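(* Let $(\eta_t)_{t\in\mathbb{R}}$ be the process of $N$ stones on the circle $\mathbb{Z}/L\mathbb{Z}$ obtained by coupling the maximal entropy measure of the two-sided stone-jumping topological Markov chain with a Poisson process on $\mathbb{R}$ of constant intensity $e^h=\frac{\sin(\pi N/L)}{\sin(\pi/L)}$ that provides the jump moments. Then the probability that stones are present at positions $k_1,\dots,k_n$ at times $t_1,\dots,t_n$ (i.e. that $k_a\in\eta_{t_a}$ for all $a=1,\dots,n$) is equal to the determinant $$\det\big(\tilde K(t_a-t_b,\;k_a-k_b)\big)_{a,b=1,\dots,n},$$ where for odd $N=2m+1$, with $\zeta_r=e^{2\pi i r/L}$, $$\tilde K(t,k)=\begin{cases}\ \ \frac1L\sum_{r=-m}^{m}e^{-t\zeta_r}e^{-2\pi i k r/L}, & t>0,\\[2pt] -\frac1L\sum_{r=m+1}^{L-m-1}e^{-t\zeta_r}e^{-2\pi i k r/L}, & t\le 0,\end{cases}$$ and for even $N=2m$, with $\zeta_r=e^{2\pi i (r+1/2)/L}$, $$\tilde K(t,k)=\begin{cases}\ \ \frac1L\sum_{r=-m}^{m-1}e^{-t\zeta_r}e^{-2\pi i k r/L}, & t>0,\\[2pt] -\frac1L\sum_{r=m}^{L-m-1}e^{-t\zeta_r}e^{-2\pi i k r/L}, & t\le 0.\end{cases}$$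
   Context: **Topological Markov chain.** Fix the number $L$ of holes on a circle and the number $N$ of stones, $1\le N\le L-1$. States are $N$-element subsets $S\subset\mathbb{Z}/L\mathbb{Z}$ (the holes occupied by stones). A transition $S\to S'$ is allowed iff $S'=(S\setminus\{k\})\cup\{k+1\}$ for some $k\in S$ with $k+1\notin S$ (one stone jumps to the next hole in the positive direction, if that hole is empty). Let $(X_i)_{i\in\mathbb{Z}}$ be distributed according to the maximal entropy measure (Parry measure) of the two-sided chain, i.e. the shift-invariant probability measure of maximal entropy on bi-infinite sequences of states with all consecutive transitions allowed. The entropy of the chain is $h=\log\frac{\sin(\pi N/L)}{\sin(\pi/L)}$. **The process.** Let $\dots<s_{-1}<s_0\le0<s_1<\dots$ be the points of a Poisson process on $\mathbb{R}$ of intensity $e^h$, independent of $(X_i)$. Set $\eta_t=X_i$ for $t\in[s_i,s_{i+1})$; thus $\eta_t\subset\mathbb{Z}/L\mathbb{Z}$ is the set of stone positions at time $t$. (This process arises as the $\varepsilon\to0$ limit, with time rescaled by $\varepsilon$, of random dimer covers of a hexagonal graph on a cylinder in which the edges encoding jumps have weight $\varepsilon$ and all other edges have weight $1$.)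
   Formalization: The printed formula fails for n=1 and for the jump direction, so the kernel's first branch is used for t≥0 (second for t<0), the matrix entries are K̃(t_a−t_b, k_b−k_a), and the space-time points (t_a,k_a) are assumed pairwise distinct. *)

(* Defs.v *)
From HB Require Import structures.
From mathcomp Require Import all_boot all_order all_algebra.
From mathcomp Require Import complex.
From mathcomp Require Import all_classical all_reals all_analysis.

Set Implicit Arguments.
Unset Strict Implicit.
Unset Printing Implicit Defensive.

Import Order.TTheory GRing.Theory Num.Theory.
Import numFieldNormedType.Exports.

Local Open Scope classical_set_scope.
Local Open Scope ring_scope.

HB.instance Definition _ (T : finType) := isPointed.Build {set T} finset.set0.

Definition coord_cylinders (E : Type) (G : set (set E)) : set (set (int -> E)) :=
  [set C | exists i : int, exists2 B, G B & C = [set x | B (x i)]].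

(* E^Z with the product of the sigma-algebras generated by G in each
   coordinate *)
Notation biseq G := (g_sigma_algebraType (coord_cylinders G)).

(* For 1 < L, the type 'Z_L is Z/LZ; the finite set of states is discrete. *)
Notation state_seq L := (biseq [set: set {set 'Z_L}]).

Notation real_seq R := (biseq (@measurable _ R)).

Definition jump (L : nat) (S S' : {set 'Z_L}) : bool :=
  [exists k : 'Z_L,
    [&& k \in S, k + 1 \notin S & S' == ((k + 1) |: (S :\ k))%SET]].

Definition chain_paths (L N : nat) : set (state_seq L) :=
  [set x : state_seq L | forall i : int, #|x i| = N /\ jump (x i) (x (i + 1))].

Definition seq_shift (L : nat) (x : state_seq L) : state_seq L :=
  fun i => x (i + 1).

Section Entropy.
Variables (R : realType) (L : nat).
Implicit Types mu nu : probability (state_seq L) R.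

Definition word_prob mu n (w : {ffun 'I_n -> {set 'Z_L}}) : R :=
  fine (mu [set x | forall j : 'I_n, x j%:Z = w j]).

(* ln 0 = 0, so words of probability 0 do not contribute *)
Definition block_entropy mu (n : nat) : R :=
  - \sum_(w : {ffun 'I_n -> {set 'Z_L}}) word_prob mu w * ln (word_prob mu w).

Definition entropy mu : R := limn (fun n => block_entropy mu n / n%:R).

Definition chain_invariant (N : nat) mu : Prop :=
  mu (@chain_paths L N) = 1%E /\
  forall A : set (state_seq L), measurable A -> mu (@seq_shift L @^-1` A) = mu A.

Definition max_entropy_measure (N : nat) mu : Prop :=
  chain_invariant N mu /\
  forall nu, chain_invariant N nu -> entropy nu <= entropy mu.

End Entropy.

(* [poisson_pmf] has the value 1 at rate 0, which is wrong for the count of a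
   Lebesgue-null set; hence the explicit formula (with 0 ^+ 0 = 1). *)
Definition poisson_weight (R : realType) (rate : R) (k : nat) : R :=
  rate ^+ k / k`!%:R * expR (- rate).

(* The increasing enumeration ... < s_{-1} < s_0 <= 0 < s_1 < ... of a
   homogeneous Poisson process: the numbers of points in disjoint Borel sets of
   finite measure are independent Poisson variables. *)
Definition poisson_points (R : realType) d (T : measurableType d)
    (P : probability T R) (lam : R) (s : T -> real_seq R) : Prop :=
  [/\ forall (w : T) (i : int), s w i < s w (i + 1),
      forall w : T, s w 0 <= 0 < s w 1 &
      forall (n : nat) (A : 'I_n -> set R) (c : 'I_n -> nat),
        (forall j, measurable (A j)) ->
        (forall j, (lebesgue_measure (A j) < +oo)%E) ->
        trivIset setT A ->
        P [set w | forall j, ([set i : int | A j (s w i)] #= `I_(c j))%card] =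
        (\prod_(j < n)
           poisson_weight (lam * fine (lebesgue_measure (A j))) (c j))%:E].

Definition independent_rv (R : realType) d d1 d2 (T : measurableType d)
    (T1 : measurableType d1) (T2 : measurableType d2) (P : probability T R)
    (X : T -> T1) (Y : T -> T2) : Prop :=
  forall (A : set T1) (B : set T2), measurable A -> measurable B ->
    P (X @^-1` A `&` Y @^-1` B) = (P (X @^-1` A) * P (Y @^-1` B))%E.

(* eta_t = x_i for t in [s_i, s_{i+1}); the default set0 is used only if no
   such i exists, which for Poisson points has probability 0. *)
Definition stones (R : realType) (L : nat) (x : state_seq L) (s : real_seq R)
    (t : R) : {set 'Z_L} :=
  xget finset.set0 [set S | exists i : int, s i <= t < s (i + 1) /\ S = x i].

Section Kernel.
Variables (R : realType) (L N : nat).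

Definition cexp (z : R[i]) : R[i] :=
  (expR (complex.Re z) * cos (complex.Im z) +i*
   (expR (complex.Re z) * sin (complex.Im z)))%C.

(* exp (2 pi i a / L) *)
Definition unit_root (a : R) : R[i] := cexp (0 +i* (2 * pi * a / L%:R))%C.

Definition zeta (r : int) : R[i] :=
  unit_root (r%:~R + (if odd N then 0 else 2^-1)).

(* As r is an integer, the phase depends only on the class of k mod L. *)
Definition kernel_term (t : R) (k : 'Z_L) (r : int) : R[i] :=
  cexp (- (t%:C)%C * zeta r) * unit_root (- (k%:R * r%:~R)).

(* The value at t = 0 is that of the first branch: it makes K(0, 0) = N / L.
   The shifted index j - m runs over -m, ..., m for N = 2 m + 1 and over
   -m, ..., m - 1 for N = 2 m. For stones jumping from k to k + 1, the
   correlation matrix has entries K(t_a - t_b, k_b - k_a); with k_a - k_b the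
   same K describes stones jumping from k to k - 1. *)
Definition stone_kernel (t : R) (k : 'Z_L) : R[i] :=
  let m := N./2 in
  if odd N then
    if 0 <= t
    then L%:R^-1 * \sum_(0 <= j < (2 * m).+1) kernel_term t k (j%:Z - m%:Z)
    else - (L%:R^-1 * \sum_(m.+1 <= r < L - m) kernel_term t k r%:Z)
  else
    if 0 <= t
    then L%:R^-1 * \sum_(0 <= j < 2 * m) kernel_term t k (j%:Z - m%:Z)
    else - (L%:R^-1 * \sum_(m <= r < L - m) kernel_term t k r%:Z).

End Kernel.

(* Main.v *)
(* The stones behave as free fermions. Slater determinants of plane waves on
   Z/LZ, multiplied by the conjugate phase of the determinant of the N waves with
   smallest momenta, are eigenvectors of the adjacency matrix A of the chain,
   with the sums of the zeta_r as eigenvalues. For the N smallest momenta this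
   gives the positive eigenvector r, the Vandermonde modulus, with eigenvalue
   lambda = sin (pi N / L) / sin (pi / L).

   Entropy: for a stationary law, Gibbs' inequality against the Markov kernel
   A(x, y) r(y) / (lambda r(x)) bounds the entropy by log lambda. In the case of
   equality the law is Markov with this kernel, and its one-point marginal is
   r^2 / L^N because every state leads to one fixed state. The Markov law exists,
   so the measure of maximal entropy has these word probabilities.

   Poissonization: with jumps at rate lambda, the factor lambda^-c of a path with
   c jumps cancels against the Poisson weights, and the law of the stones at
   sorted times is L^-N r exp ((t_2 - t_1)(A - lambda)) ... r.

   Determinant: exp (x A) acts on Slater determinants through one-particle
   evolution operators, and inserting 1 + u 1_[k_a occupied] multiplies the
   one-particle operator by a rank-one perturbation of 1. Hence the generating
   function of the occupations is a determinant of a product of rank-one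
   perturbations compressed to the N lowest momenta, which equals
   det (1 + u K), K the n x n matrix of the kernel; the coefficient of u^n is the
   probability of the theorem. *)

Require Import Defs.
From mathcomp Require Import all_boot all_order all_algebra all_fingroup.
From mathcomp Require Import complex.
From mathcomp Require Import all_classical all_reals all_analysis.
From mathcomp Require Import ring lra zify.

Set Implicit Arguments.
Unset Strict Implicit.
Unset Printing Implicit Defensive.

Import Order.TTheory GRing.Theory Num.Theory.
Import numFieldNormedType.Exports.

Local Open Scope classical_set_scope.
Local Open Scope ring_scope.

(** * Determinants *)

(** Labelling stones on a circle is not canonical: after a full turn the labels are permuted
    cyclically, with sign (-1)^(N-1), while weights of sets must be symmetric. The phase of one
    fixed determinant absorbs this sign, at the price of a constant rotation per jump.

    The adjacency matrix is real and nonnegative but its eigenvectors are complex, and the complex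
    exponential is given through sine and cosine. So all limits are taken in R, for real and
    imaginary parts separately, and the algebra is done on finite sums.

    Infinite sums over numbers of jumps are avoided as well. Histories with fewer than M jumps
    between consecutive times bound the probability of a sequence of states from below; in the limit
    these bounds have total 1, so they are equalities.

    The enumerated points are not assumed to be unbounded, so a time might lie in no interval [s_i,
    s_{i+1}). That this has probability 0 is deduced from the Poisson counts. *)

Section Determinants.
Variable K : comUnitRingType.

(** Multilinearity in all rows at once. It yields the Andreief identity and, in [desc_fourier], the
    expansion of Slater determinants in plane waves. *)
Lemma det_sum_rows (G : finType) N (c : 'I_N -> G -> K) (B : G -> 'I_N -> K) :
  \sum_(h : {ffun 'I_N -> G})
     (\prod_i c i (h i)) * \det (\matrix_(i, j) B (h i) j) =
  \det (\matrix_(i, j) \sum_x c i x * B x j).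
Proof.
rewrite {2}/determinant.
under [RHS]eq_bigr => s _.
  under eq_bigr => i _ do rewrite mxE.
  rewrite (bigA_distr_bigA (fun i x => c i x * B x (s i))) mulr_sumr.
  over.
rewrite exchange_big; apply: eq_bigr => h _; rewrite /determinant mulr_sumr.
apply: eq_bigr => s _; rewrite big_split /= mulrCA.
by congr (_ * (_ * _)); apply: eq_bigr => i _; rewrite mxE.
Qed.

(** Cauchy-Binet over all functions instead of subsets, hence the factorial. When the first
    determinant is expanded, every permutation contributes the same term, since its sign comes back
    squared. *)
Lemma andreief (G : finType) N (A B : G -> 'I_N -> K) :
  \sum_(h : {ffun 'I_N -> G})
     \det (\matrix_(i, j) A (h i) j) * \det (\matrix_(i, j) B (h i) j) =
  N`!%:R * \det (\matrix_(i, j) \sum_x A x i * B x j).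
Proof.
under eq_bigr => h _ do rewrite {1}/determinant mulr_suml.
rewrite exchange_big /=.
transitivity (\sum_(s : {perm 'I_N})
   \det (\matrix_(i, j) \sum_x A x i * B x j)); last first.
  by rewrite sumr_const card_Sn mulr_natl.
apply: eq_bigr => s _.
under eq_bigr => h _.
  rewrite -mulrA; under eq_bigr => i _ do rewrite mxE.
  over.
rewrite -mulr_sumr (det_sum_rows (fun i x => A x (s i))).
have -> : \matrix_(i, j) (\sum_x A x (s i) * B x j) =
  row_perm s (\matrix_(i, j) \sum_x A x i * B x j).
  by apply/matrixP => i j; rewrite !mxE.
by rewrite row_permE det_mulmx det_perm mulrA -expr2 sqrr_sign mul1r.
Qed.

(** The derivative at s = 0 of scaling each column j by 1 + s z_j, taken row by row. This is how
    one-particle energies add up when a single stone jumps. *)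
Lemma sum_det_scale_row N (z : 'I_N -> K) (B : 'I_N -> 'I_N -> K) :
  \sum_i \det (\matrix_(i', j) ((if i' == i then z j else 1) * B i' j)) =
  (\sum_j z j) * \det (\matrix_(i, j) B i j).
Proof.
under eq_bigr => i _.
  rewrite (expand_det_row _ i).
  under eq_bigr => j _.
    rewrite mxE eqxx -mulrA.
    rewrite (_ : cofactor _ i j = cofactor (\matrix_(i, j) B i j) i j); last first.
      rewrite /cofactor; congr (_ * \det _); apply/matrixP => a b.
      by rewrite !mxE eq_sym (negPf (neq_lift _ _)) mul1r.
    over.
  over.
rewrite exchange_big mulr_suml; apply: eq_bigr => j _.
rewrite -mulr_sumr (expand_det_col _ j).
by congr (_ * _); apply: eq_bigr => i _; rewrite mxE.
Qed.

(** Sylvester's identity: the same two block matrices, multiplied in both orders, give block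
    triangular products with the two determinants. *)
Lemma det_1D_comm m n (A : 'M[K]_(m, n)) (B : 'M[K]_(n, m)) :
  \det (1%:M + A *m B) = \det (1%:M + B *m A).
Proof.
have E1 : block_mx 1%:M (- A) B 1%:M *m block_mx 1%:M A 0 1%:M =
          block_mx 1%:M 0 B (1%:M + B *m A).
  rewrite mulmx_block !mul1mx !mulmx0 !mulmx1 !addr0.
  by rewrite subrr addrC.
have E2 : block_mx 1%:M A 0 1%:M *m block_mx 1%:M (- A) B 1%:M =
          block_mx (1%:M + A *m B) 0 B 1%:M.
  by rewrite mulmx_block !mul1mx !mul0mx !mulmx1 add0r addNr add0r.
have := congr1 determinant E1; have := congr1 determinant E2.
rewrite !det_mulmx !det_ublock !det_lblock !det1 !mul1r !mulr1.
by move=> -> ->.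
Qed.

(** Suffix products with the smallest index leftmost: the induction over the times runs from the
    last to the first and multiplies on the left. *)
Definition rank1_prod q n (X : 'M[K]_(q, n)) (Y : 'M[K]_(n, q)) u (j : nat) :=
  foldr (fun a M => (1%:M + u *: (col a X *m row a Y)) *m M) 1%:M
    (drop j (enum 'I_n)).

Definition strict_upper n (M : 'M[K]_n) : 'M[K]_n :=
  \matrix_(a, b) (if (a < b)%N then M a b else 0).

Lemma rank1_prod_step q n (X : 'M[K]_(q, n)) (Y : 'M[K]_(n, q)) u (a : 'I_n) :
  rank1_prod X Y u a =
  (1%:M + u *: (col a X *m row a Y)) *m rank1_prod X Y u a.+1.
Proof.
rewrite /rank1_prod (drop_nth a) ?size_enum_ord //=.
by rewrite nth_ord_enum.
Qed.

Lemma rank1_prod_end q n (X : 'M[K]_(q, n)) (Y : 'M[K]_(n, q)) u :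
  rank1_prod X Y u n = 1%:M.
Proof. by rewrite /rank1_prod drop_oversize // size_enum_ord. Qed.

(** Telescoping: the term of a takes 1 from the factors to the left of factor a, its rank-one part
    from factor a, and all that follows unexpanded. *)
Lemma rank1_prodE q n (X : 'M[K]_(q, n)) (Y : 'M[K]_(n, q)) u j :
  (j <= n)%N ->
  rank1_prod X Y u j = 1%:M +
  u *: (\sum_(a < n | (j <= a)%N) col a X *m row a Y *m rank1_prod X Y u a.+1).
Proof.
move=> jn; rewrite -(subKn jn); elim: (n - j)%N (leq_subr j n) => [|d IH] dn.
  rewrite subn0 rank1_prod_end big_pred0 ?scaler0 ?addr0 // => a.
  by rewrite leqNgt ltn_ord.
have lt : (n - d.+1 < n)%N by rewrite ltn_subrL (leq_ltn_trans _ dn).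
pose a := Ordinal lt.
have aE : a.+1 = (n - d)%N by rewrite /= subnSK.
rewrite (rank1_prod_step X Y u a) mulmxDl mul1mx aE {1}IH 1?ltnW //.
rewrite -addrA; congr (_ + _).
rewrite -scalemxAl -scalerDr; congr (_ *: _).
rewrite [RHS](bigD1 a) //= aE addrC; congr (_ + _).
apply: eq_bigl => b; rewrite -aE /= ltn_neqAle andbC eq_sym; congr (_ && _).
Qed.

Lemma det_strict_upper n (M : 'M[K]_n) u :
  \det (1%:M - u *: strict_upper M) = 1.
Proof.
rewrite -det_tr det_trig; last first.
  apply/is_trig_mxP => i j ij; rewrite !mxE.
  by rewrite -val_eqE /= (gtn_eqF ij) ltnNge (ltnW ij) /= mulr0 subr0.
by rewrite big1 // => i _; rewrite !mxE ltnn eqxx mulr0 subr0.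
Qed.

(* A product of rank-one perturbations is 1 + u X Z with (1 - u T) Z = Y, T the
   strictly upper part of Y X; then det (1 + A B) = det (1 + B A). *)
Lemma det_rank1_prod q n N (X : 'M[K]_(q, n)) (Y : 'M[K]_(n, q)) u
    (V : 'M[K]_(q, N)) (V' : 'M[K]_(N, q)) :
  V' *m V = 1%:M ->
  \det (V' *m rank1_prod X Y u 0 *m V) =
  \det (1%:M + u *: (Y *m (V *m V') *m X - strict_upper (Y *m X))).
Proof.
move=> V1; pose T := strict_upper (Y *m X).
pose Z : 'M[K]_(n, q) := \matrix_a (row a Y *m rank1_prod X Y u a.+1).
have W0 : rank1_prod X Y u 0 = 1%:M + u *: (X *m Z).
  rewrite rank1_prodE //; congr (_ + _ *: _).
  apply/matrixP => i j; rewrite summxE [RHS]mxE; apply: eq_bigr => a _.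
  by rewrite -mulmxA mxE big_ord1 [col a X _ _]mxE [in RHS]mxE.
have ZY : (1%:M - u *: T) *m Z = Y.
  rewrite mulmxBl mul1mx; apply/eqP; rewrite subr_eq; apply/eqP.
  apply/row_matrixP => a; rewrite rowK rank1_prodE // mulmxDr mulmx1 linearD /=.
  congr (_ + _); rewrite -scalemxAr -scalemxAl linearZ /=; congr (_ *: _).
  rewrite mulmx_sumr row_mul mulmx_sum_row [RHS](bigID (fun b : 'I_n => (a < b)%N)) /=.
  rewrite [X in _ = _ + X]big1 ?addr0 => [|b ab]; last first.
    by rewrite !mxE (negPf ab) scale0r.
  apply: eq_bigr => b ab; rewrite rowK !mulmxA -mulmxA -[RHS]mul_scalar_mx.
  congr (_ *m _); apply/matrixP => i j; rewrite !ord1 !mxE ab eqxx mulr1n.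
  by apply: eq_bigr => c _; rewrite !mxE.
have -> : V' *m rank1_prod X Y u 0 *m V = 1%:M + (u *: (V' *m X)) *m (Z *m V).
  by rewrite W0 mulmxDr mulmx1 mulmxDl V1 -!scalemxAr -!scalemxAl !mulmxA.
rewrite det_1D_comm -[LHS]mul1r -[X in X * _ = _](det_strict_upper (Y *m X) u).
rewrite -det_mulmx.
congr (\det _); rewrite -/T mulmxDr mulmx1 -!scalemxAr !mulmxA ZY.
by rewrite scalerBr addrAC addrA.
Qed.

End Determinants.

(* The coefficient of u^n on both sides, read off by evaluating the reversed
   polynomials at 0. *)
Lemma top_coef_det (K : numFieldType) (I : finType) n (p : I -> K)
    (b : I -> 'I_n -> bool) (M : 'M[K]_n) :
  (forall u, \sum_i p i * \prod_a (1 + u * (b i a)%:R) = \det (1%:M + u *: M)) ->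
  \sum_i p i * (\prod_a (b i a)%:R) = \det M.
Proof.
move=> pM.
pose P1 : {poly K} := \sum_i p i *: \prod_a ('X + (b i a)%:R%:P).
pose P2 : {poly K} := \det ('X%:M + map_mx polyC M).
have P1E e : P1.[e] = \sum_i p i * \prod_a (e + (b i a)%:R).
  rewrite horner_sum; apply: eq_bigr => i _; rewrite hornerZ horner_prod.
  by congr (_ * _); apply: eq_bigr => a _; rewrite hornerD hornerX hornerC.
have P2E e : P2.[e] = \det (e%:M + M).
  rewrite -[LHS]/(horner_eval e P2) -det_map_mx; congr (\det _).
  apply/matrixP => i j; rewrite !mxE /= /horner_eval hornerD hornerC.
  by rewrite hornerMn hornerX.
suff P12 : P1 = P2.
  have := P1E 0; rewrite P12 P2E raddf0 add0r => ->.
  by apply: eq_bigr => i _; congr (_ * _); apply: eq_bigr => a _; rewrite add0r.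
apply/eqP; rewrite -subr_eq0; apply: contraT => nz.
(* For e = 1, 2, ... the hypothesis at u = 1 / e makes e a root of the difference; these are more
   roots than its size allows. *)
have := max_poly_roots (rs := [seq i.+1%:R | i <- iota 0 (size (P1 - P2))]) nz.
rewrite size_map size_iota ltnn; apply; last first.
  by rewrite map_inj_uniq ?iota_uniq // => i j /eqP; rewrite eqr_nat => /eqP[].
apply/allP => _ /mapP[i _ ->]; rewrite rootE hornerD hornerN P1E P2E subr_eq0.
set e : K := _%:R; have e0 : e != 0 by rewrite pnatr_eq0.
have -> : e%:M + M = e *: (1%:M + e^-1 *: M).
  by rewrite scalerDr scalerA mulfV // scale1r scale_scalar_mx mulr1.
rewrite detZ -pM mulr_sumr; apply/eqP/eq_bigr => j _; rewrite mulrCA.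
congr (_ * _); rewrite -[in e ^+ n](card_ord n) -prodr_const -big_split /=.
by apply: eq_bigr => a _; rewrite mulrDr mulr1 mulrA mulfV // mul1r.
Qed.

(** * The complex exponential and roots of unity *)

Definition exp_psum (K : fieldType) (z : K) (M : nat) : K :=
  \sum_(c < M) (c`!%:R)^-1 * z ^+ c.

(** In the product of two partial sums the terms with p + q < M form the partial sum at x + y. The
    coefficients of the rest are nonnegative, so its modulus is controlled by its value at |x| and
    |y|. *)
Lemma exp_psumD (K : numFieldType) (x y : K) M :
  exp_psum x M * exp_psum y M - exp_psum (x + y) M =
  \sum_(p < M) \sum_(q < M | (M <= p + q)%N)
     ((p`!%:R)^-1 * x ^+ p) * ((q`!%:R)^-1 * y ^+ q).
Proof.
pose f (p q : nat) := ((p`!%:R)^-1 * x ^+ p) * ((q`!%:R)^-1 * y ^+ q).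
have fact0 c : (c`!%:R : K) != 0 by rewrite pnatr_eq0 -lt0n fact_gt0.
have -> : exp_psum (x + y) M =
    \sum_(p < M) \sum_(q < M | ~~ (M <= p + q)%N) f p q.
  transitivity (\sum_(c < M) \sum_(p < M) \sum_(q < M)
      if (p + q == c)%N then f p q else 0).
    apply: eq_bigr => c _; rewrite addrC exprDn mulr_sumr.
    rewrite (big_ord_widen M
      (fun p => (c`!%:R)^-1 * (y ^+ (c - p) * x ^+ p *+ 'C(c, p)))) //.
    rewrite big_mkcond; apply: eq_bigr => p _; rewrite ltnS.
    case: leqP => [pc|cp]; last first.
      rewrite big1 // => q _; case: eqP => // E.
      by move: cp; rewrite -E ltnNge leq_addr.
    have qM : (c - p < M)%N by apply: leq_ltn_trans (leq_subr _ _) (ltn_ord c).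
    rewrite (bigD1 (Ordinal qM)) //= subnKC // eqxx big1 ?addr0; last first.
      move=> q; rewrite -val_eqE /= => qc; case: eqP => // E.
      by move: qc; rewrite -E addKn eqxx.
    rewrite /f -(bin_fact pc) !natrM !invfM -mulr_natr.
    have b0 : ('C(c, p)%:R : K) != 0 by rewrite pnatr_eq0 -lt0n bin_gt0.
    by field; rewrite b0 !fact0.
  rewrite exchange_big; apply: eq_bigr => p _; rewrite exchange_big /=.
  rewrite [RHS]big_mkcond; apply: eq_bigr => q _; rewrite -ltnNge.
  case: ifPn => pq; last first.
    rewrite big1 // => c _; case: eqP => // E.
    by move: pq; rewrite E ltn_ord.
  rewrite (bigD1 (Ordinal pq)) //= eqxx big1 ?addr0 // => c.
  by rewrite -val_eqE /= eq_sym => /negPf ->.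
rewrite /exp_psum big_distrl /= -sumrB; apply: eq_bigr => p _.
rewrite big_distrr /= (bigID (fun q : 'I_M => (M <= p + q)%N)) /=.
by rewrite addrK.
Qed.

Section ComplexExponential.
Variable R : realType.
Implicit Types (x y a b : R) (z w : R[i]).

Lemma cexpD z w : cexp (z + w) = cexp z * cexp w.
Proof.
case: z w => [a b] [c d]; rewrite /cexp /= expRD cosD sinD.
by apply/eqP; rewrite eq_complex /=; apply/andP; split; apply/eqP; ring.
Qed.

Lemma cexp0 : cexp 0 = 1 :> R[i].
Proof. by rewrite /cexp /= expR0 cos0 sin0 !mul1r. Qed.

Lemma cexp_sum (I : finType) (F : I -> R[i]) :
  cexp (\sum_i F i) = \prod_i cexp (F i).
Proof. by apply: (big_morph _ cexpD cexp0). Qed.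

Lemma conj_cexp z : (cexp z)^*%C = cexp (z^*%C).
Proof. by case: z => a b; rewrite /cexp /= cosN sinN mulrN. Qed.

Lemma cexp_real x : cexp (x%:C)%C = ((expR x)%:C)%C.
Proof. by rewrite /cexp /= cos0 sin0 mulr1 mulr0. Qed.

Lemma Re_sum (I : Type) (r : seq I) (P : pred I) (F : I -> R[i]) :
  complex.Re (\sum_(i <- r | P i) F i) = \sum_(i <- r | P i) complex.Re (F i).
Proof. by apply: (big_morph (@complex.Re R)) => // -[a b] [c d]. Qed.

Lemma Im_sum (I : Type) (r : seq I) (P : pred I) (F : I -> R[i]) :
  complex.Im (\sum_(i <- r | P i) F i) = \sum_(i <- r | P i) complex.Im (F i).
Proof. by apply: (big_morph (@complex.Im R)) => // -[a b] [c d]. Qed.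

Lemma Re_realM x z : complex.Re ((x%:C)%C * z) = x * complex.Re z.
Proof. by case: z => a b /=; rewrite mul0r subr0. Qed.

Lemma Im_realM x z : complex.Im ((x%:C)%C * z) = x * complex.Im z.
Proof. by case: z => a b /=; rewrite mul0r addr0. Qed.

Lemma exp_pow_i y c :
  (c`!%:R)^-1 * ((y *i)%C) ^+ c = (cos_coeff y c +i* sin_coeff y c)%C.
Proof.
have -> : (c`!%:R)^-1 = (((c`!%:R : R)^-1)%:C)%C :> R[i].
  by rewrite fmorphV /= rmorph_nat.
have -> : (y *i)%C = (y%:C)%C * 'i%C by apply/eqP;
  rewrite eq_complex /= !(mulr0, mul0r, mulr1, subr0, addr0) !eqxx.
rewrite exprMn -rmorphXn /=.
have -> : ('i%C : R[i]) ^+ c =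
   (((~~ odd c)%:R * (-1) ^+ c./2) +i* ((odd c)%:R * (-1) ^+ c.-1./2))%C.
  rewrite -{1}(odd_double_half c) exprD -mul2n exprM sqr_i.
  have -> : (-1) ^+ c./2 = (((-1) ^+ c./2)%:C)%C :> R[i].
    by rewrite rmorphXn /= rmorphN1.
  case: (boolP (odd c)) => oc /=; rewrite ?expr0 ?expr1; last first.
    by apply/eqP; rewrite eq_complex /=; apply/andP; split; apply/eqP; ring.
  have -> : c.-1./2 = c./2 by case: c oc => //= c; rewrite uphalf_half => /negPf ->.
  by apply/eqP; rewrite eq_complex /=; apply/andP; split; apply/eqP; ring.
rewrite /cos_coeff /sin_coeff /=; apply/eqP; rewrite eq_complex /=.
by apply/andP; split; apply/eqP; rewrite ?exprnP; ring.
Qed.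

Lemma exp_psum_i y M :
  exp_psum (y *i)%C M = (series (cos_coeff y) M +i* series (sin_coeff y) M)%C.
Proof.
rewrite /exp_psum; under eq_bigr do rewrite exp_pow_i.
apply/eqP; rewrite eq_complex Re_sum Im_sum /series /= !big_mkord.
by rewrite !eqxx.
Qed.

Lemma cvg_series_cos y : series (cos_coeff y) @ \oo --> cos y.
Proof. by rewrite unlock; exact: is_cvg_series_cos_coeff. Qed.

Lemma cvg_series_sin y : series (sin_coeff y) @ \oo --> sin y.
Proof. by rewrite unlock; exact: is_cvg_series_sin_coeff. Qed.

Lemma cvg_exp_psumR x : exp_psum x M @[M --> \oo] --> expR x.
Proof.
have -> : exp_psum x = series (exp_coeff x).
  apply/funext => M; rewrite /series /= big_mkord.
  by apply: eq_bigr => c _; rewrite mulrC.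
exact: is_cvg_series_exp_coeff.
Qed.

Lemma exp_psum_defect_le x y M :
  `|exp_psum (x%:C)%C M * exp_psum (y *i)%C M - exp_psum (x +i* y)%C M| <=
  ((exp_psum `|x| M * exp_psum `|y| M - exp_psum (`|x| + `|y|) M)%:C)%C.
Proof.
have -> : (x +i* y)%C = (x%:C)%C + (y *i)%C.
  by apply/eqP; rewrite eq_complex /= addr0 add0r !eqxx.
rewrite !exp_psumD rmorph_sum /=.
apply: le_trans (ler_norm_sum _ _ _) _; apply: ler_sum => p _.
rewrite rmorph_sum /=.
apply: le_trans (ler_norm_sum _ _ _) _; apply: ler_sum => q _.
have absC (a : R) : `|(a%:C)%C| = (`|a|%:C)%C.
  by rewrite normc_def /= expr0n addr0 sqrtr_sqr.
have absi (a : R) : `|(a *i)%C| = (`|a|%:C)%C.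
  by rewrite normc_def /= expr0n add0r sqrtr_sqr.
rewrite !rmorphM !fmorphV !rmorph_nat !rmorphXn /= !normrM !normfV !normr_nat.
by rewrite !normrX absC absi.
Qed.

(** Here phi stands for the real or the imaginary part. The bound at |x| and |y| tends to 0 because
    the real exponential is multiplicative. *)
Lemma cvg_exp_psum_defect x y (phi : R[i] -> R) :
  (forall z, (`|phi z|%:C)%C <= `|z|) ->
  phi (exp_psum (x%:C)%C M * exp_psum (y *i)%C M - exp_psum (x +i* y)%C M)
    @[M --> \oo] --> (0 : R).
Proof.
move=> phi_le.
pose D M := exp_psum `|x| M * exp_psum `|y| M - exp_psum (`|x| + `|y|) M.
have D0 : D M @[M --> \oo] --> (0 : R).
  rewrite -(subrr (expR (`|x| + `|y|))) {1}expRD.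
  by apply: cvgB; [apply: cvgM|]; exact: cvg_exp_psumR.
apply/cvgr0Pnorm_lt => e e0; move/cvgr0Pnorm_lt : D0 => /(_ e e0).
apply: filterS => M; apply: le_lt_trans.
apply: le_trans (ler_norm _); rewrite -lecR.
exact: le_trans (phi_le _) (exp_psum_defect_le _ _ _).
Qed.

(** The product of the series of exp x and exp (i y) converges to [cexp] by the real theory; the
    partial sums at x + i y differ from it by the vanishing defect. *)
Lemma cvg_exp_psum z :
  complex.Re (exp_psum z M) @[M --> \oo] --> complex.Re (cexp z) /\
  complex.Im (exp_psum z M) @[M --> \oo] --> complex.Im (cexp z).
Proof.
case: z => x y.
have ReD := @cvg_exp_psum_defect x y (@complex.Re R) (@normc_ge_Re R).
have ImD : complex.Im (exp_psum (x%:C)%C M * exp_psum (y *i)%C M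
    - exp_psum (x +i* y)%C M) @[M --> \oo] --> (0 : R).
  apply: cvg_exp_psum_defect => z; apply: le_trans (_ : _ <= `|z * 'i%C|) _.
    (* The imaginary part is, up to sign, the real part after multiplication by i, which preserves
       the modulus. *)
    by apply: le_trans (normc_ge_Re _); rewrite ReiNIm normrN.
  rewrite normrM (_ : `|'i%C| = 1) ?mulr1 //.
  by rewrite normc_def /= expr0n add0r expr1n sqrtr1.
have prodE M : exp_psum (x%:C)%C M * exp_psum (y *i)%C M =
  (exp_psum x M * series (cos_coeff y) M +i*
   (exp_psum x M * series (sin_coeff y) M))%C.
  rewrite exp_psum_i (_ : exp_psum (x%:C)%C M = ((exp_psum x M)%:C)%C).
    by apply/eqP; rewrite eq_complex /= !mul0r subr0 addr0 !eqxx.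
  rewrite /exp_psum rmorph_sum; apply: eq_bigr => c _.
  by rewrite rmorphM rmorphXn fmorphV rmorph_nat.
have subE (p q : R) : p - (p - q) = q by rewrite opprB addrCA subrr addr0.
split.
- rewrite (_ : (fun M => _) = (fun M => exp_psum x M * series (cos_coeff y) M -
    complex.Re (exp_psum (x%:C)%C M * exp_psum (y *i)%C M -
                exp_psum (x +i* y)%C M))); last first.
    by apply/funext => M; rewrite prodE; case: (exp_psum _ M) => a b /=; rewrite subE.
  rewrite -[X in _ --> X]subr0; apply: cvgB => //.
  by apply: cvgM; [exact: cvg_exp_psumR | exact: cvg_series_cos].
- rewrite (_ : (fun M => _) = (fun M => exp_psum x M * series (sin_coeff y) M -
    complex.Im (exp_psum (x%:C)%C M * exp_psum (y *i)%C M -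
                exp_psum (x +i* y)%C M))); last first.
    by apply/funext => M; rewrite prodE; case: (exp_psum _ M) => a b /=; rewrite subE.
  rewrite -[X in _ --> X]subr0; apply: cvgB => //.
  by apply: cvgM; [exact: cvg_exp_psumR | exact: cvg_series_sin].
Qed.

End ComplexExponential.

Section UnitRoots.
Variables (R : realType) (L : nat).
Hypothesis L_gt1 : (1 < L)%N.
Local Notation C := R[i].
Local Notation e := (@unit_root R L).

Lemma LR_neq0 : (L%:R : R) != 0.
Proof. by rewrite pnatr_eq0 -lt0n ltnW. Qed.

Lemma unit_rootD a b : e (a + b) = e a * e b.
Proof.
rewrite /unit_root -cexpD; congr cexp; apply/eqP; rewrite eq_complex /= addr0 eqxx /=.
by apply/eqP; ring.
Qed.

Lemma unit_root0 : e 0 = 1.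
Proof. by rewrite /unit_root mulr0 mul0r cexp0. Qed.

Lemma unit_rootN a : e (- a) = (e a)^*%C.
Proof. by rewrite /unit_root conj_cexp /= mulrN mulNr. Qed.

Lemma unit_root_mulN a : e a * e (- a) = 1.
Proof. by rewrite -unit_rootD subrr unit_root0. Qed.

Lemma unit_root_neq0 a : e a != 0.
Proof. by apply: contra_eq_neq (unit_root_mulN a) => ->; rewrite mul0r eq_sym oner_eq0. Qed.

Lemma norm_unit_root a : `|e a| = 1.
Proof.
rewrite normc_def; have := congr1 (@complex.Re R) (unit_root_mulN a).
by rewrite unit_rootN; case: (e a) => x y /=; rewrite mulrN opprK !expr2 => ->; rewrite sqrtr1.
Qed.

Lemma unit_root_mulrn a n : e (a *+ n) = e a ^+ n.
Proof.
elim: n => [|n IH]; first by rewrite unit_root0.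
by rewrite mulrS unit_rootD IH exprS.
Qed.

Lemma unit_root_period (r : int) : e (L%:R * r%:~R) = 1.
Proof.
have e1 : e L%:R = 1.
  rewrite /unit_root mulfK ?LR_neq0 // /cexp /= expR0 !mul1r -[2]/(1 + 1).
  by rewrite mulrDl mul1r -mulr2n cos2pi sin2pi.
case: r => n; first by rewrite mulr_natr unit_root_mulrn e1 expr1n.
by rewrite NegzE mulrNz mulrN unit_rootN mulr_natr unit_root_mulrn e1 expr1n conjc1.
Qed.

Lemma unit_root_modn n (r : int) : e ((n %% L)%N%:R * r%:~R) = e (n%:R * r%:~R).
Proof.
rewrite [in RHS](divn_eq n L) natrD mulrDl unit_rootD natrM.
rewrite [_ * L%:R]mulrC -mulrA.
have -> : ((n %/ L)%N%:R * r%:~R : R) = ((n %/ L)%N%:Z * r)%:~R by rewrite intrM.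
by rewrite unit_root_period mul1r.
Qed.

Lemma val_ZpD (x y : 'Z_L) : (x + y)%R = ((x + y) %% L)%N :> nat.
Proof. by congr (_ %% _)%N; exact: Zp_cast. Qed.

Lemma val_Zp1 : nat_of_ord (1 : 'Z_L) = 1%N.
Proof. by []. Qed.

Lemma unit_root_ZpD (x y : 'Z_L) (r : int) :
  e ((x + y)%R%:R * r%:~R) = e (x%:R * r%:~R) * e (y%:R * r%:~R).
Proof. by rewrite val_ZpD unit_root_modn natrD mulrDl unit_rootD. Qed.

Lemma unit_root_ZpN (x : 'Z_L) (r : int) :
  e ((- x)%R%:R * r%:~R) = e (- (x%:R * r%:~R)).
Proof.
have := unit_root_ZpD x (- x) r; rewrite subrr mul0r unit_root0.
rewrite -(unit_root_mulN (x%:R * r%:~R)) => /mulfI -> //.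
exact: unit_root_neq0.
Qed.

(** Separates the half-angle phase of a chord of the circle from its signed length, so that
    positivity becomes a matter of signs of sines. *)
Lemma unit_root_chord a :
  e a - 1 = e (a / 2) * (0 +i* (2 * sin (pi * a / L%:R)))%C.
Proof.
have aE : a = a / 2 + a / 2 by rewrite -splitr.
rewrite {1}aE unit_rootD -[X in _ - X](unit_root_mulN (a / 2)) -mulrBr; congr (_ * _).
rewrite unit_rootN /unit_root /cexp /= expR0 !mul1r.
have -> : 2 * pi * (a / 2) / L%:R = pi * a / L%:R.
  by field; rewrite LR_neq0.
by apply/eqP; rewrite eq_complex /=; apply/andP; split; apply/eqP; ring.
Qed.

Lemma sin_pi_gt0 a : 0 < a < L%:R -> 0 < sin (pi * a / L%:R) :> R.
Proof.
move=> /andP[a0 aL]; apply: sin_gt0_pi.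
have L0 : (0 : R) < L%:R by rewrite ltr0n ltnW.
rewrite divr_gt0 ?mulr_gt0 ?pi_gt0 //=.
by rewrite ltr_pdivrMr // ltr_pM2l ?pi_gt0.
Qed.

Lemma unit_root_neq1 (a : R) : 0 < `|a| < L%:R -> e a != 1.
Proof.
move=> aL; rewrite -subr_eq0 unit_root_chord mulf_neq0 ?unit_root_neq0 //.
rewrite eq_complex /= eqxx /= mulf_neq0 ?pnatr_eq0 //.
have s0 := lt0r_neq0 (sin_pi_gt0 aL).
have [a0|a0] := leP 0 a; first by move: s0; rewrite ger0_norm.
by move: s0; rewrite ltr0_norm // mulrN mulNr sinN oppr_eq0.
Qed.

(* m = N / 2 shifts the momenta so that the occupied ones are the h < N. *)
Definition plane_wave (m : nat) (x h : 'Z_L) : C := e (x%:R * (h%:Z - m%:Z)%:~R).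

Lemma card_Zp : #|'Z_L| = L.
Proof. by rewrite card_ord Zp_cast. Qed.

(** A geometric sum whose ratio is an L-th root of unity, different from 1 when h and h' differ
    because then 0 < |h' - h| < L. *)
Lemma plane_wave_orthogonal m (h h' : 'Z_L) :
  \sum_x (plane_wave m x h)^*%C * plane_wave m x h' = L%:R * (h == h')%:R.
Proof.
pose z := e ((h'%:Z - h%:Z)%:~R).
have -> : \sum_x (plane_wave m x h)^*%C * plane_wave m x h' = \sum_(x : 'Z_L) z ^+ x.
  apply: eq_bigr => x _; rewrite /plane_wave -unit_rootN -unit_rootD.
  rewrite -unit_root_mulrn; congr e; rewrite -[in RHS]mulr_natl !intrD !intrN /=.
  by ring.
case: (eqVneq h h') => [hE|hh'] /=.
  have -> : z = 1 by rewrite /z hE subrr unit_root0.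
  by under eq_bigr do rewrite expr1n; rewrite sumr_const card_Zp mulr1.
have hL (x : 'Z_L) : (x < L)%N by rewrite -[X in (_ < X)%N](Zp_cast L_gt1).
have z1 : z != 1.
  have hn : (h : nat) <> h' by move/val_inj => E; rewrite E eqxx in hh'.
  apply: unit_root_neq1; rewrite -intr_norm ltr0z -[L%:R]/(L%:Z%:~R) ltr_int.
  by have := hL h; have := hL h'; lia.
rewrite mulr0; apply/eqP; have /eqP := subrX1 z L.
rewrite -{1}unit_root_mulrn -mulr_natl unit_root_period subrr eq_sym mulf_eq0.
by rewrite subr_eq0 (negPf z1) /= -(big_mkord xpredT (fun i => z ^+ i)) -{1}(Zp_cast L_gt1) big_mkord.
Qed.

End UnitRoots.

#[local] Arguments unit_root : simpl never.
#[local] Arguments conjc : simpl never.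

(** * Slater determinants and the Perron-Frobenius eigenvector *)

Section Slater.
Variables (R : realType) (L N : nat).
Hypotheses (L_gt1 : (1 < L)%N) (N_gt0 : (0 < N)%N) (N_ltL : (N < L)%N).
Local Notation C := R[i].
Local Notation e := (@unit_root R L).
Local Notation m := (N./2).

Lemma ltn_Zp (x : 'Z_L) : (x < L)%N.
Proof. by rewrite -[X in (_ < X)%N](Zp_cast L_gt1). Qed.

(** Moving one end of a chord by one hole turns its direction by exactly half a step (inscribed
    angle), which [e (- 2^-1)] undoes. The signed lengths keep their sign, as d and d + 1 both lie
    in (0, L) or both in (-L, 0): the stone at x neither meets nor passes the one at y. *)
Lemma chord_product_gt0 (x y : 'Z_L) : x != y -> x + 1 != y ->
  0 < e (- 2^-1) * ((e (x + 1)%R%:R - e y%:R) * (e x%:R - e y%:R)^*%C).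
Proof.
move=> xy x1y; pose d : R := x%:R - y%:R.
have -> : e (x + 1)%R%:R = e 1 * e x%:R.
  have := unit_root_ZpD R L_gt1 x 1 1; rewrite !mulr1 => ->.
  by rewrite mulrC val_Zp1.
have -> : e 1 * e x%:R - e y%:R = e y%:R * (e (d + 1) - 1).
  by rewrite mulrBr mulr1 -!unit_rootD; congr (e _ - _); rewrite /d; ring.
have -> : e x%:R - e y%:R = e y%:R * (e d - 1).
  by rewrite mulrBr mulr1 -!unit_rootD; congr (e _ - _); rewrite /d; ring.
rewrite rmorphM /= mulrACA.
rewrite -unit_rootN unit_root_mulN [X in _ < _ * X]mul1r.
rewrite !(unit_root_chord L_gt1) rmorphM /= -unit_rootN mulrACA -unit_rootD.
rewrite [X in _ < X]mulrA -unit_rootD.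
have -> : - 2^-1 + ((d + 1) / 2 + - (d / 2)) = 0 :> R by field.
rewrite unit_root0 mul1r ltcE /=; apply/andP; split; first by apply/eqP; ring.
rewrite mul0r mulrN opprK add0r.
suff : 0 < sin (pi * (d + 1) / L%:R) * sin (pi * d / L%:R) by nra.
have xL := ltn_Zp x; have yL := ltn_Zp y.
have {}xy : (x : nat) <> y by move/val_inj => E; rewrite E eqxx in xy.
have {}x1y : ((x + 1) %% L)%N <> y.
  move=> E; case/eqP: x1y; apply/val_inj.
  by rewrite [LHS]val_ZpD // val_Zp1.
have [yx|xy'] := ltnP y x.
  (* Wrap-around: if x = L - 1 then x + 1 is the hole 0, so y is not 0 and still d + 1 < L. *)
  have x1L : (x.+1 < L)%N || (0 < y)%N.
    case: ltnP => //= Lx; rewrite lt0n; apply/eqP => y0.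
    by apply: x1y; rewrite y0 addn1 (_ : x.+1 = L) ?modnn //; lia.
  have d0 : 0 < d by rewrite subr_gt0 ltr_nat.
  have dL : d + 1 < L%:R.
    by rewrite /d addrAC ltrBlDr -natrD -[1]/(1%:R) -natrD ltr_nat; lia.
  by rewrite mulr_gt0 // (sin_pi_gt0 L_gt1) //; lra.
have {xy xy' x1y}xy : (x.+1 < y)%N.
  have x1 : (x.+1 < L)%N by lia.
  by move: x1y; rewrite addn1 modn_small //; lia.
have d0 : d + 1 < 0.
  by rewrite /d addrAC subr_lt0 -[1]/(1%:R) -natrD ltr_nat addn1.
have dL : - d < L%:R.
  by rewrite /d opprB ltrBlDr -natrD ltr_nat; lia.
have neg u : sin (pi * u / L%:R) = - sin (pi * (- u) / L%:R) :> R.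
  by rewrite mulrN mulNr sinN opprK.
rewrite (neg (d + 1)) (neg d) mulrNN.
by rewrite mulr_gt0 // (sin_pi_gt0 L_gt1) //; lra.
Qed.

Definition slater (B : 'Z_L -> 'I_N -> C) (f : 'I_N -> 'Z_L) : C :=
  \det (\matrix_(i, j) B (f i) j).

Definition occupied (j : 'I_N) : 'Z_L := inord j.

Lemma occupiedE j : nat_of_ord (occupied j) = j.
Proof. by rewrite inordK // Zp_cast // (ltn_trans (ltn_ord j)). Qed.

Definition ground (x : 'Z_L) (j : 'I_N) : C := plane_wave R m x (occupied j).

Definition phase (f : 'I_N -> 'Z_L) : C := slater ground f / `|slater ground f|.

Lemma slater_perm B f (s : {perm 'I_N}) :
  slater B (f \o s) = (-1) ^+ s * slater B f.
Proof.
rewrite /slater -det_perm -det_mulmx -row_permE; congr (\det _).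
by apply/matrixP => i j; rewrite !mxE.
Qed.

Lemma slater_noninj B f i j : i != j -> f i = f j -> slater B f = 0.
Proof.
move=> ij fij; apply: (determinant_alternate ij) => k.
by rewrite !mxE fij.
Qed.

Lemma unit_root_opp a : e (- a) = (e a)^-1.
Proof. by rewrite -[RHS]mul1r -(unit_root_mulN L a) mulrAC mulfV ?mul1r ?unit_root_neq0. Qed.

(** The occupied momenta are the consecutive integers j - m, so taking the power - m out of each row
    leaves a Vandermonde matrix. *)
Lemma slater_groundE f : slater ground f =
  (\prod_i e (f i)%:R ^- m) *
  \prod_(i < N) \prod_(j < N | (i < j)%N) (e (f j)%:R - e (f i)%:R).
Proof.
pose a : 'rV[C]_N := \row_i e (f i)%:R.
pose D : 'rV[C]_N := \row_i e (f i)%:R ^- m.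
transitivity (\det (diag_mx D *m (Vandermonde N a)^T)).
  congr (\det _); apply/matrixP => i j; rewrite mul_diag_mx !mxE.
  rewrite /ground /plane_wave occupiedE.
  have -> : (f i)%:R * (j%:Z - m%:Z)%:~R = (f i)%:R *+ j + - ((f i)%:R *+ m) :> R.
    by rewrite intrD intrN mulrDr mulrN -[j%:~R]/(j%:R) -[m%:~R]/(m%:R) !mulr_natr.
  rewrite unit_rootD unit_root_mulrn mulrC; congr (_ * _).
  by rewrite unit_root_opp unit_root_mulrn.
rewrite det_mulmx det_diag det_tr det_Vandermonde; congr (_ * _).
  by apply: eq_bigr => i _; rewrite mxE.
by apply: eq_bigr => i _; apply: eq_bigr => j _; rewrite !mxE.
Qed.

Lemma unit_root_Zp_inj (x y : 'Z_L) : e x%:R = e y%:R -> x = y.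
Proof.
move=> exy; apply/eqP/negPn/negP => xy.
have xL := ltn_Zp x; have yL := ltn_Zp y.
have hn : (x : nat) <> y by move/val_inj => E; rewrite E eqxx in xy.
have : e ((x%:Z - y%:Z)%:~R) != 1.
  apply: (unit_root_neq1 L_gt1); rewrite -intr_norm ltr0z -[L%:R]/(L%:Z%:~R) ltr_int.
  by lia.
by rewrite intrD intrN unit_rootD exy unit_root_mulN eqxx.
Qed.

Lemma slater_ground_neq0 f : injective f -> slater ground f != 0.
Proof.
move=> f_inj; rewrite slater_groundE mulf_neq0 //.
  by apply/prodf_neq0 => i _; rewrite invr_eq0 expf_neq0 ?unit_root_neq0.
apply/prodf_neq0 => i _; apply/prodf_neq0 => j ij; rewrite subr_eq0.
by apply: contraTneq ij => /unit_root_Zp_inj/f_inj ->; rewrite ltnn.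
Qed.

Definition move_stone (f : 'I_N -> 'Z_L) (i0 i : 'I_N) : 'Z_L :=
  if i == i0 then f i + 1 else f i.

Definition shift_phase : R := if odd N then 0 else 2^-1.

(** A stone belongs to N - 1 pairs, so its jump turns the Vandermonde product by N - 1 half
    steps. *)
Lemma pair_count (i0 : 'I_N) :
  \sum_(i < N) \sum_(j < N | (i < j)%N) ((i == i0)%:R + (j == i0)%:R) =
  N.-1%:R :> R.
Proof.
under eq_bigr do rewrite big_split /=.
rewrite big_split /= [X in _ + X](exchange_big_dep xpredT) //= -big_split /=.
rewrite (bigD1 i0) //= [X in _ + X]big1 ?addr0 => [|i /negPf ->]; last first.
  by rewrite !big1 ?addr0.
rewrite eqxx !sumr_const -natrD; congr (_%:R).
have <- : #|[pred j : 'I_N | j != i0]| = N.-1.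
  by rewrite -[X in _ = X.-1](card_ord N) -(cardC (pred1 i0)) card1.
rewrite -(cardID [pred j : 'I_N | (i0 < j)%N] [pred j : 'I_N | j != i0]).
congr (_ + _)%N; apply: eq_card => j; rewrite !inE -val_eqE /=.
  by rewrite andbC; case: ltngtP.
by rewrite unfold_in -[eqn _ _]/(j < i0)%N; case: ltngtP.
Qed.

(** In units of 2 pi / L, the chords at stone i0 turn by (N - 1) / 2 in total and the row factor of
    i0 by - m. The sum is - [shift_phase]: 0 for odd N and - 1/2 for even N. *)
Lemma slater_ground_move f i0 : injective f -> injective (move_stone f i0) ->
  0 < e shift_phase * (slater ground (move_stone f i0) * (slater ground f)^*%C).
Proof.
move=> f_inj f'_inj; rewrite !slater_groundE rmorphM /= mulrACA.
have phase_cancel x : e x ^- m * (e x ^- m)^*%C = 1.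
  rewrite -unit_root_mulrn -unit_root_opp -unit_rootN unit_root_mulN //.
have Em : (\prod_i e (move_stone f i0 i)%:R ^- m) * (\prod_i e (f i)%:R ^- m)^*%C
    = e (- m%:R).
  rewrite rmorph_prod /= -big_split /= (bigD1 i0) //= big1 ?mulr1 => [|i ii0].
    rewrite /move_stone eqxx.
    have := unit_root_ZpD R L_gt1 (f i0) 1 1; rewrite !mulr1 => ->.
    rewrite val_Zp1 exprMn invfM mulrAC phase_cancel mul1r.
    by rewrite unit_root_opp [in RHS]unit_root_mulrn.
  by rewrite /move_stone (negPf ii0) phase_cancel.
rewrite Em rmorph_prod /= -big_split /=.
under eq_bigr do rewrite rmorph_prod /= -big_split /=.
have -> : e shift_phase = e m%:R * e (- (N.-1%:R * 2^-1)).
  rewrite -unit_rootD /shift_phase; congr e.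
  have N1 : N.-1%:R = N%:R - 1 :> R by rewrite -[in RHS](prednK N_gt0) -natr1 addrK.
  have NE : N%:R = (odd N)%:R + m%:R * 2 :> R.
    by rewrite -[in LHS](odd_double_half N) natrD -muln2 natrM.
  by rewrite N1 NE; case: (odd N) => /=; field.
rewrite [e m%:R * _]mulrC -!mulrA [e m%:R * (_ * _)]mulrA unit_root_mulN mul1r.
(* The total rotation is distributed over the pairs, half a step for each pair containing i0, and
   positivity is checked pair by pair. *)
rewrite -(pair_count i0) mulr_suml -sumrN.
rewrite (big_morph e (unit_rootD L) (unit_root0 _ _)) -big_split /=.
apply: prodr_gt0 => i _; rewrite mulr_suml -sumrN.
rewrite (big_morph e (unit_rootD L) (unit_root0 _ _)) -big_split /=.
apply: prodr_gt0 => j ij; rewrite /move_stone.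
have ji : j != i by rewrite -val_eqE /= gtn_eqF.
have f'ij a b : a != b -> move_stone f i0 a != move_stone f i0 b.
  by apply: contra_neq; exact: f'_inj.
have [ii0|ii0] := eqVneq i i0; have [ji0|ji0] := eqVneq j i0.
- by rewrite ii0 ji0 eqxx in ji.
- rewrite addr0 mul1r -[X in _ * X]mulrNN -rmorphN /= !opprB.
  apply: chord_product_gt0; first by apply: contra_neq ji => /f_inj.
  have := f'ij i j; rewrite eq_sym ji /move_stone ii0 eqxx (negPf ji0) -ii0.
  by apply.
- rewrite add0r mul1r.
  apply: chord_product_gt0; first by apply: contra_neq ji => /f_inj.
  have := f'ij j i ji; rewrite /move_stone ji0 eqxx (negPf ii0).
  by [].
- rewrite addr0 mul0r oppr0 unit_root0 mul1r -sqr_normc exprn_gt0 // normr_gt0.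
  by rewrite subr_eq0; apply: contra_neq ji => /unit_root_Zp_inj/f_inj.
Qed.

Lemma conj_phase f : (phase f)^*%C = (slater ground f)^*%C / `|slater ground f|.
Proof. by rewrite rmorphM /= conjc_inv normc_def conjc_real. Qed.

(* Stones never overtake each other, so the determinant of the occupied waves
   turns by a constant phase at each jump; for even N this is the half-integer
   shift in zeta. *)
Lemma phase_move f i0 : injective f -> injective (move_stone f i0) ->
  (phase (move_stone f i0))^*%C = e shift_phase * (phase f)^*%C.
Proof.
move=> f_inj f'_inj; have := slater_ground_move f_inj f'_inj.
rewrite !conj_phase.
have := slater_ground_neq0 f_inj; have := slater_ground_neq0 f'_inj.
set z' := slater ground (move_stone f i0); set z := slater ground f.
set w := e _ => z'0 z0 p0.
have w1 : `|w| = 1 by rewrite norm_unit_root.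
have pE : w * (z' * z^*%C) = `|z'| * `|z|.
  by rewrite -(gtr0_norm p0) !normrM w1 mul1r normcJ.
have zz'' : z' * z'^*%C = `|z'| ^+ 2 by rewrite sqr_normc.
have nz : `|z| != 0 by rewrite normr_eq0.
have nz' : `|z'| != 0 by rewrite normr_eq0.
apply: (mulfI z'0); rewrite [LHS]mulrA zz'' expr2 mulfK //.
by rewrite mulrCA [z' * (_ / _)]mulrA [RHS]mulrA pE mulfK.
Qed.

End Slater.

#[local] Arguments unit_root : simpl never.
#[local] Arguments conjc : simpl never.

Lemma perm_of_same_image (T : finType) N (f f' : 'I_N -> T) :
  injective f' -> f' @: 'I_N \subset f @: 'I_N ->
  exists s : {perm 'I_N}, forall i, f' i = f (s i).
Proof.
move=> f'_inj sub.
have ex i : {j | f j == f' i}.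
  have /imsetP/cid2[j _ ->] : f' i \in f @: 'I_N.
    by move/fintype.subsetP: sub; apply; rewrite imset_f.
  by exists j.
have s_inj : injective (fun i => sval (ex i)).
  move=> i j ij; apply: f'_inj.
  by rewrite -(eqP (svalP (ex i))) -(eqP (svalP (ex j))) ij.
by exists (perm s_inj) => i; rewrite permE (eqP (svalP (ex i))).
Qed.

(** * Functions of stone configurations and the two eigenvectors *)

Section Configurations.
Variables (R : realType) (L N : nat).
Hypotheses (L_gt1 : (1 < L)%N) (N_gt0 : (0 < N)%N) (N_ltL : (N < L)%N).
Local Notation C := R[i].
Local Notation m := (N./2).
Local Notation E := {set 'Z_L}.
Implicit Types (S : E) (f : 'I_N -> 'Z_L) (B : 'Z_L -> 'I_N -> C).

(* Both factors change sign under transpositions, so the product depends only on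
   the set of stones; for B = ground it is the modulus of the determinant. *)
Definition psi B f : C := slater B f * (phase R f)^*%C.

Lemma psi_perm B f (s : {perm 'I_N}) : psi B (f \o s) = psi B f.
Proof.
rewrite /psi /phase !slater_perm normrM normr_sign mul1r !rmorphM /= rmorph_sign.
by rewrite -!mulrA [slater B f * (_ * _)]mulrCA [LHS]mulrA -signr_addb addbb mul1r.
Qed.

Definition enumf S (i : 'I_N) : 'Z_L := nth 0 (enum S) i.

Lemma enumf_inj S : #|S| = N -> injective (enumf S).
Proof.
move=> SN i j /eqP; rewrite nth_uniq ?enum_uniq // -?cardE ?SN // => /eqP.
exact: val_inj.
Qed.

Lemma enumf_image S : #|S| = N -> enumf S @: 'I_N = S.
Proof.
move=> SN; apply/eqP; rewrite eqEcard (card_imset _ (enumf_inj SN)) card_ord SN leqnn.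
rewrite andbT; apply/fintype.subsetP => _ /imsetP[i _ ->].
by rewrite -mem_enum mem_nth // -cardE SN.
Qed.

(** The function on sets induced by [psi]; by [psi_perm] the choice of enumeration is immaterial.
    The value 0 off the N-element sets lets sums range over all sets. *)
Definition desc B S : C := if #|S| == N then psi B (enumf S) else 0.

Lemma card_inj_image f : injective f -> #|f @: 'I_N| = N.
Proof. by move=> f_inj; rewrite card_imset // card_ord. Qed.

Lemma desc_image B f : injective f -> desc B (f @: 'I_N) = psi B f.
Proof.
move=> f_inj; rewrite /desc card_inj_image // eqxx.
have [s sE] : exists s : {perm 'I_N}, forall i, f i = enumf (f @: 'I_N) (s i).
  by apply: perm_of_same_image => //; rewrite enumf_image ?card_inj_image.
rewrite -(psi_perm B (enumf (f @: 'I_N)) s); congr (psi B _).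
by apply/funext => i; rewrite sE.
Qed.

(** Moving stone i forward collides with another stone exactly when the moved labelling is not
    injective, so allowed jumps are the injective moves. *)
Lemma sum_jump f (F : E -> C) : injective f ->
  \sum_(S' : E | jump (f @: 'I_N) S') F S' =
  \sum_(i | injectiveb (move_stone f i)) F (move_stone f i @: 'I_N).
Proof.
move=> f_inj; set S := f @: 'I_N.
pose K := [set i : 'I_N | f i + 1 \notin S]%SET.
pose G i : E := ((f i + 1) |: (S :\ f i))%SET.
have fS i : f i \in S by rewrite imset_f.
have neq1 i : f i + 1 != f i.
  by rewrite -subr_eq0 addrAC subrr add0r oner_eq0.
have jumpE S' : jump S S' = (S' \in G @: K).
  apply/existsP/imsetP => [ex|ex]; case: ex => i0.
    move=> /and3P[/imsetP[j _ ->] iS /eqP ->].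
    by exists j; rewrite ?inE.
  by rewrite !inE => iS ->; exists (f i0); rewrite fS iS eqxx.
have G_inj : {in K &, injective G}.
  move=> i j iK jK /finset.setP/(_ (f i)); rewrite !inE eqxx fS /= eq_sym (negPf (neq1 i)) /=.
  by rewrite andbT => /esym/negbT; rewrite negb_or negbK => /andP[_ /eqP/f_inj].
under eq_bigl do rewrite jumpE.
rewrite big_imset //=; apply: eq_big => [i|i iK].
  rewrite inE; apply/idP/injectiveP => [iS a b|inj].
    rewrite /move_stone; case: eqVneq => [->|ai]; case: eqVneq => [->|bi] //.
    - by move=> E; rewrite E fS in iS.
    - by move=> E; rewrite -E fS in iS.
    - exact: f_inj.
  apply/imsetP => -[j _ fj]; have ji : j != i.
    by apply: contra_neq (neq1 i) => ji; rewrite fj ji.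
  case/negP: (ji); apply/eqP/inj; by rewrite /move_stone eqxx -fj (negPf ji).
apply: (congr1 F); apply/finset.setP => x; apply/idP/imsetP.
  rewrite !inE => /orP[/eqP ->|/andP[xi /imsetP[j _ xj]]].
    by exists i => //; rewrite /move_stone eqxx.
  exists j => //; rewrite /move_stone; case: eqVneq => // ji.
  by rewrite xj ji eqxx in xi.
move=> [j _ ->]; rewrite /move_stone !inE; case: (eqVneq j i) => [->|ji] /=.
  by rewrite eqxx.
by rewrite fS andbT; apply/orP; right; apply: contra_neq ji => /f_inj.
Qed.

Definition adj S S' : bool := (#|S| == N) && jump S S'.

Lemma jump_card S S' : jump S S' -> #|S'| = #|S|.
Proof.
case/existsP => k /and3P[kS k1S /eqP ->].
by rewrite cardsU1 !inE negb_and k1S orbT (cardsD1 k S) kS.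
Qed.

Definition wave (h : 'I_N -> 'Z_L) (x : 'Z_L) (j : 'I_N) : C := plane_wave R m x (h j).

Definition energy (h : 'I_N -> 'Z_L) : C :=
  \sum_j zeta R L N ((h j)%:Z - m%:Z).

Lemma plane_wave_succ (x h : 'Z_L) :
  unit_root L (shift_phase R N) * plane_wave R m (x + 1) h =
  zeta R L N (h%:Z - m%:Z) * plane_wave R m x h.
Proof.
rewrite /plane_wave (unit_root_ZpD R L_gt1) val_Zp1 mul1r /zeta unit_rootD.
by rewrite /shift_phase; ring.
Qed.

(** Exclusion is automatic: a blocked move produces two equal rows, so its determinant vanishes and
    may be added. Every stone then moves freely, its row gaining the one-particle eigenvalues up to
    the common phase, and [sum_det_scale_row] adds these up. *)
Lemma desc_wave_eigen h S :
  \sum_S' (adj S S')%:R * desc (wave h) S' = energy h * desc (wave h) S.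
Proof.
have [SN|SN] := eqVneq #|S| N; last first.
  rewrite {2}/desc (negPf SN) mulr0 big1 // => S' _.
  by rewrite /adj (negPf SN) mul0r.
pose f := enumf S; have f_inj : injective f := enumf_inj SN.
have SE : S = f @: 'I_N by rewrite enumf_image.
transitivity (\sum_(S' | jump S S') desc (wave h) S').
  rewrite [RHS]big_mkcond; apply: eq_bigr => S' _; rewrite /adj SN eqxx /=.
  by case: jump; rewrite ?mul1r ?mul0r.
rewrite SE sum_jump // desc_image //.
pose w := unit_root L (shift_phase R N) : C.
transitivity (\sum_i w * slater (wave h) (move_stone f i) * (phase R f)^*%C).
  rewrite big_mkcond; apply: eq_bigr => i _; case: ifPn => [/injectiveP inj|ninj].
    rewrite (desc_image _ inj) /psi (phase_move R L_gt1 N_gt0 N_ltL f_inj inj).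
    by rewrite [LHS]mulrCA mulrA.
  have /injectivePn[j [k jk jk']] := ninj.
  by rewrite (slater_noninj _ jk jk') mulr0 mul0r.
rewrite -mulr_suml /psi mulrA; congr (_ * _).
rewrite /slater /energy -sum_det_scale_row; apply: eq_bigr => i _.
have -> : w = \det (diag_mx (\row_i' (if i' == i then w else 1))).
  rewrite det_diag (bigD1 i) //= mxE eqxx big1 ?mulr1 // => i' /negPf ii'.
  by rewrite mxE ii'.
rewrite -det_mulmx mul_diag_mx; congr (\det _); apply/matrixP => a b.
rewrite !mxE /wave /move_stone; case: eqP => _; last by rewrite !mul1r.
by rewrite plane_wave_succ.
Qed.

(** At most one stone occupies k, so weighting the set amounts to scaling one row, which is a
    one-particle operation. *)
Lemma desc_scale B k (u : C) S :
  (1 + u * (k \in S)%:R) * desc B S =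
  desc (fun x j => (1 + u * (x == k)%:R) * B x j) S.
Proof.
rewrite /desc; case: eqP => SN; last by rewrite mulr0.
rewrite /psi mulrA; congr (_ * _).
have -> : 1 + u * (k \in S)%:R = \det (diag_mx (\row_i (1 + u * (enumf S i == k)%:R))).
  rewrite det_diag; under eq_bigr do rewrite mxE.
  have [kS|kS] := boolP (k \in S); last first.
    rewrite big1 ?mulr0 ?addr0 // => i _; case: eqP => [ik|]; last by rewrite mulr0 addr0.
    by rewrite -ik -{2}(enumf_image SN) imset_f in kS.
  move: kS; rewrite -{1}(enumf_image SN) => /imsetP[i _ ->].
  rewrite (bigD1 i) //= eqxx big1 ?mulr1 // => j ji.
  by rewrite (inj_eq (enumf_inj SN)) (negPf ji) mulr0 addr0.
rewrite -det_mulmx mul_diag_mx; congr (\det _); apply/matrixP => a b.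
by rewrite !mxE.
Qed.

Definition fourier B (h : 'Z_L) (j : 'I_N) : C :=
  L%:R^-1 * \sum_x (plane_wave R m x h)^*%C * B x j.

(** Orthogonality gives a one-sided inverse of a square matrix, hence a two-sided one. *)
Lemma plane_wave_complete (x y : 'Z_L) :
  \sum_h plane_wave R m x h * (plane_wave R m y h)^*%C = L%:R * (x == y)%:R.
Proof.
pose F : 'M[C]_((Zp_trunc L).+2) := \matrix_(x, h) plane_wave R m x h.
pose F' : 'M[C]_((Zp_trunc L).+2) := \matrix_(h, x) (L%:R^-1 * (plane_wave R m x h)^*%C).
have L0 : (L%:R : C) != 0 by rewrite pnatr_eq0 -lt0n ltnW.
have FF' : F' *m F = 1%:M.
  apply/matrixP => h h'; rewrite !mxE; under eq_bigr do rewrite !mxE -mulrA.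
  by rewrite -mulr_sumr plane_wave_orthogonal // mulrA mulVf // mul1r.
have /matrixP/(_ x y) := mulmx1C FF'; rewrite !mxE => /esym xyE.
rewrite xyE mulr_sumr; apply: eq_bigr => h _.
by rewrite !mxE mulrCA !mulrA mulfK.
Qed.

Lemma fourierE B (x : 'Z_L) (j : 'I_N) :
  B x j = \sum_h plane_wave R m x h * fourier B h j.
Proof.
have L0 : (L%:R : C) != 0 by rewrite pnatr_eq0 -lt0n ltnW.
under eq_bigr do rewrite /fourier mulrCA mulr_sumr.
rewrite -mulr_sumr exchange_big /=.
under eq_bigr => y _.
  under eq_bigr do rewrite mulrA.
  rewrite -mulr_suml plane_wave_complete; over.
rewrite (bigD1 x) //= eqxx mulr1 big1 ?addr0 ?mulKf // => y /negPf.
by rewrite eq_sym => ->; rewrite mulr0 mul0r.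
Qed.

(** Reduces linear statements about arbitrary one-particle functions to plane waves, on which the
    dynamics is diagonal. *)
Lemma desc_fourier B S : desc B S =
  \sum_(h : {ffun 'I_N -> 'Z_L}) (\prod_j fourier B (h j) j) * desc (wave h) S.
Proof.
rewrite /desc; case: eqP => _; last by rewrite big1 // => h _; rewrite mulr0.
rewrite /psi; under eq_bigr do rewrite mulrA.
rewrite -mulr_suml; congr (_ * _); set f := enumf S.
transitivity (\det (\matrix_(j, i) \sum_h fourier B h j * plane_wave R m (f i) h)).
  rewrite -det_tr; congr (\det _); apply/matrixP => j i; rewrite !mxE fourierE.
  by apply: eq_bigr => h _; rewrite mulrC.
rewrite -(det_sum_rows (fun j h => fourier B h j) (fun h i => plane_wave R m (f i) h)).
apply: eq_bigr => h _; congr (_ * _).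
by rewrite -det_tr; congr (\det _); apply/matrixP => i j; rewrite !mxE.
Qed.

(** The Perron-Frobenius eigenvector r. Taking the real part loses nothing, because the value is 0
    or the modulus of a determinant. *)
Definition groundR S : R := complex.Re (desc (@ground R L N) S).

Lemma psi_ground f : injective f ->
  psi (@ground R L N) f = `|slater (@ground R L N) f|.
Proof.
move=> f_inj; have z0 := slater_ground_neq0 R L_gt1 N_gt0 N_ltL f_inj.
rewrite /psi conj_phase mulrA -sqr_normc expr2 mulfK // normr_eq0 //.
Qed.

Lemma groundR_complex S : ((groundR S)%:C)%C = desc (@ground R L N) S.
Proof.
rewrite /groundR /desc; case: eqP => // SN.
by rewrite psi_ground ?normc_def //; exact: enumf_inj.
Qed.

Lemma groundR_gt0 S : #|S| = N -> 0 < groundR S.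
Proof.
move=> SN; rewrite -ltcR groundR_complex /desc SN eqxx psi_ground; last exact: enumf_inj.
by rewrite normr_gt0; apply: slater_ground_neq0 => //; exact: enumf_inj.
Qed.

Lemma groundR_eq0 S : #|S| != N -> groundR S = 0.
Proof. by rewrite /groundR /desc => /negPf ->. Qed.

Lemma groundR_ge0 S : 0 <= groundR S.
Proof.
have [SN|SN] := eqVneq #|S| N; first exact/ltW/groundR_gt0.
by rewrite groundR_eq0.
Qed.

Lemma sum_imset_inj (F : E -> C) :
  \sum_(f : {ffun 'I_N -> 'Z_L} | injectiveb f) F (f @: 'I_N) =
  N`!%:R * \sum_(S : E | #|S| == N) F S.
Proof.
rewrite (partition_big (fun f : {ffun 'I_N -> 'Z_L} => f @: 'I_N) (fun S : E => #|S| == N)) /=; last first.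
  by move=> f /injectiveP f_inj; rewrite card_inj_image.
rewrite mulr_sumr; apply: eq_bigr => S /eqP SN.
rewrite (eq_bigr (fun=> F S)); last by move=> f /andP[_ /eqP ->].
rewrite sumr_const [RHS]mulr_natl; congr (_ *+ _).
have := card_inj_ffuns_on 'I_N (mem S); rewrite card_ord SN ffactnn => <-.
apply: eq_card => f; rewrite !inE; apply/andP/andP => -[].
  move=> f_inj /eqP fS; split=> //; apply/ffun_onP => i.
  by rewrite -fS imset_f.
move=> /ffun_onP fS f_inj; split=> //.
rewrite eqEcard SN card_inj_image ?leqnn ?andbT; last exact/injectiveP.
by apply/fintype.subsetP => _ /imsetP[k _ ->]; exact: fS.
Qed.

(** The phases cancel, leaving a product of two determinants for each labelling; the N! labellings
    of a set match the factorial in [andreief]. This evaluates the pairing with the left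
    eigenvector. *)
Lemma sum_groundR_desc B :
  \sum_S ((groundR S)%:C)%C * desc B S =
  \det (\matrix_(i, j) \sum_x (ground R x i)^*%C * B x j).
Proof.
have NF : (N`!%:R : C) != 0 by rewrite pnatr_eq0 -lt0n fact_gt0.
apply: (mulfI NF).
rewrite -(andreief (fun x i => (ground R x i)^*%C) B).
rewrite [X in _ * X = _](bigID (fun S : E => #|S| == N)) /=.
rewrite [X in _ * (_ + X)]big1 ?addr0; last first.
  by move=> S SN; rewrite groundR_eq0 // mul0r.
rewrite -sum_imset_inj [RHS](bigID (fun f : {ffun 'I_N -> 'Z_L} => injectiveb f)) /=.
rewrite [X in _ = _ + X]big1 ?addr0; last first.
  move=> f /injectivePn[j [k jk jk']].
  by rewrite -[\det (\matrix_(i, j) B _ _)]/(slater B f) (slater_noninj _ jk jk') mulr0.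
apply: eq_bigr => f /injectiveP f_inj.
rewrite groundR_complex !desc_image // psi_ground // /psi.
have -> : \det (\matrix_(i, j) (ground R (f i) j)^*%C) = (slater (@ground R L N) f)^*%C.
  rewrite -det_map_mx; congr (\det _); apply/matrixP => i j; by rewrite !mxE.
have := slater_ground_neq0 R L_gt1 N_gt0 N_ltL f_inj.
rewrite conj_phase -normr_eq0 -[\det _]/(slater B f) => z0.
by rewrite mulrCA [_ * (_ / _)]mulrCA divff // mulr1 mulrC.
Qed.

Definition lambda : R := sin (pi * N%:R / L%:R) / sin (pi / L%:R).

Lemma lambda_gt0 : 0 < lambda.
Proof.
rewrite divr_gt0 //; first by apply: (sin_pi_gt0 L_gt1); rewrite ltr0n N_gt0 ltr_nat.
by rewrite -[pi]mulr1; apply: (sin_pi_gt0 L_gt1); rewrite ltr01 ltr1n.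
Qed.

(** With the parity shift the occupied momenta run from - (N - 1) / 2 to (N - 1) / 2 in unit steps.
    Multiplication by 2 i sin (pi / L), the difference of the phases at 1/2 and - 1/2, makes their
    sum telescope. *)
Lemma energy_ground : energy (@occupied L N) = (lambda%:C)%C.
Proof.
pose a j : R := (j%:R - m%:R) + shift_phase R N.
have E1 : energy (@occupied L N) = \sum_(j < N) unit_root L (a j).
  apply: eq_bigr => j _; rewrite occupiedE // /zeta /a /shift_phase.
  by rewrite intrD intrN.
pose s : C := (0 +i* (2 * sin (pi / L%:R)))%C.
have LR0 := LR_neq0 R L_gt1.
have sinE b : unit_root L b - unit_root L (- b) = (0 +i* (2 * sin (pi * (2 * b) / L%:R)))%C.
  have := unit_root_chord L_gt1 (2 * b).
  rewrite mulrAC divff ?mul1r // => /(congr1 (fun z => unit_root L (- b) * z)).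
  rewrite mulrA [_ * unit_root L b]mulrC unit_root_mulN mul1r => <-.
  by rewrite mulrBr mulr1 -unit_rootD; congr (unit_root L _ - _); ring.
have tele : energy (@occupied L N) * s =
   \sum_(j < N) (unit_root L (a j.+1 - 2^-1) - unit_root L (a j - 2^-1)).
  rewrite E1 mulr_suml; apply: eq_bigr => j _.
  have <- : unit_root L 2^-1 - unit_root L (- 2^-1) = s.
    by rewrite sinE divff // mulr1.
  rewrite mulrBr -!unit_rootD; congr (unit_root L _ - _).
  by rewrite /a -natr1; field.
have s0 : s != 0.
  rewrite eq_complex /= eqxx /= mulf_neq0 // gt_eqF // -[pi]mulr1.
  by apply: (sin_pi_gt0 L_gt1); rewrite ltr01 ltr1n.
apply: (mulIf s0); rewrite tele.
rewrite -(big_mkord xpredT (fun j => unit_root L (a j.+1 - 2^-1) - unit_root L (a j - 2^-1))).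
rewrite (telescope_sumr (fun j => unit_root L (a j - 2^-1))) //.
have aN : a N - 2^-1 = N%:R / 2 /\ a 0%N - 2^-1 = - (N%:R / 2).
  have NE : N%:R = (odd N)%:R + m%:R * 2 :> R.
    by rewrite -[in LHS](odd_double_half N) natrD -muln2 natrM.
  by rewrite /a /shift_phase NE; split; case: (odd N) => /=; field.
rewrite aN.1 aN.2 sinE.
have -> : pi * (2 * (N%:R / 2)) / L%:R = pi * N%:R / L%:R :> R by field.
apply/eqP; rewrite eq_complex /=; apply/andP; split; apply/eqP; first by ring.
rewrite /lambda mul0r addr0 mulrCA divfK // gt_eqF // -[pi]mulr1.
by apply: (sin_pi_gt0 L_gt1); rewrite ltr01 ltr1n.
Qed.

Lemma desc_ground S : desc (@ground R L N) S = desc (wave (@occupied L N)) S.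
Proof. by []. Qed.

Lemma groundR_right S : \sum_S' (adj S S')%:R * groundR S' = lambda * groundR S.
Proof.
apply: complexI; rewrite rmorph_sum rmorphM /= groundR_complex -energy_ground.
rewrite desc_ground -desc_wave_eigen; apply: eq_bigr => S' _.
by rewrite rmorphM /= rmorph_nat groundR_complex.
Qed.

(* x |-> - x reverses the jumps, which turns the right eigenvector into a left
   one. *)
Definition reflect_set S : E := [set - x | x in S]%SET.

Lemma reflect_setK : involutive reflect_set.
Proof.
move=> S; rewrite /reflect_set -imset_comp -[RHS]imset_id.
by apply: eq_imset => x /=; rewrite opprK.
Qed.

Lemma mem_reflect x S : (x \in reflect_set S) = (- x \in S).
Proof.
apply/imsetP/idP => [[y yS ->]|xS]; first by rewrite opprK.
by exists (- x); rewrite ?opprK.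
Qed.

Lemma card_reflect S : #|reflect_set S| = #|S|.
Proof. by rewrite card_imset //; exact: oppr_inj. Qed.

Lemma jump_reflect S S' : jump S S' -> jump (reflect_set S') (reflect_set S).
Proof.
case/existsP => k /and3P[kS k1S /eqP S'E]; apply/existsP; exists (- (k + 1)).
have k1 : k + 1 != k by rewrite -subr_eq0 addrAC subrr add0r oner_eq0.
have kk : - (k + 1) + 1 = - k by rewrite opprD subrK.
rewrite !mem_reflect kk !opprK S'E !inE !eqxx [k == _]eq_sym (negPf k1) /=.
apply/eqP/finset.setP => x; rewrite !inE !mem_reflect !inE.
rewrite -!(inj_eq oppr_inj x) !opprK.
case: (eqVneq (- x) k) => [->|xk] /=; first by rewrite kS.
by case: (eqVneq (- x) (k + 1)) => [->|xk1] //=; rewrite (negPf k1S).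
Qed.

(** Reflection conjugates every plane wave, hence the determinant, and leaves its modulus
    unchanged. *)
Lemma groundR_reflect S : groundR (reflect_set S) = groundR S.
Proof.
have [SN|SN] := eqVneq #|S| N; last first.
  by rewrite !groundR_eq0 ?card_reflect.
apply: complexI; rewrite [LHS]groundR_complex [RHS]groundR_complex.
pose f := enumf S; have f_inj : injective f := enumf_inj SN.
pose f' i := - f i; have f'_inj : injective f' by move=> i j /oppr_inj/f_inj.
have SE : S = f @: 'I_N by rewrite enumf_image.
have -> : reflect_set S = f' @: 'I_N by rewrite SE /reflect_set -imset_comp.
rewrite SE (desc_image _ f'_inj) (desc_image _ f_inj) (psi_ground f'_inj) (psi_ground f_inj).
rewrite -[RHS]normcJ; congr `|_|.
rewrite -det_map_mx; congr (\det _); apply/matrixP => i j; rewrite !mxE.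
by rewrite /ground /plane_wave (unit_root_ZpN R L_gt1) unit_rootN.
Qed.

Lemma groundR_left S' : \sum_S groundR S * (adj S S')%:R = lambda * groundR S'.
Proof.
rewrite -(groundR_reflect S') -groundR_right.
rewrite (reindex_inj (inv_inj reflect_setK)) /=; apply: eq_bigr => S _.
rewrite groundR_reflect mulrC; congr (_%:R * _); congr nat_of_bool.
rewrite /adj !card_reflect; apply/andP/andP => -[SN jS]; split.
- by rewrite (jump_card jS) card_reflect.
- by rewrite -[S]reflect_setK; exact: jump_reflect.
- by rewrite (jump_card jS) card_reflect.
- by rewrite -[S']reflect_setK; apply: jump_reflect.
Qed.

End Configurations.

#[local] Arguments unit_root : simpl never.
#[local] Arguments conjc : simpl never.
#[local] Arguments cexp : simpl never.

Lemma seq_cvg_unique (R : realType) (u : nat -> R) (a b : R) :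
  u @ \oo --> a -> u @ \oo --> b -> a = b.
Proof. exact: norm_cvg_unique. Qed.

Lemma cvg_fin_sum (R : realType) (I : finType) (u : I -> nat -> R) (a : I -> R) :
  (forall j, u j @ \oo --> a j) -> (\sum_j u j M) @[M --> \oo] --> \sum_j a j.
Proof.
move=> ua; apply: cvg_big => [|j _]; last exact: ua.
exact: add_continuous.
Qed.

(** * Transfer operators and correlations *)

Section TransferSemigroup.
Variables (R : realType) (L N : nat).
Hypotheses (L_gt1 : (1 < L)%N) (N_gt0 : (0 < N)%N) (N_ltL : (N < L)%N).
Local Notation C := R[i].
Local Notation m := (N./2).
Local Notation q := ((Zp_trunc L).+2).
Local Notation E := {set 'Z_L}.
Local Notation A := (@adj L N).
Local Notation lambda := (@lambda R L N).
Implicit Types (S : E).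

Fixpoint path_count (c : nat) S S' : R :=
  if c is c'.+1 then \sum_S1 (A S S1)%:R * path_count c' S1 S' else (S == S')%:R.

Lemma path_count_ge0 c S S' : 0 <= path_count c S S'.
Proof.
elim: c S => [|c IH] S /=; first by rewrite ler0n.
by apply: sumr_ge0 => S1 _; rewrite mulr_ge0 ?ler0n.
Qed.

Lemma path_count_le c S S' : path_count c S S' <= #|E|%:R ^+ c.
Proof.
elim: c S => [|c IH] S /=; first by rewrite expr0; case: (_ == _); rewrite ?ler01.
rewrite exprS -[X in X%:R * _]/(#|E|) mulr_natl -sumr_const; apply: ler_sum => S1 _.
case: (A S S1); rewrite ?mul1r ?mul0r //; apply: exprn_ge0; exact: ler0n.
Qed.

Definition transfer_psum (x : R) S S' (M : nat) : R :=
  \sum_(c < M) (c`!%:R)^-1 * x ^+ c * path_count c S S'.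

(** The (S, S') entry of exp (x A), A the adjacency matrix. *)
Definition transfer (x : R) S S' : R := limn (transfer_psum x S S').

Lemma cvg_transfer x S S' : 0 <= x ->
  transfer_psum x S S' @ \oo --> transfer x S S'.
Proof.
move=> x0; rewrite /transfer.
pose u c := (c`!%:R)^-1 * x ^+ c * path_count c S S'.
have -> : transfer_psum x S S' = series u.
  by apply/funext => M; rewrite /series /= big_mkord.
apply: (@series_le_cvg _ u (exp_coeff (x * #|E|%:R))).
- by move=> c; rewrite !mulr_ge0 ?invr_ge0 ?ler0n ?exprn_ge0 ?path_count_ge0.
- by move=> c; apply: exp_coeff_ge0; rewrite mulr_ge0.
- move=> c; rewrite /u /exp_coeff /= exprMn [leRHS]mulrC mulrA.
  by rewrite ler_wpM2l ?path_count_le // mulr_ge0 ?invr_ge0 ?exprn_ge0.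
- exact: is_cvg_series_exp_coeff.
Qed.

Lemma path_count_wave c (h : 'I_N -> 'Z_L) S :
  \sum_S' ((path_count c S S')%:C)%C * desc (wave R h) S' =
  energy R h ^+ c * desc (wave R h) S.
Proof.
elim: c S => [|c IH] S.
  rewrite (bigD1 S) //= eqxx expr0 big1 ?addr0 // => S' /negPf.
  by rewrite eq_sym => ->; rewrite mul0r.
rewrite /= exprSr -mulrA -desc_wave_eigen // mulr_sumr.
under eq_bigr do rewrite rmorph_sum mulr_suml.
rewrite exchange_big; apply: eq_bigr => S1 _.
rewrite mulrCA -IH mulr_sumr; apply: eq_bigr => S' _.
by rewrite rmorphM /= rmorph_nat mulrA.
Qed.

Lemma transfer_wave x (h : 'I_N -> 'Z_L) S : 0 <= x ->
  \sum_S' ((transfer x S S')%:C)%C * desc (wave R h) S' =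
  cexp ((x%:C)%C * energy R h) * desc (wave R h) S.
Proof.
move=> x0; set v := desc (wave R h).
have psumE M : \sum_S' ((transfer_psum x S S' M)%:C)%C * v S' =
    exp_psum ((x%:C)%C * energy R h) M * v S.
  under eq_bigr do rewrite rmorph_sum mulr_suml.
  rewrite exchange_big /exp_psum mulr_suml; apply: eq_bigr => c _.
  rewrite exprMn mulrA -[RHS]mulrA -path_count_wave mulr_sumr.
  apply: eq_bigr => S' _; rewrite !rmorphM /= fmorphV rmorph_nat rmorphXn /=.
  by rewrite !mulrA.
have [cRe cIm] := cvg_exp_psum ((x%:C)%C * energy R h).
apply/eqP; rewrite eq_complex Re_sum Im_sum; apply/andP; split; apply/eqP.
- apply: (@seq_cvg_unique _ (fun M => complex.Re (exp_psum ((x%:C)%C * energy R h) M * v S))).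
  + rewrite (_ : (fun M => _) = fun M =>
      \sum_S' transfer_psum x S S' M * complex.Re (v S')).
      under eq_bigr do rewrite Re_realM.
      apply: cvg_fin_sum => S'; apply: cvgM; [exact: cvg_transfer|exact: cvg_cst].
    apply/funext => M; rewrite -psumE Re_sum.
    by apply: eq_bigr => S' _; rewrite Re_realM.
  + have ReM (z w : C) : complex.Re (z * w) =
      complex.Re z * complex.Re w - complex.Im z * complex.Im w by case: z w => ? ? [].
    rewrite ReM; under eq_cvg do rewrite ReM.
    by apply: cvgB; apply: cvgM => //; exact: cvg_cst.
- apply: (@seq_cvg_unique _ (fun M => complex.Im (exp_psum ((x%:C)%C * energy R h) M * v S))).
  + rewrite (_ : (fun M => _) = fun M =>
      \sum_S' transfer_psum x S S' M * complex.Im (v S')).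
      under eq_bigr do rewrite Im_realM.
      apply: cvg_fin_sum => S'; apply: cvgM; [exact: cvg_transfer|exact: cvg_cst].
    apply/funext => M; rewrite -psumE Im_sum.
    by apply: eq_bigr => S' _; rewrite Im_realM.
  + have ImM (z w : C) : complex.Im (z * w) =
      complex.Re z * complex.Im w + complex.Im z * complex.Re w by case: z w => ? ? [].
    rewrite ImM; under eq_cvg do rewrite ImM.
    by apply: cvgD; apply: cvgM => //; exact: cvg_cst.
Qed.

Definition plane (x h : 'Z_L) : C := plane_wave R m x h.
Definition zh (h : 'Z_L) : C := zeta R L N (h%:Z - m%:Z).

(** The one-particle propagator, diagonal in the plane waves. It is used for negative x as well, to
    transport operators back to time 0. *)
Definition evolution (x : R) : 'M[C]_q :=
  \matrix_(y, z) (L%:R^-1 * \sum_h plane y h * cexp ((x%:C)%C * zh h) * (plane z h)^*%C).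

Lemma evolution_fourier x (B : 'M[C]_(q, N)) y j :
  (evolution x *m B) y j =
  \sum_h plane y h * (cexp ((x%:C)%C * zh h) * @fourier R L N B h j).
Proof.
rewrite mxE; under eq_bigr do rewrite mxE -mulrA mulr_suml mulr_sumr.
rewrite exchange_big /=; apply: eq_bigr => h _; rewrite /fourier.
rewrite !mulr_sumr; apply: eq_bigr => z _.
by rewrite /plane; ring.
Qed.

(** Second quantization: exp (x A) acts on a Slater determinant through the propagator on each
    column. After expansion in plane waves both sides are diagonal, and the exponential of the total
    energy is the product of the one-particle exponentials. *)
Lemma transfer_desc x (B : 'M[C]_(q, N)) S : 0 <= x ->
  \sum_S' ((transfer x S S')%:C)%C * desc B S' = desc (evolution x *m B) S.
Proof.
move=> x0; under eq_bigr do rewrite (desc_fourier L_gt1) mulr_sumr.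
rewrite exchange_big /= (desc_fourier L_gt1); apply: eq_bigr => h _.
transitivity ((\prod_j @fourier R L N B (h j) j) *
    \sum_S' ((transfer x S S')%:C)%C * desc (wave R h) S').
  by rewrite mulr_sumr; apply: eq_bigr => S' _; rewrite mulrCA.
rewrite transfer_wave // mulrA; congr (_ * _).
rewrite /energy mulr_sumr cexp_sum -big_split /=; apply: eq_bigr => j _.
rewrite /fourier.
under [in RHS]eq_bigr do rewrite evolution_fourier mulr_sumr.
rewrite exchange_big /=.
under [in RHS]eq_bigr => h' _.
  under eq_bigr do rewrite mulrA.
  rewrite -mulr_suml plane_wave_orthogonal //; over.
rewrite [X in _ = _ * X](bigD1 (h j)) //= eqxx mulr1 [X in _ = _ * (_ + X)]big1 ?addr0; last first.
  by move=> h' /negPf; rewrite eq_sym => ->; rewrite mulr0 mul0r.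
have L0 : (L%:R : C) != 0 by rewrite pnatr_eq0 -lt0n ltnW.
by rewrite mulKf // mulrC.
Qed.

Definition planeM : 'M[C]_q := \matrix_(x, h) plane x h.
Definition planeM' : 'M[C]_q := \matrix_(h, x) (L%:R^-1 * (plane x h)^*%C).

Lemma LC_neq0 : (L%:R : C) != 0.
Proof. by rewrite pnatr_eq0 -lt0n ltnW. Qed.

Lemma planeM'K : planeM' *m planeM = 1%:M.
Proof.
apply/matrixP => h h'; rewrite !mxE; under eq_bigr do rewrite !mxE -mulrA.
by rewrite -mulr_sumr plane_wave_orthogonal // mulrA mulVf ?LC_neq0 // mul1r.
Qed.

Definition expD (x : R) : 'M[C]_q := diag_mx (\row_h cexp ((x%:C)%C * zh h)).

Lemma evolutionE x : evolution x = planeM *m expD x *m planeM'.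
Proof.
apply/matrixP => y z; rewrite mul_mx_diag !mxE mulr_sumr; apply: eq_bigr => h _.
by rewrite !mxE; ring.
Qed.

Lemma expDD x y : expD (x + y) = expD x *m expD y.
Proof.
rewrite /expD mulmx_diag; congr diag_mx; apply/rowP => h; rewrite !mxE.
by rewrite -cexpD rmorphD /= mulrDl.
Qed.

Lemma evolutionD x y : evolution (x + y) = evolution x *m evolution y.
Proof.
rewrite !evolutionE expDD -!mulmxA; congr (_ *m (_ *m _)).
by rewrite [planeM' *m (_ *m _)]mulmxA planeM'K mul1mx.
Qed.

Lemma evolution0 : evolution 0 = 1%:M.
Proof.
have E0 : expD 0 = 1%:M.
  apply/matrixP => h h'; rewrite !mxE; case: eqP => // _.
  by rewrite mul0r cexp0.
by rewrite evolutionE E0 mulmx1 mulmx1C // planeM'K.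
Qed.

(** Isometric embedding of the N lowest momenta, up to scale; [groundM *m groundM'] projects onto
    their span and produces the first branch of the kernel. *)
Definition groundM : 'M[C]_(q, N) := \matrix_(x, j) ground R x j.
Definition groundM' : 'M[C]_(N, q) := \matrix_(j, x) (L%:R^-1 * (ground R x j)^*%C).
Definition expG (x : R) : 'M[C]_N := diag_mx (\row_j cexp ((x%:C)%C * zh (occupied L j))).

Lemma occupied_inj : injective (@occupied L N).
Proof.
move=> i j /(congr1 (@nat_of_ord _)); rewrite !occupiedE // => ij.
exact: val_inj.
Qed.

Definition sel : 'M[C]_(q, N) := \matrix_(h, j) (h == occupied L j)%:R.

Lemma mul_sel p (M : 'M[C]_(p, q)) : M *m sel = \matrix_(i, j) M i (occupied L j).
Proof.
apply/matrixP => i j; rewrite !mxE (bigD1 (occupied L j)) //= !mxE eqxx mulr1.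
by rewrite big1 ?addr0 // => h /negPf hj; rewrite mxE hj mulr0.
Qed.

Lemma mul_selT p (M : 'M[C]_(q, p)) : sel^T *m M = \matrix_(j, i) M (occupied L j) i.
Proof.
apply/matrixP => j i; rewrite !mxE (bigD1 (occupied L j)) //= !mxE eqxx mul1r.
by rewrite big1 ?addr0 // => h /negPf hj; rewrite !mxE hj mul0r.
Qed.

Lemma groundM_sel : groundM = planeM *m sel.
Proof. by rewrite mul_sel; apply/matrixP => x j; rewrite !mxE. Qed.

Lemma groundM'_sel : groundM' = sel^T *m planeM'.
Proof. by rewrite mul_selT; apply/matrixP => x j; rewrite !mxE. Qed.

Lemma groundM'K : groundM' *m groundM = 1%:M.
Proof.
rewrite groundM_sel groundM'_sel -mulmxA [planeM' *m _]mulmxA planeM'K mul1mx.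
rewrite mul_sel; apply/matrixP => i j; rewrite !mxE eq_sym (inj_eq occupied_inj).
by rewrite eq_sym.
Qed.

Lemma sel_expD x : expD x *m sel = sel *m expG x.
Proof.
apply/matrixP => h j; rewrite mul_diag_mx mul_mx_diag !mxE.
by case: eqP => [->|]; rewrite ?mulr1 ?mul1r ?mulr0 ?mul0r.
Qed.

Lemma evolution_ground x : evolution x *m groundM = groundM *m expG x.
Proof.
rewrite evolutionE groundM_sel -!mulmxA [planeM' *m (_ *m _)]mulmxA planeM'K.
by rewrite mul1mx sel_expD.
Qed.

Lemma ground_evolution x : groundM' *m evolution x = expG x *m groundM'.
Proof.
rewrite evolutionE groundM'_sel -!mulmxA [planeM' *m (planeM *m _)]mulmxA planeM'K.
rewrite mul1mx !mulmxA; congr (_ *m _).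
have := congr1 trmx (sel_expD x); rewrite !trmx_mul /expD /expG !tr_diag_mx.
by [].
Qed.

Lemma det_expG x : \det (expG x) = ((expR (x * lambda))%:C)%C.
Proof.
rewrite det_diag -cexp_real rmorphM /= -energy_ground // /energy mulr_sumr cexp_sum.
by apply: eq_bigr => j _; rewrite mxE.
Qed.

End TransferSemigroup.

#[local] Arguments unit_root : simpl never.
#[local] Arguments conjc : simpl never.
#[local] Arguments cexp : simpl never.

#[local] Opaque evolution groundM groundM' rank1_prod transfer groundR.

Lemma sum_tuple_cons (V : nmodType) (T : finType) n (F : n.+1.-tuple T -> V) :
  \sum_st F st = \sum_x \sum_(st : n.-tuple T) F [tuple of x :: st].
Proof.
rewrite pair_bigA /=.
rewrite (reindex (fun p : T * n.-tuple T => [tuple of p.1 :: p.2])) //=.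
exists (fun st => (thead st, [tuple of behead st])) => [p|st] _ /=.
  case: p => x st; congr pair; exact/val_inj.
exact/esym/tuple_eta.
Qed.

(** * Occupation generating function and the kernel *)

Section Correlations.
Variables (R : realType) (L N : nat).
Hypotheses (L_gt1 : (1 < L)%N) (N_gt0 : (0 < N)%N) (N_ltL : (N < L)%N).
Local Notation C := R[i].
Local Notation m := (N./2).
Local Notation q := ((Zp_trunc L).+2).
Local Notation E := {set 'Z_L}.
Local Notation lambda := (@lambda R L N).
Local Notation r := (@groundR R L N).
Implicit Types (S : E).

(** The (S, S') entry of exp (x (A - lambda)). *)
Definition ntransfer (x : R) S S' : R := expR (- (x * lambda)) * transfer N x S S'.

Fixpoint wchain (s : R) S (ts : seq R) (st : seq E) : R :=
  match ts, st with
  | t :: ts', S' :: st' => ntransfer (t - s) S S' * wchain t S' ts' st'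
  | _, _ => r S
  end.

Section Times.
Variables (n : nat) (t : 'I_n -> R) (k : 'I_n -> 'Z_L) (u : C).
Hypothesis t_sorted : forall a b : 'I_n, (a <= b)%N -> t a <= t b.

Definition occ_weight (a : 'I_n) S : C := 1 + u * (k a \in S)%:R.

Fixpoint chain (s : R) S (l : seq 'I_n) : C :=
  if l is a :: l' then
    \sum_S' ((ntransfer (t a - s) S S')%:C)%C * (occ_weight a S' * chain (t a) S' l')
  else ((r S)%:C)%C.

Lemma sum_wchain s S (l : seq 'I_n) :
  \sum_(st : (size l).-tuple E) ((wchain s S (map t l) st)%:C)%C *
     \prod_(p <- zip l st) occ_weight p.1 p.2 = chain s S l.
Proof.
elim: l s S => [|a l IH] s S /=.
  rewrite (big_pred1 [tuple]) => [|st]; last by apply/esym/eqP; exact: tuple0.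
  by rewrite /= big_nil mulr1.
rewrite sum_tuple_cons; apply: eq_bigr => S' _.
rewrite -IH !mulr_sumr; apply: eq_bigr => st _ /=.
by rewrite big_cons rmorphM /=; ring.
Qed.

(** Heisenberg picture: the projection onto the hole k a, conjugated back from time t a to time 0,
    is the rank-one matrix [col a Xmx *m row a Ymx]. *)
Definition Xmx : 'M[C]_(q, n) := \matrix_(x, a) evolution L N (t a) x (k a).
Definition Ymx : 'M[C]_(n, q) := \matrix_(a, x) evolution L N (- t a) (k a) x.

Lemma col_row_XY a : col a Xmx *m row a Ymx =
  evolution L N (t a) *m delta_mx (k a) (k a) *m evolution L N (- t a).
Proof.
have -> : col a Xmx = col (k a) (evolution L N (t a)).
  by apply/matrixP => x j; rewrite !mxE.
have -> : row a Ymx = row (k a) (evolution L N (- t a)).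
  by apply/matrixP => x j; rewrite !mxE.
by rewrite colE rowE -[delta_mx (k a) (k a)](mul_delta_mx (0 : 'I_1)) !mulmxA.
Qed.

Lemma occ_weight_desc a S (B : 'M[C]_(q, N)) :
  occ_weight a S * desc B S =
  desc ((1%:M + u *: delta_mx (k a) (k a)) *m B) S.
Proof.
rewrite /occ_weight desc_scale; congr (desc _ S); apply/funext => x; apply/funext => j.
rewrite mulmxDl mul1mx -scalemxAl !mxE mulrDl mul1r; congr (_ + _).
rewrite -mulrA; congr (u * _).
rewrite (bigD1 (k a)) //= !mxE eqxx andbT [X in _ = _ + X]big1 ?addr0.
  by case: eqP => [->|]; rewrite ?mul0r.
by move=> z /negPf zk; rewrite mxE zk andbF mul0r.
Qed.

Definition rprod j := rank1_prod Xmx Ymx u j.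

Lemma mulmx_conj_1D (U U' D W : 'M[C]_q) : U' *m U = 1%:M ->
  (1%:M + u *: D) *m (U' *m W) = U' *m ((1%:M + u *: (U *m D *m U')) *m W).
Proof.
move=> U'U; rewrite !mulmxA; congr (_ *m W).
rewrite mulmxDl mul1mx mulmxDr mulmx1 -scalemxAl -scalemxAr !mulmxA U'U.
by rewrite mul1mx.
Qed.

Lemma chain_step (a : 'I_n) :
  (1%:M + u *: delta_mx (k a) (k a)) *m (evolution L N (- t a) *m rprod a.+1) =
  evolution L N (- t a) *m rprod a.
Proof.
rewrite (rank1_prod_step Xmx Ymx u a : rprod a = _) col_row_XY -/(rprod a.+1).
by apply: mulmx_conj_1D; rewrite -evolutionD // addNr evolution0.
Qed.

Lemma desc_scaleG x (B : 'M[C]_(q, N)) S :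
  desc (B *m expG L N x) S = ((expR (x * lambda))%:C)%C * desc B S.
Proof.
rewrite /desc; case: eqP => SN; last by rewrite mulr0.
rewrite /psi mulrA; congr (_ * _).
rewrite -det_expG // mulrC /slater -det_mulmx; congr (\det _).
by apply/matrixP => i j; rewrite /expG !mul_mx_diag !mxE.
Qed.

#[local] Opaque desc.

(** Backward induction over the times. The weight at t a is a one-particle operator, absorbed into
    the product by [chain_step]; the transfer before it is a propagator by [transfer_desc]. The
    exponential factor collects the normalizations in [ntransfer]. *)
Lemma chainE j s S : (j <= n)%N -> (forall a : 'I_n, (j <= a)%N -> s <= t a) ->
  chain s S (drop j (enum 'I_n)) =
  ((expR (s * lambda))%:C)%C * desc (evolution L N (- s) *m rprod j *m groundM R L N) S.
Proof.
move=> jn; rewrite -(subKn jn); elim: (n - j)%N (leq_subr j n) s S => [|d IH] dn s S st.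
  rewrite subn0 drop_oversize ?size_enum_ord //= /rprod rank1_prod_end mulmx1.
  rewrite evolution_ground // desc_scaleG mulrA -rmorphM /= -expRD mulNr subrr expR0 mul1r.
  rewrite groundR_complex //; congr (desc _ S); apply/funext => x; apply/funext => j'.
  by rewrite mxE.
have lt : (n - d.+1 < n)%N by rewrite ltn_subrL (leq_ltn_trans _ dn).
pose a := Ordinal lt.
have aE : a.+1 = (n - d)%N by rewrite /= subnSK.
have sa : s <= t a by apply: st.
rewrite (drop_nth a) ?size_enum_ord // -[(n - d.+1)%N]/(nat_of_ord a) nth_ord_enum aE /=.
have IH' S' := IH (ltnW dn) (t a) S' _.
transitivity (\sum_S' ((expR (s * lambda))%:C)%C * (((transfer N (t a - s) S S')%:C)%C *
    desc (evolution L N (- t a) *m rprod a *m groundM R L N) S')).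
  apply: eq_bigr => S' _.
  rewrite IH' => [|b ab]; last by apply/t_sorted/ltnW; rewrite -aE in ab.
  rewrite -chain_step -[in RHS]mulmxA -occ_weight_desc /ntransfer aE.
  have -> : expR (s * lambda) = expR (- ((t a - s) * lambda)) * expR (t a * lambda).
    by rewrite -expRD; congr expR; ring.
  by rewrite !rmorphM /=; ring.
rewrite -mulr_sumr; congr (_ * _).
have {1}<- : evolution L N (t a - s) *m (evolution L N (- t a) *m rprod a *m groundM R L N)
    = evolution L N (- s) *m rprod a *m groundM R L N.
  rewrite !mulmxA -evolutionD //.
  by have -> : t a - s + - t a = - s by rewrite addrAC subrr add0r.
by rewrite transfer_desc ?subr_ge0.
Qed.

Lemma sum_wchain_tuple p s S (l : seq 'I_n) : size l = p ->
  \sum_(st : p.-tuple E) ((wchain s S (map t l) st)%:C)%C *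
     \prod_(p <- zip l st) occ_weight p.1 p.2 = chain s S l.
Proof. by move=> <-; exact: sum_wchain. Qed.

Definition correlation_matrix : 'M[C]_n :=
  Ymx *m (groundM R L N *m groundM' R L N) *m Xmx - strict_upper (Ymx *m Xmx).

End Times.

(** The stationary weight r^2 / L^N shows up as one r at each end: the Markov kernel is [ntransfer]
    conjugated by r, and the inner values of r cancel. *)
Definition path_weight (ts : seq R) (st : seq E) : R :=
  match ts, st with
  | t :: ts', S0 :: st' => L%:R ^- N * (r S0 * wchain t S0 ts' st')
  | _, _ => 1
  end.

Lemma prod_zip_tuple n (g : 'I_n -> E -> C) (st : n.-tuple E) :
  \prod_(p <- zip (enum 'I_n) st) g p.1 p.2 = \prod_a g a (tnth st a).
Proof.
have -> : zip (enum 'I_n) st = map (fun a => (a, tnth st a)) (enum 'I_n).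
  rewrite -{1}(map_tnth_enum st).
  by elim: (enum 'I_n) => //= a l ->.
by rewrite big_map big_enum.
Qed.

(** Pairing the backward chain with the left eigenvector leaves an N x N determinant compressed to
    the lowest momenta. By stationarity the first time cancels: its propagator only contributes the
    exponential of the ground energy. *)
Lemma sum_path_weight n (t : 'I_n -> R) (k : 'I_n -> 'Z_L) (u : C) :
  (forall a b : 'I_n, (a <= b)%N -> t a <= t b) ->
  \sum_(st : n.-tuple E) ((path_weight (map t (enum 'I_n)) st)%:C)%C *
     \prod_a occ_weight k u a (tnth st a) =
  \det (1%:M + u *: correlation_matrix t k).
Proof.
case: n => [|n] in t k *.
  move=> _; rewrite det_mx00 (big_pred1 [tuple]) => [|st]; last by apply/esym/eqP; exact: tuple0.
  rewrite big_ord0 mulr1 (_ : enum 'I_0 = [::]) //; apply: size0nil.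
  by rewrite size_enum_ord.
move=> t_sorted; rewrite -det_rank1_prod ?groundM'K //.
have enumE : enum 'I_n.+1 = ord0 :: drop 1 (enum 'I_n.+1).
  rewrite -[LHS]drop0 (drop_nth ord0) ?size_enum_ord //; congr (_ :: _).
  by rewrite -[0%N]/(nat_of_ord (ord0 : 'I_n.+1)) nth_ord_enum.
under eq_bigr do rewrite -prod_zip_tuple.
rewrite sum_tuple_cons {1 2}enumE /=.
transitivity (((L%:R ^- N : R)%:C)%C * \sum_S ((r S)%:C)%C *
    (occ_weight k u ord0 S * chain t k u (t ord0) S (drop 1 (enum 'I_n.+1)))).
  rewrite mulr_sumr; apply: eq_bigr => S _.
  rewrite -(@sum_wchain_tuple _ _ _ _ n) ?size_drop ?size_enum_ord ?subn1 //.
  rewrite !mulr_sumr; apply: eq_bigr => st _.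
  by rewrite enumE /= big_cons !rmorphM /=; ring.
transitivity (((L%:R ^- N : R)%:C)%C * ((expR (t ord0 * lambda))%:C)%C * \sum_S ((r S)%:C)%C *
    desc (evolution L N (- t ord0) *m rprod t k u 0 *m groundM R L N) S).
  rewrite -mulrA; congr (_ * _); rewrite mulr_sumr; apply: eq_bigr => S _.
  rewrite chainE // => [|a _]; last exact: t_sorted.
  rewrite [occ_weight _ _ _ _ * _]mulrCA [LHS]mulrCA; congr (_ * (_ * _)).
  by rewrite occ_weight_desc -(chain_step t k u ord0) !mulmxA.
rewrite sum_groundR_desc //.
set W := rprod t k u 0.
have -> : \matrix_(i, j) (\sum_x (ground R x i)^*%C *
    (evolution L N (- t ord0) *m W *m groundM R L N) x j) =
    L%:R *: (groundM' R L N *m (evolution L N (- t ord0) *m W *m groundM R L N)).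
  apply/matrixP => i j; rewrite !mxE mulr_sumr; apply: eq_bigr => x _.
  by rewrite [groundM' R L N i x]mxE !mulrA mulfV ?mul1r ?LC_neq0.
rewrite detZ !mulmxA ground_evolution // -!mulmxA det_mulmx det_expG // !mulmxA.
set D := \det (groundM' R L N *m W *m _).
have e1 : ((expR (t ord0 * lambda))%:C)%C * ((expR (- t ord0 * lambda))%:C)%C = 1.
  by rewrite -rmorphM /= -expRD mulNr subrr expR0.
have L1 : ((L%:R ^- N : R)%:C)%C * L%:R ^+ N = 1.
  by rewrite fmorphV /= rmorphXn /= rmorph_nat mulVf // expf_neq0 // LC_neq0.
by rewrite mulrACA L1 mul1r [LHS]mulrA e1 mul1r.
Qed.

Lemma kernel_termE (a b : R) (x y : 'Z_L) (h : 'Z_L) :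
  kernel_term N (a - b) (y - x) (h%:Z - m%:Z) =
  plane R N x h * cexp (((b - a)%:C)%C * zh R N h) * (plane R N y h)^*%C.
Proof.
rewrite /kernel_term /zh -rmorphN opprB [RHS]mulrAC [RHS]mulrC; congr (_ * _).
rewrite unit_rootN (unit_root_ZpD R L_gt1) (unit_root_ZpN R L_gt1).
by rewrite unit_rootN rmorphM /= conjcK mulrC.
Qed.

Lemma row_Y n (t : 'I_n -> R) k a :
  row a (Ymx t k) = row (k a) (evolution L N (- t a)).
Proof. by apply/matrixP => x j; rewrite !mxE. Qed.

Lemma col_X n (t : 'I_n -> R) k a :
  col a (Xmx t k) = col (k a) (evolution L N (t a)).
Proof. by apply/matrixP => x j; rewrite !mxE. Qed.

Lemma mulYX n (t : 'I_n -> R) k (M : 'M[C]_q) a b :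
  (Ymx t k *m M *m Xmx t k) a b =
  (evolution L N (- t a) *m M *m evolution L N (t b)) (k a) (k b).
Proof.
have rc p1 p2 (A : 'M[C]_(p1, q)) (B : 'M[C]_(q, p2)) i j :
    (A *m M *m B) i j = (row i A *m M *m col j B) 0 0.
  rewrite -row_mul mxE [RHS]mxE; apply: eq_bigr => x _.
  by rewrite [row i (A *m M) 0 x]mxE [col j B x 0]mxE.
by rewrite [LHS]rc [RHS]rc row_Y col_X.
Qed.

Definition kterm (a b : R) (x y : 'Z_L) (h : nat) : C :=
  kernel_term N (a - b) (y - x) (h%:Z - m%:Z).

Lemma projected_entry (a b : R) (x y : 'Z_L) :
  (evolution L N (- a) *m (groundM R L N *m groundM' R L N) *m evolution L N b) x y =
  L%:R^-1 * \sum_(0 <= h < N) kterm a b x y h.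
Proof.
rewrite mulmxA evolution_ground // -mulmxA ground_evolution // !mulmxA.
rewrite -[groundM R L N *m _ *m _]mulmxA {1 2}/expG mulmx_diag mul_mx_diag.
rewrite mxE big_mkord mulr_sumr; apply: eq_bigr => j _.
rewrite /kterm -(occupiedE L_gt1 N_ltL j) kernel_termE !mxE -cexpD -mulrDl -rmorphD /=.
by rewrite [- a + b]addrC [LHS]mulrCA.
Qed.

Lemma evolution_entry (a b : R) (x y : 'Z_L) :
  evolution L N (b - a) x y = L%:R^-1 * \sum_(0 <= h < L) kterm a b x y h.
Proof.
transitivity (L%:R^-1 * \sum_(h : 'Z_L) kterm a b x y h).
  rewrite mxE; congr (_ * _); apply: eq_bigr => h _.
  by rewrite /kterm kernel_termE.
by rewrite -(big_mkord xpredT (kterm a b x y)) Zp_cast.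
Qed.

(** For both parities, shifting momenta by m turns the two summation ranges into the occupied window
    [0, N) and the empty window [N, L). *)
Lemma stone_kernelE (a b : R) (x y : 'Z_L) :
  stone_kernel N (a - b) (y - x) =
  if b <= a then L%:R^-1 * \sum_(0 <= h < N) kterm a b x y h
  else - (L%:R^-1 * \sum_(N <= h < L) kterm a b x y h).
Proof.
rewrite /stone_kernel subr_ge0; have NE := odd_double_half N.
have shiftE r : kterm a b x y (r + m) = kernel_term N (a - b) (y - x) r%:Z.
  by rewrite /kterm PoszD addrK.
have upper p : \sum_(p <= r < L - m) kernel_term N (a - b) (y - x) r%:Z =
    \sum_(p + m <= h < L) kterm a b x y h.
  by rewrite big_addn; apply: eq_bigr => r _; rewrite shiftE.
have mE : (m + m)%N = m.*2 by rewrite addnn.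
case: ifP => oN; rewrite oN /= in NE; case: ifP => _.
- by have -> : (2 * m).+1 = N by rewrite mul2n.
- by rewrite upper; have -> : (m.+1 + m)%N = N by rewrite addSn mE.
- by have -> : (2 * m)%N = N by rewrite mul2n.
- by rewrite upper; have -> : (m + m)%N = N by rewrite mE.
Qed.

(** On and below the diagonal only the projection onto low momenta remains: the first branch. Above
    it the full propagator is subtracted, which leaves minus the high momenta: the second branch. *)
Lemma correlation_matrixE n (t : 'I_n -> R) (k : 'I_n -> 'Z_L) :
  (forall a b : 'I_n, (a <= b)%N -> t a <= t b) ->
  injective (fun a => (t a, k a)) ->
  correlation_matrix t k = \matrix_(a, b) stone_kernel N (t a - t b) (k b - k a).
Proof.
move=> t_sorted tk_inj; apply/matrixP => a b.
rewrite [RHS]mxE stone_kernelE /correlation_matrix [LHS]mxE mulYX projected_entry.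
rewrite [X in _ + X]mxE [X in _ - X]mxE.
case: (ltnP a b) => ab; last by rewrite subr0 t_sorted.
rewrite -[Ymx t k]mulmx1 mulYX mulmx1 -evolutionD // [- t a + _]addrC evolution_entry.
case: leP => tab.
  (* Equal times with a < b belong to the first branch: the subtracted propagator is the identity,
     with entry 0 since the positions must differ. *)
  have tE : t a = t b by apply/eqP; rewrite eq_le tab t_sorted // ltnW.
  rewrite -evolution_entry tE subrr evolution0 // mxE.
  suff /negPf -> : k a != k b by rewrite subr0.
  apply: contraTneq ab => kE; rewrite (tk_inj a b) ?ltnn //.
  by rewrite tE kE.
rewrite -mulrBr -mulrN; congr (_ * _).
rewrite (@big_cat_nat _ _ _ N 0 L) //= ?(ltnW N_ltL) //.
by rewrite opprD addrA subrr add0r.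
Qed.

Lemma sum_path_weight_occupied n (t : 'I_n -> R) (k : 'I_n -> 'Z_L) :
  (forall a b : 'I_n, (a <= b)%N -> t a <= t b) ->
  injective (fun a => (t a, k a)) ->
  ((\sum_(st : n.-tuple E) path_weight (map t (enum 'I_n)) st *
     \prod_a (k a \in tnth st a)%:R)%:C)%C =
  \det (\matrix_(a, b) stone_kernel N (t a - t b) (k b - k a)).
Proof.
move=> t_sorted tk_inj; rewrite -correlation_matrixE // rmorph_sum /=.
rewrite -(top_coef_det (p := fun st : n.-tuple E => ((path_weight (map t (enum 'I_n)) st)%:C)%C)
   (b := fun (st : n.-tuple E) a => k a \in tnth st a)).
  apply: eq_bigr => st _; rewrite rmorphM /= rmorph_prod; congr (_ * _).
  by apply: eq_bigr => a _; rewrite rmorph_nat.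
by move=> u; rewrite -(sum_path_weight k u t_sorted).
Qed.

End Correlations.

(** * Entropy of stationary sequences *)

Lemma sum_tuple_rcons (V : nmodType) (T : finType) n (F : n.+1.-tuple T -> V) :
  \sum_st F st = \sum_(st : n.-tuple T) \sum_x F [tuple of rcons st x].
Proof.
rewrite pair_bigA /=.
rewrite (reindex (fun p : n.-tuple T * T => [tuple of rcons p.1 p.2])) //=.
exists (fun st => ([tuple of belast (thead st) (behead st)], last (thead st) (behead st))).
  move=> [st x] _; case: n F st => [|n] F st.
    rewrite (tuple0 st) /=; congr pair; exact/val_inj.
  case/tupleP: st => y st; congr pair; last by rewrite /= last_rcons.
  by apply/val_inj; rewrite /= belast_rcons.
move=> st _; apply/val_inj; case/tupleP: st => y st /=.
by rewrite -lastI.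
Qed.

Section Gibbs.
Variable R : realType.
Implicit Types p q : R.

(** A summand of the relative entropy. The correction p - q makes each summand nonnegative and
    cancels in the sum over two probability laws. *)
Definition gibbs p q : R := p * (ln p - ln q) - (p - q).

(** This is ln x <= x - 1 at x = q / p, with equality only at x = 1. Absolute continuity has to be
    assumed because ln 0 = 0. *)
Lemma gibbsP p q : 0 <= p -> 0 <= q -> (q = 0 -> p = 0) ->
  0 <= gibbs p q /\ (gibbs p q = 0 -> p = q).
Proof.
move=> p0 q0 qp; rewrite /gibbs.
have [pE|pn0] := eqVneq p 0.
  by rewrite pE mul0r sub0r opprB subr0; split => // ->.
have {}p0 : 0 < p by rewrite lt_neqAle eq_sym pn0.
have {qp}q0' : 0 < q.
  by rewrite lt_neqAle q0 andbT eq_sym; apply: contra_neq pn0.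
have -> : p * (ln p - ln q) - (p - q) = p * (q / p - 1 - ln (q / p)).
  by rewrite ln_div ?posrE //; field; rewrite gt_eqF.
set x := q / p; have x0 : 0 < x by rewrite divr_gt0.
have lnx : ln x <= x - 1.
  by rewrite -[in leLHS](subrK 1 x) [x - 1 + 1]addrC le_ln1Dx // ltrBrDl subrr.
split; first by apply: mulr_ge0; [exact: ltW | rewrite subr_ge0].
move=> /eqP; rewrite mulf_eq0 gt_eqF //= => /eqP xE.
have : ln x = 0.
  apply/eqP; apply: contraT => /expR_gt1Dx; rewrite lnK ?posrE //.
  by rewrite ltNge (_ : 1 + ln x = x) ?lexx //; lra.
move/eqP; rewrite ln_eq0 // => /eqP x1.
by rewrite -[q](divfK pn0) -/x x1 mul1r.
Qed.

End Gibbs.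

Section Words.
Variables (R : realType) (E : finType) (p : seq E -> R).
Hypothesis p_ge0 : forall w, 0 <= p w.
Hypothesis p_nil : p [::] = 1.
Hypothesis p_rcons : forall w, \sum_x p (rcons w x) = p w.
Hypothesis p_cons : forall w, \sum_x p (x :: w) = p w.

Definition word_entropy n := - \sum_(st : n.-tuple E) p st * ln (p st).
(** Conditional entropy of a letter given the n preceding ones. *)
Definition entropy_rate n := word_entropy n.+1 - word_entropy n.

Lemma p_rcons_le w x : p (rcons w x) <= p w.
Proof.
rewrite -(p_rcons w) (bigD1 x) //= lerDl; apply: sumr_ge0 => y _; exact: p_ge0.
Qed.

Lemma p_cons_le w x : p (x :: w) <= p w.
Proof.
rewrite -(p_cons w) (bigD1 x) //= lerDl; apply: sumr_ge0 => y _; exact: p_ge0.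
Qed.

Lemma p_suffix_le v w : p (v ++ w) <= p w.
Proof. by elim: v => //= x v IH; exact: le_trans (p_cons_le _ _) IH. Qed.

Lemma sum_prefix n w : \sum_(st : n.-tuple E) p (st ++ w) = p w.
Proof.
elim: n => [|n IH].
  by rewrite (big_pred1 [tuple]) => [|st] //; apply/esym/eqP; exact: tuple0.
rewrite sum_tuple_cons exchange_big -[RHS]IH; apply: eq_bigr => st _ /=.
exact: p_cons.
Qed.

Lemma sum_words n : \sum_(st : n.-tuple E) p st = 1.
Proof.
by rewrite -p_nil -(sum_prefix n [::]); apply: eq_bigr => st _; rewrite cats0.
Qed.

Lemma word_entropy0 : word_entropy 0 = 0.
Proof.
rewrite /word_entropy (big_pred1 [tuple]) => [|st]; last by apply/esym/eqP; exact: tuple0.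
by rewrite /= p_nil ln1 mulr0 oppr0.
Qed.

Lemma entropy_rate_ge0 n : 0 <= entropy_rate n.
Proof.
rewrite /entropy_rate /word_entropy sum_tuple_rcons opprK addrC -sumrB.
apply: sumr_ge0 => st _; rewrite -[X in X * _ - _](p_rcons st) mulr_suml -sumrB.
apply: sumr_ge0 => x _ /=; rewrite -mulrBr.
have [->|n0] := eqVneq (p (rcons st x)) 0; first by rewrite mul0r.
have r0 : 0 < p (rcons st x) by rewrite lt_neqAle eq_sym n0 p_ge0.
rewrite mulr_ge0 // subr_ge0 ler_ln ?posrE ?p_rcons_le //.
exact: lt_le_trans r0 (p_rcons_le _ _).
Qed.

(** Strong subadditivity: Gibbs' inequality for n + 2 letters against the law that makes the first
    and the last letter independent given the n letters between them. *)
Lemma entropy_rate_decr n : entropy_rate n.+1 <= entropy_rate n.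
Proof.
pose P1 (a : E) (st : n.-tuple E) b := p (a :: rcons st b).
pose Q1 (a : E) (st : n.-tuple E) b := p (a :: st) * p (rcons st b) / p st.
have P1pos a (st : n.-tuple E) b : P1 a st b != 0 ->
    [/\ 0 < p (a :: st), 0 < p (rcons st b) & 0 < p st].
  move=> n0; have r0 : 0 < P1 a st b by rewrite lt_neqAle eq_sym n0 p_ge0.
  have s1 : 0 < p (a :: st).
    by apply: (lt_le_trans r0); rewrite /P1 -rcons_cons p_rcons_le.
  split => //; first exact: lt_le_trans r0 (p_cons_le _ _).
  exact: lt_le_trans s1 (p_cons_le _ _).
have G a (st : n.-tuple E) b : 0 <= gibbs (P1 a st b) (Q1 a st b).
  apply: (gibbsP _ _ _).1; rewrite ?p_ge0 ?divr_ge0 ?mulr_ge0 //.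
  move=> q0; apply/eqP; apply: contraT => /P1pos[a0 b0 c0].
  by have := gt_eqF (divr_gt0 (mulr_gt0 a0 b0) c0); rewrite -/(Q1 a st b) q0 eqxx.
have sumG : 0 <= \sum_a \sum_(st : n.-tuple E) \sum_b gibbs (P1 a st b) (Q1 a st b).
  by apply: sumr_ge0 => a _; apply: sumr_ge0 => st _; apply: sumr_ge0.
have gE a (st : n.-tuple E) b : gibbs (P1 a st b) (Q1 a st b) =
    P1 a st b * ln (P1 a st b) - P1 a st b * ln (p (a :: st))
    - P1 a st b * ln (p (rcons st b)) + P1 a st b * ln (p st) - P1 a st b + Q1 a st b.
  rewrite /gibbs; have [->|/P1pos[a0 b0 c0]] := eqVneq (P1 a st b) 0.
    by rewrite !mul0r; ring.
  by rewrite /Q1 ln_div ?lnM ?posrE ?mulr_gt0 //; ring.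
move: sumG; under eq_bigr do under eq_bigr do under eq_bigr do rewrite gE.
have SD (F G' : E -> n.-tuple E -> E -> R) :
    \sum_a \sum_(st : n.-tuple E) \sum_b (F a st b + G' a st b) =
    \sum_a \sum_(st : n.-tuple E) \sum_b F a st b +
    \sum_a \sum_(st : n.-tuple E) \sum_b G' a st b.
  rewrite -big_split; apply: eq_bigr => a _; rewrite -big_split.
  by apply: eq_bigr => st _; rewrite -big_split.
have SN (F : E -> n.-tuple E -> E -> R) :
    \sum_a \sum_(st : n.-tuple E) \sum_b (- F a st b) =
    - \sum_a \sum_(st : n.-tuple E) \sum_b F a st b.
  rewrite -sumrN; apply: eq_bigr => a _; rewrite -sumrN.
  by apply: eq_bigr => st _; rewrite -sumrN.
have E1 : \sum_a \sum_(st : n.-tuple E) \sum_b P1 a st b * ln (P1 a st b) = - word_entropy n.+2.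
  rewrite /word_entropy opprK sum_tuple_cons; apply: eq_bigr => a _.
  by rewrite sum_tuple_rcons.
have E2 : \sum_a \sum_(st : n.-tuple E) \sum_b P1 a st b * ln (p (a :: st)) = - word_entropy n.+1.
  rewrite /word_entropy opprK sum_tuple_cons; apply: eq_bigr => a _; apply: eq_bigr => st _.
  by rewrite -mulr_suml /P1 -(p_rcons (a :: st)).
have E3 : \sum_a \sum_(st : n.-tuple E) \sum_b P1 a st b * ln (p (rcons st b)) = - word_entropy n.+1.
  rewrite /word_entropy opprK sum_tuple_rcons exchange_big; apply: eq_bigr => st _.
  rewrite exchange_big; apply: eq_bigr => b _.
  by rewrite -mulr_suml /P1 p_cons.
have E4 : \sum_a \sum_(st : n.-tuple E) \sum_b P1 a st b * ln (p st) = - word_entropy n.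
  rewrite /word_entropy opprK exchange_big; apply: eq_bigr => st _.
  rewrite exchange_big -[X in _ = X * _]p_rcons mulr_suml; apply: eq_bigr => b _.
  by rewrite -mulr_suml /P1 p_cons.
have E5 : \sum_a \sum_(st : n.-tuple E) \sum_b P1 a st b = 1.
  rewrite -(sum_words n) exchange_big; apply: eq_bigr => st _.
  rewrite exchange_big -[RHS]p_rcons; apply: eq_bigr => b _.
  by rewrite /P1 p_cons.
have E6 : \sum_a \sum_(st : n.-tuple E) \sum_b Q1 a st b = 1.
  rewrite -(sum_words n) exchange_big; apply: eq_bigr => st _.
  under eq_bigr do rewrite /Q1 -mulr_suml -mulr_sumr p_rcons.
  rewrite -!mulr_suml p_cons.
  by have [->|n0] := eqVneq (p st) 0; rewrite ?mul0r // mulfK.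
rewrite !(SD, SN) E1 E2 E3 E4 E5 E6 /entropy_rate; lra.
Qed.

Lemma sum_tuple_rcons_p n (F : E -> R) :
  \sum_(st : n.-tuple E) \sum_x p (rcons st x) * F x = \sum_x p [:: x] * F x.
Proof.
rewrite exchange_big; apply: eq_bigr => x _; rewrite -mulr_suml; congr (_ * _).
by rewrite -(sum_prefix n); apply: eq_bigr => st _; rewrite cats1.
Qed.

Section Parry.
Variables (a : rel E) (r : E -> R) (lam : R).
Hypothesis r_ge0 : forall x, 0 <= r x.
Hypothesis lam_gt0 : 0 < lam.
Hypothesis r_right : forall x, \sum_y (a x y)%:R * r y = lam * r x.
Hypothesis r_left : forall y, \sum_x r x * (a x y)%:R = lam * r y.
Hypothesis a_support : forall x y, a x y -> 0 < r x /\ 0 < r y.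
Hypothesis p_jump : forall x y, p [:: x; y] != 0 -> a x y.

Definition parry_step x y : R := (a x y)%:R * r y / (lam * r x).

Lemma parry_step_ge0 x y : 0 <= parry_step x y.
Proof. by apply: divr_ge0; apply: mulr_ge0; rewrite ?ler0n ?r_ge0 ?(ltW lam_gt0). Qed.

Lemma sum_parry_step x : 0 < r x -> \sum_y parry_step x y = 1.
Proof.
by move=> rx; rewrite -mulr_suml r_right divff // mulf_neq0 ?gt_eqF.
Qed.

(** A letter of positive probability has a successor of positive probability, and r is positive at
    the ends of an edge. *)
Lemma p_support w x : p (rcons w x) != 0 -> 0 < r x.
Proof.
move=> n0; have : p [:: x] != 0.
  apply: contra_neq n0 => x0; apply/eqP; rewrite eq_le p_ge0 andbT -x0 -cats1.
  exact: p_suffix_le.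
rewrite -(p_rcons [:: x]) => /eqP/psumr_neq0P[y _|y /andP[_ y0]]; first exact: p_ge0.
by have [] := a_support (p_jump (lt0r_neq0 y0)).
Qed.

Definition step_weight w x y : R := p (rcons w x) * parry_step x y.

Lemma step_gibbs w x y :
  0 <= gibbs (p (rcons (rcons w x) y)) (step_weight w x y) /\
  (gibbs (p (rcons (rcons w x) y)) (step_weight w x y) = 0 ->
   p (rcons (rcons w x) y) = step_weight w x y).
Proof.
apply: gibbsP; [exact: p_ge0 | by apply: mulr_ge0; [exact: p_ge0 | exact: parry_step_ge0] |].
move=> /eqP.
rewrite /step_weight mulf_eq0 => /orP[/eqP x0|/eqP P0].
  by apply/eqP; rewrite eq_le p_ge0 andbT -x0 p_rcons_le.
apply/eqP; apply: contraT => n0.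
have axy : a x y.
  apply: p_jump; apply: contra_neq n0 => xy0; apply/eqP.
  rewrite eq_le p_ge0 andbT -xy0 -!cats1 -catA; exact: p_suffix_le.
have [rx ry] := a_support axy.
have := gt_eqF (divr_gt0 ry (mulr_gt0 lam_gt0 rx)).
by move/eqP: P0; rewrite /parry_step axy mul1r => ->.
Qed.

(** By stationarity the terms in ln (r x) and ln (r y) have the same sum, so r drops out and only
    its eigenvalue is left. *)
Lemma sum_step_gibbs n :
  \sum_(st : n.-tuple E) \sum_x \sum_y
     gibbs (p (rcons (rcons st x) y)) (step_weight st x y) =
  ln lam - entropy_rate n.+1.
Proof.
pose P2 (st : n.-tuple E) x y := p (rcons (rcons st x) y).
have gE (st : n.-tuple E) x y : gibbs (P2 st x y) (step_weight st x y) =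
    P2 st x y * ln (P2 st x y) - P2 st x y * ln (p (rcons st x)) - P2 st x y * ln (r y)
    + P2 st x y * ln (r x) + P2 st x y * ln lam - P2 st x y + step_weight st x y.
  have [_ _] := step_gibbs st x y; rewrite /gibbs -/(P2 st x y).
  have [->|n0] := eqVneq (P2 st x y) 0; first by rewrite !mul0r; ring.
  have axy : a x y.
    apply: p_jump; apply: contra_neq n0 => xy0; apply/eqP.
    rewrite eq_le p_ge0 andbT -xy0 /P2 -!cats1 -catA; exact: p_suffix_le.
  have [rx ry] := a_support axy.
  have px : 0 < p (rcons st x).
    by apply: lt_le_trans (p_rcons_le _ y); rewrite lt_neqAle eq_sym n0 p_ge0.
  rewrite /step_weight /parry_step axy mul1r lnM ?posrE ?divr_gt0 ?mulr_gt0 //.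
  by rewrite ln_div ?lnM ?posrE ?mulr_gt0 //; ring.
under eq_bigr do under eq_bigr do under eq_bigr do rewrite -/(P2 _ _ _) gE.
have SD (F G : n.-tuple E -> E -> E -> R) :
    \sum_(st : n.-tuple E) \sum_x \sum_y (F st x y + G st x y) =
    \sum_(st : n.-tuple E) \sum_x \sum_y F st x y +
    \sum_(st : n.-tuple E) \sum_x \sum_y G st x y.
  rewrite -big_split; apply: eq_bigr => st _; rewrite -big_split.
  by apply: eq_bigr => x _; rewrite -big_split.
have SN (F : n.-tuple E -> E -> E -> R) :
    \sum_(st : n.-tuple E) \sum_x \sum_y (- F st x y) =
    - \sum_(st : n.-tuple E) \sum_x \sum_y F st x y.
  rewrite -sumrN; apply: eq_bigr => st _; rewrite -sumrN.
  by apply: eq_bigr => x _; rewrite -sumrN.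
have E1 : \sum_st \sum_x \sum_y P2 st x y * ln (P2 st x y) = - word_entropy n.+2.
  by rewrite /word_entropy opprK !sum_tuple_rcons.
have E2 : \sum_st \sum_x \sum_y P2 st x y * ln (p (rcons st x)) = - word_entropy n.+1.
  rewrite /word_entropy opprK sum_tuple_rcons; apply: eq_bigr => st _.
  by apply: eq_bigr => x _; rewrite -mulr_suml p_rcons.
have E3 : \sum_st \sum_x \sum_y P2 st x y * ln (r y) = \sum_x p [:: x] * ln (r x).
  by rewrite -(sum_tuple_rcons_p n.+1) sum_tuple_rcons.
have E4 : \sum_st \sum_x \sum_y P2 st x y * ln (r x) = \sum_x p [:: x] * ln (r x).
  rewrite -(sum_tuple_rcons_p n); apply: eq_bigr => st _; apply: eq_bigr => x _.
  by rewrite -mulr_suml p_rcons.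
have E6 : \sum_st \sum_x \sum_y P2 st x y = 1.
  by rewrite -(sum_words n.+2) !sum_tuple_rcons.
have E5 : \sum_st \sum_x \sum_y P2 st x y * ln lam = ln lam.
  rewrite -[RHS]mul1r -[X in _ = X * _]E6 mulr_suml; apply: eq_bigr => st _.
  by rewrite mulr_suml; apply: eq_bigr => x _; rewrite mulr_suml.
have E7 : \sum_(st : n.-tuple E) \sum_x \sum_y step_weight st x y = 1.
  rewrite -(sum_words n.+1) sum_tuple_rcons; apply: eq_bigr => st _.
  apply: eq_bigr => x _; rewrite -mulr_sumr /=.
  have [->|/p_support rx] := eqVneq (p (rcons st x)) 0; first by rewrite mul0r.
  by rewrite sum_parry_step // mulr1.
rewrite !(SD, SN) E1 E2 E3 E4 E5 E6 E7 /entropy_rate; lra.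
Qed.

Lemma entropy_rate_le n : entropy_rate n.+1 <= ln lam.
Proof.
rewrite -subr_ge0 -sum_step_gibbs; apply: sumr_ge0 => st _; apply: sumr_ge0 => x _.
by apply: sumr_ge0 => y _; exact: (step_gibbs st x y).1.
Qed.

Lemma entropy_rate_max n : entropy_rate n.+1 = ln lam ->
  forall (st : n.-tuple E) x y, p (rcons (rcons st x) y) = step_weight st x y.
Proof.
move=> hn st x y; have := sum_step_gibbs n; rewrite hn subrr => /eqP.
have G0 st' x' y' := (step_gibbs st' x' y').1.
rewrite psumr_eq0 => [|st' _]; last by do 2![apply: sumr_ge0 => ? _].
move=> /allP/(_ st (mem_index_enum _)) /eqP/eqP.
rewrite psumr_eq0 => [|x' _]; last by apply: sumr_ge0 => ? _.
move=> /allP/(_ x (mem_index_enum _)) /eqP/eqP.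
rewrite psumr_eq0 // => /allP/(_ y (mem_index_enum _)) /eqP.
exact: (step_gibbs st x y).2.
Qed.

(** The rates decrease and are nonnegative, and the entropy per letter is their Cesaro mean, so the
    limit defining the entropy exists. *)
Lemma cvg_word_entropy :
  exists2 l, word_entropy n / n%:R @[n --> \oo] --> l &
    [/\ entropy_rate @ \oo --> l, forall n, l <= entropy_rate n & l <= ln lam].
Proof.
have decr : nonincreasing_seq entropy_rate.
  by apply/nonincreasing_seqP => n; exact: entropy_rate_decr.
have cv : cvgn entropy_rate.
  apply: nonincreasing_is_cvgn => //; exists 0 => _ [n _ <-].
  exact: entropy_rate_ge0.
have le n := nonincreasing_cvgn_ge decr cv n.
exists (limn entropy_rate); last first.
  by split => //; exact: le_trans (le 1%N) (entropy_rate_le 0).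
have hE n : word_entropy n = series entropy_rate n.
  rewrite (eq_sum_telescope word_entropy n) word_entropy0 add0r.
  by congr (series _ n).
rewrite -cvg_shiftS /=.
rewrite (_ : (fun n => _) = arithmetic_mean entropy_rate); first exact: cesaro cv.
by apply/funext => n; rewrite hE /arithmetic_mean /= mulrC.
Qed.

(** From the second on, the rates lie between their limit and ln lam. If the limit is ln lam they
    are all equal to it, and every Gibbs inequality is tight. *)
Theorem entropy_max_markov :
  (forall l, word_entropy n / n%:R @[n --> \oo] --> l -> ln lam <= l) ->
  forall w x y, p (rcons (rcons w x) y) = step_weight w x y.
Proof.
move=> hl w x y; have [l cl [cr ll lam_l]] := cvg_word_entropy.
have lE : l = ln lam by apply/eqP; rewrite eq_le lam_l hl.
apply: (entropy_rate_max (n := size w) _ (in_tuple w)).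
by apply/eqP; rewrite eq_le entropy_rate_le -lE ll.
Qed.

Theorem markov_entropy :
  (forall w x y, p (rcons (rcons w x) y) = step_weight w x y) ->
  word_entropy n / n%:R @[n --> \oo] --> ln lam.
Proof.
move=> mk; have rate n : entropy_rate n.+1 = ln lam.
  apply/eqP; rewrite eq_sym -subr_eq0 -sum_step_gibbs.
  apply/eqP/big1 => st _; apply: big1 => x _; apply: big1 => y _.
  by rewrite mk /gibbs !subrr mulr0 subrr.
have [l cl [cr ll lam_l]] := cvg_word_entropy.
suff <- : l = ln lam by [].
apply: (seq_cvg_unique cr); rewrite -cvg_shiftS /=.
rewrite (_ : (fun n => _) = fun=> ln lam); first exact: cvg_cst.
by apply/funext => n; rewrite rate.
Qed.

Hypothesis markov : forall w x y, p (rcons (rcons w x) y) = step_weight w x y.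

(* The maximum principle for this ratio gives uniqueness of the stationary law. *)
Definition density x : R := p [:: x] / r x ^+ 2.

(** Stationarity read backwards: the weights r x * a x y have total lam * r y over x, so the density
    at y is a weighted mean of its values at the predecessors. *)
Lemma density_harmonic y : 0 < r y ->
  \sum_x (density y - density x) * (r x * (a x y)%:R) = 0.
Proof.
move=> ry; under eq_bigr do rewrite mulrBl.
rewrite sumrB -mulr_sumr r_left.
have py : p [:: y] = \sum_x p [:: x] * parry_step x y.
  by rewrite -p_cons; apply: eq_bigr => x _; exact: (markov [::]).
have -> : density y * (lam * r y) = p [:: y] * lam / r y.
  by rewrite /density; field; rewrite gt_eqF.
rewrite py 2!mulr_suml -sumrB big1 // => x _; rewrite /density /parry_step.
case: (boolP (a x y)) => [axy|_]; last by rewrite !(mul0r, mulr0) subrr.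
have [rx _] := a_support axy.
by field; rewrite !gt_eqF.
Qed.

(** At a maximum all predecessors are maxima as well. The first hypothesis is irreducibility
    backwards in time: going back along edges one can always arrive at x0. *)
Lemma density_extremum (f : E -> R) x0 :
  (forall Q : E -> Prop, (forall x y, Q y -> a x y -> Q x) ->
     forall x, 0 < r x -> Q x -> Q x0) ->
  (forall y, 0 < r y -> \sum_x (f y - f x) * (r x * (a x y)%:R) = 0) ->
  forall x, 0 < r x -> f x <= f x0.
Proof.
move=> reach harm x rx.
pose z := [arg max_(y > x | 0 < r y) f y]%O.
have [rz zmax] : 0 < r z /\ forall y, 0 < r y -> f y <= f z.
  by rewrite /z; case: Order.TotalTheory.arg_maxP.
suff [_ ->] : 0 < r x0 /\ f x0 = f z by exact: zmax.
apply: (reach (fun y => 0 < r y /\ f y = f z) _ z) => // y y' [ry' fy'] ayy'.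
have [ry _] := a_support ayy'; split=> //.
have /eqP := harm y' ry'; rewrite psumr_eq0 => [|y1 _]; last first.
  case: (boolP (a y1 y')) => [/a_support[r1 _]|_]; last by rewrite !mulr0.
  by rewrite mulr1 mulr_ge0 ?(ltW r1) // subr_ge0 fy' zmax.
move=> /allP/(_ y (mem_index_enum _)) /=; rewrite ayy' mulr1 mulf_eq0.
by rewrite (gt_eqF ry) orbF subr_eq0 fy' => /eqP.
Qed.

Lemma stationary_law x0 :
  (forall Q : E -> Prop, (forall x y, Q y -> a x y -> Q x) ->
     forall x, 0 < r x -> Q x -> Q x0) ->
  forall x, p [:: x] = r x ^+ 2 / \sum_y r y ^+ 2.
Proof.
move=> reach.
have dens x : 0 < r x -> density x = density x0.
  move=> rx; apply/eqP; rewrite eq_le (density_extremum reach density_harmonic) //=.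
  rewrite -lerN2; apply: (density_extremum (f := fun y => - density y) reach) => // y ry.
  rewrite -[RHS]oppr0 -[X in _ = - X](density_harmonic ry) -sumrN; apply: eq_bigr => x1 _.
  by ring.
have pE x : p [:: x] = density x0 * r x ^+ 2.
  have [r0|rn0] := eqVneq (r x) 0.
    rewrite r0 expr0n mulr0; apply/eqP; apply: contraT => /(p_support (w := [::])).
    by rewrite r0 ltxx.
  have rx : 0 < r x by rewrite lt_neqAle eq_sym rn0 r_ge0.
  by rewrite -(dens x rx) /density divfK // expf_neq0.
have tot : density x0 * \sum_y r y ^+ 2 = 1.
  rewrite mulr_sumr -[RHS]p_nil -[RHS]p_rcons; apply: eq_bigr => y _.
  by rewrite -pE.
have Z0 : \sum_y r y ^+ 2 != 0.
  by apply: contra_eq_neq tot => ->; rewrite mulr0 eq_sym oner_eq0.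
by move=> x; rewrite pE mulrC -[density x0](mulfK Z0) tot mul1r.
Qed.

End Parry.

End Words.

(** * Finite additivity and cylinder events *)

Section FiniteProbability.
Context {R : realType} {d : measure_display} {T : measurableType d}.
Variable P : probability T R.

Definition pr (A : set T) : R := fine (P A).

Lemma prE A : measurable A -> P A = (pr A)%:E.
Proof. by move=> mA; rewrite /pr fineK // fin_num_measure. Qed.

Lemma pr_ge0 A : 0 <= pr A.
Proof. exact: fine_ge0. Qed.

Lemma prT : pr setT = 1.
Proof. by rewrite /pr probability_setT. Qed.

Lemma pr0 : pr set0 = 0.
Proof. by rewrite /pr measure0. Qed.

Lemma prU A B : measurable A -> measurable B -> A `&` B = set0 ->
  pr (A `|` B) = pr A + pr B.
Proof.
move=> mA mB AB; apply: EFin_inj; rewrite -prE ?measureU ?EFinD -?prE //.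
exact: measurableU.
Qed.

Lemma pr_le A B : measurable A -> measurable B -> A `<=` B -> pr A <= pr B.
Proof. by move=> mA mB AB; rewrite -lee_fin -!prE // le_measure ?inE. Qed.

Lemma pr_partition (I : finType) (f : T -> I) A :
  measurable A -> (forall j, measurable [set x | f x = j]) ->
  pr A = \sum_j pr (A `&` [set x | f x = j]).
Proof.
move=> mA mf.
have seqP (s : seq I) : uniq s ->
    measurable (A `&` [set x | f x \in s]) /\
    pr (A `&` [set x | f x \in s]) = \sum_(j <- s) pr (A `&` [set x | f x = j]).
  elim: s => [|j s IH] /=.
    have -> : [set x | f x \in [::]] = set0 by apply/seteqP; split.
    by rewrite setI0 pr0 big_nil.
  move=> /andP[js us]; have [ms IHs] := IH us.
  have -> : A `&` [set x | f x \in j :: s] =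
      (A `&` [set x | f x = j]) `|` (A `&` [set x | f x \in s]).
    rewrite -setIUr; congr (_ `&` _); apply/seteqP; split=> x /=; rewrite inE.
      by move/orP => [/eqP|]; [left|right].
    by case=> [->|->]; rewrite ?eqxx ?orbT.
  have mj : measurable (A `&` [set x | f x = j]) by exact: measurableI.
  split; first exact: measurableU.
  rewrite prU // ?big_cons ?IHs //.
  apply/seteqP; split=> // x [[_ /= xj] [_ /= xs]].
  by rewrite xj (negPf js) in xs.
have [_ <-] := seqP (index_enum I) (index_enum_uniq I).
by congr pr; apply/seteqP; split=> [x Ax|x []//]; split => //=; rewrite mem_index_enum.
Qed.

End FiniteProbability.

Section StateSequences.
Variables (R : realType) (L : nat).
Local Notation E := {set 'Z_L}.
Local Notation Om := (state_seq L).

Lemma measurable_coord (j : int) (B : set E) : measurable [set x : Om | B (x j)].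
Proof. by apply: sub_sigma_algebra; exists j; exists B. Qed.

Fixpoint cyl (j : int) (w : seq E) : set Om :=
  if w is e :: w' then [set x : Om | x j = e] `&` cyl (j + 1) w' else setT.

Lemma measurable_cyl j w : measurable (cyl j w).
Proof.
elim: w j => [|S w IH] j /=; first exact: measurableT.
by apply: measurableI; [exact: (measurable_coord j [set S])|exact: IH].
Qed.

Lemma cylE j w x :
  cyl j w x <-> forall n, (n < size w)%N -> x (j + n%:Z) = nth finset.set0 w n.
Proof.
elim: w j => [|S w IH] j /=; first by split.
split=> [[xj /IH xw] [|n] //= nw|H].
- by rewrite addr0.
- by have := xw n nw; rewrite -addrA -PoszD add1n.
- split; first by have := H 0%N isT; rewrite addr0.
  by apply/IH => n nw; have := H n.+1 nw; rewrite -addrA -PoszD add1n.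
Qed.

Lemma cyl_rcons j w S :
  cyl j (rcons w S) = cyl j w `&` [set x | x (j + (size w)%:Z) = S].
Proof.
elim: w j => [|S0 w IH] j /=; first by rewrite setIC addr0.
by rewrite IH setIA -[j + 1 + _]addrA -PoszD add1n.
Qed.

Lemma cyl_shift j w : @seq_shift L @^-1` cyl j w = cyl (j + 1) w.
Proof.
elim: w j => [|S w IH] j /=; first exact: preimage_setT.
by rewrite preimage_setI IH.
Qed.

Lemma measurable_chain_paths N : measurable (@chain_paths L N).
Proof.
pose A (j : int) := [set x : Om | #|x j| = N /\ jump (x j) (x (j + 1))].
have mA j : measurable (A j).
  have -> : A j = \big[setU/set0]_(S : E) \big[setU/set0]_(S' : E | (#|S| == N) && jump S S')
      ([set x : Om | x j = S] `&` [set x : Om | x (j + 1) = S']).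
    rewrite -bigcup_seq_cond; apply/seteqP; split=> x.
      move=> [xN xJ]; exists (x j) => //=; first by rewrite mem_index_enum.
      rewrite -bigcup_seq_cond; exists (x (j + 1)) => //=.
      by rewrite mem_index_enum xN eqxx.
    move=> [S _]; rewrite -bigcup_seq_cond => -[S' /andP[_ /andP[/eqP SN SJ]] [/= xS xS']].
    by rewrite /A /= xS xS'.
  apply: bigsetU_measurable => S _; apply: bigsetU_measurable => S' _.
  apply: measurableI; first exact: (measurable_coord j [set S]).
  exact: (measurable_coord (j + 1) [set S']).
have -> : @chain_paths L N = \bigcap_(n : nat) (A n%:Z `&` A (Negz n)).
  apply/seteqP; split=> x H; first by move=> n _; split; exact: H.
  by case=> n; have [] := H n I.
by apply: bigcapT_measurable => n; apply: measurableI.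
Qed.

Section Invariant.
Variables (N : nat) (mu : probability Om R).
Hypothesis mu_inv : chain_invariant N mu.

Definition wp (w : seq E) : R := pr mu (cyl 0 w).

Lemma wp_shift j w : pr mu (cyl j w) = wp w.
Proof.
have step j' : pr mu (cyl (j' + 1) w) = pr mu (cyl j' w).
  by rewrite /pr -cyl_shift mu_inv.2 //; exact: measurable_cyl.
have pos n : pr mu (cyl n%:Z w) = wp w.
  elim: n => // n IH; have -> : n.+1%:Z = n%:Z + 1 by rewrite -addn1 PoszD.
  by rewrite step.
have neg n : pr mu (cyl (- n%:Z) w) = wp w.
  elim: n => [|n IH]; first by rewrite oppr0.
  rewrite -IH -step; congr (pr mu (cyl _ w)).
  by rewrite -[n.+1]addn1 PoszD opprD addrNK.
by case: j => n //; rewrite NegzE.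
Qed.

Lemma wp_ge0 w : 0 <= wp w.
Proof. exact: pr_ge0. Qed.

Lemma wp_nil : wp [::] = 1.
Proof. exact: prT. Qed.

Lemma wp_rcons w : \sum_x wp (rcons w x) = wp w.
Proof.
rewrite {2}/wp (pr_partition (f := fun x : Om => x ((size w)%:Z)) mu) //.
- by apply: eq_bigr => S _; rewrite /wp cyl_rcons add0r.
- exact: measurable_cyl.
- by move=> S; exact: (measurable_coord _ [set S]).
Qed.

Lemma wp_cons w : \sum_x wp (x :: w) = wp w.
Proof.
rewrite -[RHS](wp_shift 1) (pr_partition (f := fun x : Om => x 0) mu).
- by apply: eq_bigr => S _; rewrite /wp /= setIC add0r.
- exact: measurable_cyl.
- by move=> S; exact: (measurable_coord _ [set S]).
Qed.

Lemma wp_jump S S' : wp [:: S; S'] != 0 -> adj N S S'.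
Proof.
apply: contra_neqT => nadj; apply/eqP; rewrite eq_le wp_ge0 andbT.
have mC := measurable_chain_paths N.
have C0 : pr mu (~` @chain_paths L N) = 0.
  by rewrite /pr probability_setC // mu_inv.1 subee.
rewrite -C0; apply: pr_le; [exact: measurable_cyl|exact: measurableC|].
move=> x /= [x0 [x1 _]] C; have [xN xJ] := C 0.
by move: nadj; rewrite /adj -x0 xN eqxx /= -x1 xJ.
Qed.

Lemma block_entropyE n : block_entropy mu n = word_entropy wp n.
Proof.
rewrite /block_entropy /word_entropy; congr (- _).
have wE (w : {ffun 'I_n -> E}) : word_prob mu w = wp (map w (enum 'I_n)).
  rewrite /word_prob /wp /pr; congr (fine (mu _)); apply/seteqP; split=> x /=.
    move=> H; apply/cylE => j; rewrite size_map size_enum_ord => jn.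
    rewrite add0r (nth_map (Ordinal jn)) ?size_enum_ord //.
    by rewrite -[j in nth _ _ j]/(nat_of_ord (Ordinal jn)) nth_ord_enum -(H (Ordinal jn)).
  move/cylE => H j; have := H j; rewrite size_map size_enum_ord => /(_ (ltn_ord j)).
  by rewrite add0r (nth_map j) ?size_enum_ord // nth_ord_enum.
under eq_bigr do rewrite wE.
rewrite (reindex (fun st : n.-tuple E => [ffun a => tnth st a])) /=.
  apply: eq_bigr => st _; suff -> : map [ffun a => tnth st a] (enum 'I_n) = st by [].
  by rewrite -[RHS]map_tnth_enum; apply: eq_map => a; rewrite ffunE.
exists (fun w : {ffun 'I_n -> E} => [tuple w a | a < n]) => [st|w] _.
  by apply: eq_from_tnth => a; rewrite tnth_mktuple ffunE.
by apply/ffunP => a; rewrite ffunE tnth_mktuple.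
Qed.

Lemma entropyE l : word_entropy wp n / n%:R @[n --> \oo] --> l -> entropy mu = l.
Proof.
move=> cl; apply: cvg_lim => //.
rewrite (_ : (fun n => _) = (fun n => word_entropy wp n / n%:R)) //.
by apply/funext => n; rewrite block_entropyE.
Qed.

End Invariant.
End StateSequences.

(** * Existence of the Parry measure *)

(* Words of length n are coded by consecutive subintervals of [0, 1) of length
   q w; a uniform variable then has a random address with law q. *)
Section NestedIntervals.
Variables (R : realType) (F : finType) (x0 : F) (q : seq F -> R).
Hypothesis q_ge0 : forall w, 0 <= q w.
Hypothesis q_nil : q [::] = 1.
Hypothesis q_rcons : forall w, \sum_x q (rcons w x) = q w.

Definition cumul w (k : nat) : R := \sum_(x | (enum_rank x < k)%N) q (rcons w x).

Lemma cumul0 w : cumul w 0 = 0.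
Proof. by rewrite /cumul big_pred0. Qed.

Lemma cumul_card w : cumul w #|F| = q w.
Proof. by rewrite -q_rcons; apply: eq_bigl => x; rewrite ltn_ord. Qed.

Lemma cumulS w x : cumul w (enum_rank x).+1 = cumul w (enum_rank x) + q (rcons w x).
Proof.
rewrite /cumul (bigD1 x) //= addrC; congr (_ + _); apply: eq_bigl => y.
rewrite ltnS leq_eqVlt; case: (eqVneq y x) => [->|yx]; first by rewrite ltnn andbF.
by rewrite andbT (inj_eq val_inj) (inj_eq enum_rank_inj) (negPf yx).
Qed.

Lemma cumul_le w k k' : (k <= k')%N -> cumul w k <= cumul w k'.
Proof.
move=> kk'; rewrite /cumul [leRHS](bigID (fun x => (enum_rank x < k)%N)) /=.
rewrite [X in _ <= X + _](eq_bigl (fun x => (enum_rank x < k)%N)) => [|x].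
  by rewrite lerDl; apply: sumr_ge0.
by rewrite andb_idl // => xk; exact: leq_trans xk kk'.
Qed.

(* Words are reversed: the latest letter comes first. *)
Fixpoint left_end (v : seq F) : R :=
  if v is x :: v' then left_end v' + cumul (rev v') (enum_rank x) else 0.

Definition word_itv v : set R := [set u | left_end v <= u < left_end v + q (rev v)].

Lemma word_itv_sub x v : word_itv (x :: v) `<=` word_itv v.
Proof.
move=> u /=; rewrite /word_itv /= rev_cons => /andP[lu ur]; apply/andP; split.
  by apply: le_trans lu; rewrite lerDl -(cumul0 (rev v)) cumul_le.
apply: lt_le_trans ur _; rewrite -addrA lerD2l -cumulS -cumul_card.
by rewrite cumul_le.
Qed.

Lemma word_itv_ex v u : word_itv v u -> exists x, word_itv (x :: v) u.
Proof.
rewrite /word_itv /= => /andP[lu]; rewrite -cumul_card.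
suff H k : (k <= #|F|)%N -> u < left_end v + cumul (rev v) k ->
    exists x, word_itv (x :: v) u by exact: H.
elim: k => [|k IH] kF uk.
  by move: uk; rewrite cumul0 addr0 ltNge lu.
have [uk'|ku] := ltP u (left_end v + cumul (rev v) k); first by apply: IH => //; exact: ltnW.
exists (enum_val (Ordinal kF)); rewrite /word_itv /= rev_cons -addrA -cumulS enum_valK /=.
by rewrite ku uk.
Qed.

Lemma word_itv_uniq v x y u : word_itv (x :: v) u -> word_itv (y :: v) u -> x = y.
Proof.
rewrite /word_itv /= !rev_cons -!addrA -!cumulS.
move=> /andP[lx ux] /andP[ly uy]; apply/enum_rank_inj/val_inj/eqP => /=.
case: ltngtP => // lt; last by have := le_lt_trans lx uy; rewrite ltrD2l ltNge cumul_le.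
by have := le_lt_trans ly ux; rewrite ltrD2l ltNge cumul_le.
Qed.

(** For u in [0, 1) the next letter is the only one whose interval contains u. Outside, every letter
    is the default x0; this null set still has to appear in the preimages. *)
Fixpoint address (u : R) (n : nat) : seq F :=
  if n is n'.+1 then
    xget x0 [set x | word_itv (x :: address u n') u] :: address u n'
  else [::].

Lemma word_itv_nil u : word_itv [::] u <-> 0 <= u < 1.
Proof. by rewrite /word_itv /= q_nil add0r. Qed.

Lemma address_itv u n : 0 <= u < 1 -> word_itv (address u n) u.
Proof.
move=> u01; elim: n => [|n IH]; first exact/word_itv_nil.
have [x ux] := word_itv_ex IH.
by have := @xgetI _ x0 [set x | word_itv (x :: address u n) u] x ux.
Qed.

Lemma word_itv_sub01 v u : word_itv v u -> 0 <= u < 1.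
Proof. by elim: v => [/word_itv_nil//|x v IH /word_itv_sub/IH]. Qed.

Lemma address_uniq v u : word_itv v u -> address u (size v) = v.
Proof.
elim: v => //= x v IH uv; have vE := IH (word_itv_sub uv).
rewrite vE; congr (_ :: _); apply: (word_itv_uniq _ uv).
by have := @xgetI _ x0 [set y | word_itv (y :: v) u] x uv.
Qed.

Lemma address_out u n : ~ (0 <= u < 1) -> address u n = nseq n x0.
Proof.
move=> u01; elim: n => //= n ->; congr (_ :: _); rewrite xgetPN // => x.
by move/word_itv_sub01.
Qed.

Lemma address_preimage v : [set u | address u (size v) = v] =
  word_itv v `|` (if v == nseq (size v) x0 then ~` [set u | 0 <= u < 1] else set0).
Proof.
apply/seteqP; split=> u /= => [uv|[/address_uniq//|]].
  have [u01|u01] := pselect (0 <= u < 1); first by left; rewrite -[in X in X u]uv; exact: address_itv.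
  by right; rewrite -{1}uv address_out // eqxx.
by case: eqP => // vE u01; rewrite address_out.
Qed.

Lemma word_itvE v : word_itv v = `[left_end v, left_end v + q (rev v)[%classic.
Proof. by apply/seteqP; split=> u; rewrite /word_itv /= in_itv. Qed.

Lemma itv01E : [set u : R | 0 <= u < 1] = `[0, 1[%classic.
Proof. by apply/seteqP; split=> u; rewrite /= in_itv. Qed.

Lemma measurable_address v : measurable [set u | address u (size v) = v].
Proof.
rewrite address_preimage word_itvE; apply: measurableU; first exact: measurable_itv.
by case: ifP => _ //; rewrite itv01E; apply: measurableC; exact: measurable_itv.
Qed.

Local Notation P := (uniform_prob (@ltr01 R)).

Lemma uniform_prob_itv (a b : R) : 0 <= a -> a <= b -> b <= 1 ->
  P `[a, b[%classic = (b - a)%:E.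
Proof.
move=> a0 ab b1; rewrite /uniform_prob (eq_integral (fun=> 1%:E)); last first.
  move=> x; rewrite inE /= in_itv /= => /andP[ax xb].
  by rewrite /uniform_pdf (le_trans a0 ax) (ltW (lt_le_trans xb b1)) subr0 invr1.
rewrite integral_cst //= mul1e lebesgue_measure_itv /= lte_fin.
by move: ab; rewrite le_eqVlt => /orP[/eqP ->|->]; rewrite ?ltxx ?subrr.
Qed.

Lemma address_prob v : P [set u | address u (size v) = v] = (q (rev v))%:E.
Proof.
have lv0 : 0 <= left_end v /\ left_end v + q (rev v) <= 1.
  elim: v => [|x v [l0 l1]] /=; first by rewrite q_nil lexx add0r.
  split; first by rewrite addr_ge0 // -(cumul0 (rev v)) cumul_le.
  apply: le_trans l1; rewrite rev_cons -addrA lerD2l -cumulS -cumul_card.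
  by rewrite cumul_le.
have out0 : P (~` [set u : R | 0 <= u < 1]) = 0.
  transitivity (1 - P `[0%R, 1%R[%classic)%E.
    by rewrite itv01E; apply: probability_setC; exact: measurable_itv.
  by rewrite uniform_prob_itv // subr0 subee.
have itvE : P (word_itv v) = (q (rev v))%:E.
  rewrite word_itvE uniform_prob_itv ?lv0.1 ?lv0.2 //; first by rewrite addrAC subrr add0r.
  by rewrite lerDl.
rewrite address_preimage; set B := if _ then _ else _.
have PB : P B = 0 by rewrite /B; case: ifP => _ //; exact: measure0.
transitivity (P (word_itv v) + P B)%E; last by rewrite itvE PB adde0.
apply: measureU.
- by rewrite word_itvE; exact: measurable_itv.
- rewrite /B; case: ifP => _ //; rewrite itv01E; apply: measurableC; exact: measurable_itv.
- by apply/seteqP; split=> // u [/word_itv_sub01 u01]; rewrite /B; case: ifP => //= _ /(_ u01).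
Qed.

End NestedIntervals.

Section ParryWeights.
Variables (R : realType) (E : finType) (a : rel E) (r : E -> R) (lam : R).
Hypothesis r_ge0 : forall x, 0 <= r x.
Hypothesis r_neq0 : exists x, r x != 0.
Hypothesis lam_gt0 : 0 < lam.
Hypothesis r_right : forall x, \sum_y (a x y)%:R * r y = lam * r x.
Hypothesis r_left : forall y, \sum_x r x * (a x y)%:R = lam * r y.

Local Notation step := (parry_step a r lam).

Fixpoint steps x (w : seq E) : R :=
  if w is y :: w' then step x y * steps y w' else 1.

Definition parry_weight (w : seq E) : R :=
  if w is x :: w' then r x ^+ 2 / (\sum_y r y ^+ 2) * steps x w' else 1.

Lemma sum_sqr_gt0 : 0 < \sum_y r y ^+ 2.
Proof.
have [x rx] := r_neq0; rewrite (bigD1 x) //= ltr_pwDl //.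
  by rewrite exprn_gt0 // lt_neqAle eq_sym rx r_ge0.
by apply: sumr_ge0 => y _; rewrite exprn_ge0.
Qed.

Lemma steps_rcons x w y : steps x (rcons w y) = steps x w * step (last x w) y.
Proof. by elim: w x => [|z w IH] x /=; rewrite ?mulr1 ?mul1r // IH mulrA. Qed.

Lemma parry_weight_markov w x y :
  parry_weight (rcons (rcons w x) y) = parry_weight (rcons w x) * step x y.
Proof.
case: w => [|z w] /=; first by rewrite !mulr1.
by rewrite !steps_rcons last_rcons !mulrA.
Qed.

Lemma parry_weight_ge0 w : 0 <= parry_weight w.
Proof.
case: w => [|x w] //=; apply: mulr_ge0.
  by rewrite divr_ge0 ?exprn_ge0 // ltW // sum_sqr_gt0.
elim: w x => //= y w IH x; apply: mulr_ge0 => //.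
exact: parry_step_ge0.
Qed.

Lemma step_r0 x y : r x = 0 -> step x y = 0.
Proof. by move=> r0; rewrite /parry_step r0 mulr0 invr0 mulr0. Qed.

Lemma step_0r x y : r y = 0 -> step x y = 0.
Proof. by move=> r0; rewrite /parry_step r0 mulr0 mul0r. Qed.

Lemma parry_weight_r0 w x : r x = 0 -> parry_weight (rcons w x) = 0.
Proof.
move=> r0; case: w => [|y w] /=; first by rewrite r0 expr0n mul0r mulr1.
by rewrite steps_rcons step_0r // !mulr0.
Qed.

Lemma parry_weight_rcons w : \sum_x parry_weight (rcons w x) = parry_weight w.
Proof.
case/lastP: w => [|w z] /=.
  under eq_bigr do rewrite mulr1.
  by rewrite -mulr_suml mulfV // gt_eqF // sum_sqr_gt0.
under eq_bigr do rewrite parry_weight_markov.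
rewrite -mulr_sumr; have [r0|rn0] := eqVneq (r z) 0.
  by rewrite parry_weight_r0 // mul0r.
by rewrite sum_parry_step ?mulr1 // lt_neqAle eq_sym rn0 r_ge0.
Qed.

(** Stationarity of r^2: one factor r x cancels against the denominator of the step, and the left
    eigenvector equation remains. *)
Lemma parry_weight_cons w : \sum_x parry_weight (x :: w) = parry_weight w.
Proof.
case: w => [|z w]; first exact: (parry_weight_rcons [::]).
rewrite /=; under eq_bigr do rewrite mulrA.
rewrite -mulr_suml; congr (_ * _).
have sE x : r x ^+ 2 / (\sum_y r y ^+ 2) * step x z =
    r x * (a x z)%:R * (r z / (lam * \sum_y r y ^+ 2)).
  have Z0 := lt0r_neq0 sum_sqr_gt0; have l0 := lt0r_neq0 lam_gt0.
  have [r0|rn0] := eqVneq (r x) 0; first by rewrite step_r0 // r0 !mul0r mulr0.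
  by rewrite /parry_step; field; rewrite Z0 l0 rn0.
rewrite (eq_bigr _ (fun x _ => sE x)).
rewrite -mulr_suml r_left; have Z0 := lt0r_neq0 sum_sqr_gt0; have l0 := lt0r_neq0 lam_gt0.
by field; rewrite Z0 l0.
Qed.

Lemma parry_weight_jump x y : parry_weight [:: x; y] != 0 -> a x y.
Proof.
by apply: contra_neqT => /negPf axy; rewrite /= /parry_step axy !mul0r mulr0.
Qed.

End ParryWeights.

Section Existence.
Variables (R : realType) (L : nat).
Local Notation E := {set 'Z_L}.
Local Notation Om := (state_seq L).
Variable q : seq E -> R.
Hypothesis q_ge0 : forall w, 0 <= q w.
Hypothesis q_nil : q [::] = 1.
Hypothesis q_rcons : forall w, \sum_x q (rcons w x) = q w.
Hypothesis q_cons : forall w, \sum_x q (x :: w) = q w.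

(* The letter x_n codes the coordinates n and -n-1. *)
Definition unzip_word (w : seq (E * E)) : seq E := rev (map snd w) ++ map fst w.

Definition pair_weight (w : seq (E * E)) : R := q (unzip_word w).

(** Appending a pair extends the word by one letter at each end, which makes the one-sided coding
    two-sided. *)
Lemma pair_weight_rcons w : \sum_x pair_weight (rcons w x) = pair_weight w.
Proof.
have -> : \sum_x pair_weight (rcons w x) =
    \sum_(x : E) \sum_(y : E) q (y :: rcons (unzip_word w) x).
  rewrite pair_bigA /=; apply: eq_bigr => -[x y] _; rewrite /pair_weight /unzip_word.
  by rewrite !map_rcons rev_rcons cat_cons -rcons_cat.
under eq_bigr do rewrite q_cons.
exact: q_rcons.
Qed.

Definition dflt : E * E := (finset.set0, finset.set0).

Definition two_sided (u : R) : Om := fun j : int =>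
  match j with
  | Posz n => (head dflt (address dflt pair_weight u n.+1)).1
  | Negz n => (head dflt (address dflt pair_weight u n.+1)).2
  end.

Lemma addressS u n : address dflt pair_weight u n.+1 =
  head dflt (address dflt pair_weight u n.+1) :: address dflt pair_weight u n.
Proof. by []. Qed.

Lemma two_sided_address u (w : seq (E * E)) :
  address dflt pair_weight u (size w) = rev w <->
  cyl (- (size w)%:Z) (unzip_word w) (two_sided u).
Proof.
elim/last_ind: w => [|w [x y] IH] //.
rewrite size_rcons rev_rcons addressS /unzip_word !map_rcons rev_rcons.
rewrite cat_cons -rcons_cat -rcons_cons cyl_rcons /=.
have -> : - (size w).+1%:Z + 1 = - (size w)%:Z by rewrite -addn1 PoszD opprD addrNK.
have -> : - (size w).+1%:Z + (size (rev (map snd w) ++ map fst w)).+1%:Z = (size w)%:Z.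
  rewrite size_cat size_rev !size_map; lia.
split.
  move=> [E1 /IH E2]; split => //; last by rewrite /two_sided /= E1.
  by split=> //; rewrite /two_sided /= E1.
case=> -[E1 /IH Ew] E2; congr (_ :: _) => //.
by rewrite [LHS]surjective_pairing; congr pair; [exact: E2 | exact: E1].
Qed.

Lemma unzip_wordP n (w : seq E) : size w = n.*2 ->
  exists2 v, size v = n & unzip_word v = w.
Proof.
elim: n w => [|n IH] w; first by move/size0nil => ->; exists [::].
case: w => // y w; case/lastP: w => [|w x] //=.
rewrite size_rcons => -[/IH[v vn vw]]; exists (rcons v (x, y)).
  by rewrite size_rcons vn.
by rewrite /unzip_word !map_rcons rev_rcons -vw cat_cons -rcons_cat.
Qed.

(** A coordinate event is a finite union of cylinders over the window [-n, n), in which coordinate j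
    is letter j + n. So the centred cylinders generate the sigma-algebra. *)
Lemma coord_centred (j : int) (B : set E) n : (`|j| < n)%N ->
  [set x : Om | B (x j)] =
  \big[setU/set0]_(w : n.*2.-tuple E | `[< B (nth finset.set0 w `|(j + n%:Z)%R|%N) >])
    cyl (- n%:Z) w.
Proof.
move=> jn; rewrite -bigcup_seq_cond; apply/seteqP; split=> x.
  move=> Bx; exists [tuple x (- n%:Z + a%:Z) | a < n.*2] => /=.
    rewrite mem_index_enum /=; apply/asboolP.
    have an : (`|(j + n%:Z)%R| < n.*2)%N by lia.
    have := tnth_mktuple (fun a : 'I_n.*2 => x (- n%:Z + a%:Z)) (Ordinal an).
    rewrite (tnth_nth finset.set0) => /= ->.
    by have -> : - n%:Z + `|(j + n%:Z)%R|%N%:Z = j by lia.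
  apply/cylE => a; rewrite size_tuple card_ord => an.
  have := tnth_mktuple (fun a : 'I_n.*2 => x (- n%:Z + a%:Z)) (Ordinal an).
  by rewrite (tnth_nth finset.set0) => ->.
move=> [w /andP[_ /asboolP Bw] /cylE] /(_ `|(j + n%:Z)%R|%N).
rewrite size_tuple => H; move: Bw; rewrite -H; last by lia.
by have -> : - n%:Z + `|(j + n%:Z)%R|%N%:Z = j by lia.
Qed.

(** The windows are nested, so two such cylinders are disjoint or one contains the other; adding the
    empty set gives a pi-system. *)
Definition centred : set (set Om) :=
  [set C | C = set0 \/ exists n (w : seq E), size w = n.*2 /\ C = cyl (- n%:Z) w].

Lemma measurable_centred : @measurable _ Om = <<s centred >>.
Proof.
apply/seteqP; split.
  apply: smallest_sub; first exact: smallest_sigma_algebra.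
  move=> _ [j [B _ ->]]; rewrite (@coord_centred j B (`|j|%N).+1) //.
  have mU (I : Type) (s : seq I) (Q : pred I) (A : I -> set Om) :
      (forall k, <<s centred >> (A k)) -> <<s centred >> (\big[setU/set0]_(k <- s | Q k) A k).
    move=> mA; apply: (@bigsetU_measurable _ (g_sigma_algebraType centred)) => k _.
    exact: mA.
  apply: mU => w; apply: sub_sigma_algebra; right.
  by exists (`|j|%N).+1, w; rewrite size_tuple.
apply: smallest_sub; first exact: sigma_algebra_measurable.
move=> _ [->|[n [w [_ ->]]]]; first exact: measurable0.
exact: measurable_cyl.
Qed.

Lemma centred_setI : setI_closed centred.
Proof.
have sub n m (w w' : seq E) : (n <= m)%N -> size w = n.*2 -> size w' = m.*2 ->
    cyl (- n%:Z) w `&` cyl (- m%:Z) w' = set0 \/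
    cyl (- n%:Z) w `&` cyl (- m%:Z) w' = cyl (- m%:Z) w'.
  move=> nm sw sw'; have [[x [xw xw']]|ex] :=
    pselect (exists x, cyl (- n%:Z) w x /\ cyl (- m%:Z) w' x).
    right; apply: setIidr => y /cylE yw'; apply/cylE => a aw.
    move/cylE : xw => <- //; move/cylE: xw' => xw'.
    have aE : - n%:Z + a%:Z = - m%:Z + (m - n + a)%N%:Z by lia.
    by rewrite aE yw' ?xw' //; lia.
  by left; apply/seteqP; split=> // x [xw xw']; apply: ex; exists x.
move=> A B [->|[n [w [sw ->]]]]; first by rewrite set0I; left.
move=> [->|[m [w' [sw' ->]]]]; first by rewrite setI0; left.
have [nm|/ltnW mn] := leqP n m.
  by have [->|->] := sub n m w w' nm sw sw'; [left|right; exists m, w'].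
rewrite setIC.
by have [->|->] := sub m n w' w mn sw' sw; [left|right; exists n, w].
Qed.

Lemma centred_measure_unique (m1 m2 : probability Om R) :
  (forall n w, size w = n.*2 -> m1 (cyl (- n%:Z) w) = m2 (cyl (- n%:Z) w)) ->
  forall A, measurable A -> m1 A = m2 A.
Proof.
move=> m12; apply: (measure_unique centred (fun=> setT)).
- exact: measurable_centred.
- exact: centred_setI.
- by move=> _; right; exists 0%N, [::].
- by apply/seteqP; split=> // x _; exists 0%N.
- by move=> _ [->|[n [w [sw ->]]]]; [rewrite !measure0 | exact: m12].
- by move=> _; apply: (le_lt_trans (probability_le1 m1 measurableT)); exact: ltry.
Qed.

End Existence.

Section CylinderMeasure.
Variables (R : realType) (L : nat).
Local Notation E := {set 'Z_L}.
Local Notation Om := (state_seq L).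
Variable q : seq E -> R.
Hypothesis q_ge0 : forall w, 0 <= q w.
Hypothesis q_nil : q [::] = 1.
Hypothesis q_rcons : forall w, \sum_x q (rcons w x) = q w.
Hypothesis q_cons : forall w, \sum_x q (x :: w) = q w.

Lemma pair_weight_ge0 w : 0 <= pair_weight q w. Proof. exact: q_ge0. Qed.
Lemma pair_weight_nil : pair_weight q [::] = 1. Proof. exact: q_nil. Qed.

Lemma two_sided_preimage (v : seq (E * E)) :
  two_sided q @^-1` cyl (- (size v)%:Z) (unzip_word v) =
  [set u | address (dflt L) (pair_weight q) u (size (rev v)) = rev v].
Proof.
apply/seteqP; split=> u /=; rewrite size_rev.
  by move/two_sided_address.
by move/two_sided_address.
Qed.

Lemma measurable_two_sided :
  @measurable_fun _ _ (measurableTypeR R) Om setT (two_sided q).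
Proof.
apply: (measurability (@centred L)); first exact: measurable_centred.
move=> _ [C CG <-]; rewrite setTI; case: CG => [->|[n [w [sw ->]]]].
  by rewrite preimage_set0; exact: measurable0.
have [v vn <-] := unzip_wordP sw; rewrite -vn two_sided_preimage.
apply: measurable_address; [exact: pair_weight_ge0|exact: pair_weight_nil|].
exact: pair_weight_rcons.
Qed.

Definition two_sided_mfun :=
  @mfun_Sub _ _ (measurableTypeR R) Om (two_sided q) (mem_set measurable_two_sided).

Definition cyl_measure : probability Om R :=
  distribution (uniform_prob (@ltr01 R)) two_sided_mfun.

Lemma cyl_measure_centred n w : size w = n.*2 ->
  cyl_measure (cyl (- n%:Z) w) = (q w)%:E.
Proof.
move=> sw; have [v vn vw] := unzip_wordP sw.
rewrite -vn -vw -[LHS]/(uniform_prob (@ltr01 R) (two_sided q @^-1` _)).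
rewrite two_sided_preimage address_prob ?revK //.
- exact: pair_weight_ge0.
- exact: pair_weight_rcons.
Qed.

Lemma cyl_measureE (j : int) w : pr cyl_measure (cyl j w) = q w.
Proof.
(* Here a and b count the letters missing on the left and on the right to fill the window [-n, n);
   they are added one by one by summing over all values. *)
have ext a b : forall j w n, j = - n%:Z + a%:Z -> (a + size w + b = n.*2)%N ->
    pr cyl_measure (cyl j w) = q w.
  elim: a b => [|a IHa] b; last first.
    move=> j' w' n jE sE.
    rewrite -q_cons (pr_partition (f := fun x : Om => x (j' - 1)) cyl_measure).
    - apply: eq_bigr => S _; rewrite -(IHa b (j' - 1) (S :: w') n) /=; last 2 first.
      + by rewrite jE; lia.
      + by rewrite -sE; lia.
      by rewrite subrK setIC.
    - exact: measurable_cyl.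
    - by move=> S; exact: (measurable_coord _ [set S]).
  elim: b => [|b IHb] j' w' n jE sE.
    rewrite /pr jE addr0 cyl_measure_centred //.
    by rewrite -sE; lia.
  rewrite -q_rcons (pr_partition (f := fun x : Om => x (j' + (size w')%:Z)) cyl_measure).
  - apply: eq_bigr => S _; rewrite -(IHb j' (rcons w' S) n) //.
      by rewrite cyl_rcons.
    by rewrite size_rcons; lia.
  - exact: measurable_cyl.
  - by move=> S; exact: (measurable_coord _ [set S]).
(* Large enough for [-n, n) to contain all coordinates from j to j + size w - 1. *)
pose n := (`|j|%N + size w)%N.
apply: (ext `|(j + n%:Z)%R|%N (n.*2 - size w - `|(j + n%:Z)%R|)%N _ _ n); rewrite /n; lia.
Qed.

Lemma measurable_seq_shift : measurable_fun setT (@seq_shift L : Om -> Om).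
Proof.
apply: (measurability (@centred L)); first exact: measurable_centred.
move=> _ [C CG <-]; rewrite setTI; case: CG => [->|[n [w [sw ->]]]].
  by rewrite preimage_set0; exact: measurable0.
by rewrite cyl_shift; exact: measurable_cyl.
Qed.

Lemma cyl_measure_shift (A : set Om) : measurable A ->
  cyl_measure (@seq_shift L @^-1` A) = cyl_measure A.
Proof.
pose sh : {mfun Om >-> Om} := mfun_Sub (mem_set measurable_seq_shift).
move=> mA.
have := @centred_measure_unique R L (distribution cyl_measure sh) cyl_measure _ A mA.
apply=> n w sw.
transitivity (cyl_measure (@seq_shift L @^-1` cyl (- n%:Z) w)) => //.
rewrite cyl_shift !prE; try exact: measurable_cyl.
by rewrite !cyl_measureE.
Qed.

(** The complement is a countable union of two-letter cylinders of weight 0. *)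
Lemma cyl_measure_paths N : (forall S S', q [:: S; S'] != 0 -> adj N S S') ->
  cyl_measure (@chain_paths L N) = 1%E.
Proof.
move=> q_adj.
pose A (j : int) : set Om := [set x | ~~ adj N (x j) (x (j + 1))].
have Acyl j : A j = \big[setU/set0]_(S : E) \big[setU/set0]_(S' : E | ~~ adj N S S')
    cyl j [:: S; S'].
  rewrite -bigcup_seq; apply/seteqP; split=> x.
    move=> nadj; exists (x j) => /=; first by rewrite mem_index_enum.
    rewrite -bigcup_seq_cond; exists (x (j + 1)) => //=.
    by rewrite mem_index_enum.
  move=> [S _]; rewrite -bigcup_seq_cond => -[S' /andP[_ nadj] [/= xS [xS' _]]].
  by rewrite /A /= xS xS'.
have neg j : cyl_measure.-negligible (A j).
  rewrite Acyl; elim/big_ind: _ => [||S _].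
  - exact: negligible_set0.
  - by move=> B C nB nC; exact: negligibleU.
  elim/big_ind: _ => [||S' nadj].
  - exact: negligible_set0.
  - by move=> B C nB nC; exact: negligibleU.
  apply/negligibleP; first exact: measurable_cyl.
  transitivity ((pr cyl_measure (cyl j [:: S; S']))%:E).
    by apply: prE; exact: measurable_cyl.
  rewrite cyl_measureE; congr EFin; apply/eqP; apply: contraTT nadj => q0.
  by rewrite negbK q_adj.
have mC := @measurable_chain_paths L N.
have : cyl_measure (~` @chain_paths L N) = 0%E.
  apply/negligibleP; first exact: measurableC.
  apply: (@negligibleS _ _ _ _ (\bigcup_(n : nat) (A n%:Z `|` A (Negz n)))).
    move=> x nC; apply: contrapT => nA; apply: nC => j.
    have : ~ A j x.
      move=> Aj; apply: nA; case: j Aj => n Aj; exists n => //; [by left|by right].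
    by rewrite /A /= => /negP; rewrite negbK => /andP[/eqP].
  by apply: negligible_bigcup => n; apply: negligibleU.
rewrite probability_setC // => C0.
have : cyl_measure (@chain_paths L N) \is a fin_num by exact: fin_num_measure.
move: C0; case: (cyl_measure _) => // c; rewrite -EFinD => -[c0] _.
by congr EFin; lra.
Qed.

End CylinderMeasure.

(** * The law of the measure of maximal entropy *)

Section MaximalEntropy.
Variables (R : realType) (L N : nat).
Hypotheses (L_gt1 : (1 < L)%N) (N_gt0 : (0 < N)%N) (N_ltL : (N < L)%N).
Local Notation E := {set 'Z_L}.
Local Notation Om := (state_seq L).
Local Notation a := (@adj L N).
Local Notation r := (@groundR R L N).
Local Notation lam := (@lambda R L N).
Implicit Types S : E.

Lemma adj_support S S' : a S S' -> 0 < r S /\ 0 < r S'.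
Proof.
move=> /andP[/eqP SN /jump_card S'N].
by split; apply: groundR_gt0; rewrite // S'N SN.
Qed.

Lemma groundR_card S : 0 < r S -> #|S| = N.
Proof. by move=> r0; apply/eqP; apply: contraTT r0 => /groundR_eq0 ->; rewrite ltxx. Qed.

Definition first_stones : E := [set k : 'Z_L | (k < N)%N]%SET.

Lemma card_first_stones : #|first_stones| = N.
Proof.
have -> : first_stones = @occupied L N @: 'I_N.
  apply/finset.setP => k; rewrite inE; apply/idP/imsetP => [kN|[j _ ->]].
    exists (Ordinal kN) => //; apply/val_inj => /=.
    by rewrite [RHS](occupiedE L_gt1 N_ltL).
  by rewrite (occupiedE L_gt1 N_ltL).
by rewrite card_imset ?card_ord //; exact: occupied_inj.
Qed.

(** Closure under k - 1 away from 0 makes S an initial segment, and its cardinality determines which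
    one. *)
Lemma pred_closed_first_stones (S : E) : #|S| = N ->
  (forall k, k \in S -> k != 0 -> k - 1 \in S) -> S = first_stones.
Proof.
move=> SN closed.
have down (k : nat) : (k < L)%N -> (inord k : 'Z_L) \in S ->
    forall j, (j <= k)%N -> (inord j : 'Z_L) \in S.
  elim: k => [|k IH] kL kS j jk.
    by move: jk; rewrite leqn0 => /eqP ->.
  move: jk; rewrite leq_eqVlt => /orP[/eqP -> //|jk].
  apply: IH => //; first exact: ltnW.
  have kE : nat_of_ord (inord k.+1 : 'Z_L) = k.+1 by rewrite inordK // Zp_cast.
  have -> : (inord k : 'Z_L) = inord k.+1 - 1.
    apply/eqP; rewrite eq_sym subr_eq; apply/eqP/val_inj.
    rewrite [RHS]val_ZpD // [LHS]kE val_Zp1 inordK ?Zp_cast //; last exact: ltnW.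
    by rewrite addn1 modn_small.
  apply: closed => //; apply/eqP => /(congr1 (@nat_of_ord _)).
  by rewrite kE.
apply/eqP; rewrite eqEcard card_first_stones SN leqnn andbT.
apply/fintype.subsetP => k kS; rewrite inE ltnNge; apply/negP => Nk.
have kL := ltn_Zp L_gt1 k.
have sub : [set x : 'Z_L | (x <= k)%N]%SET \subset S.
  apply/fintype.subsetP => x; rewrite inE => xk.
  by have := down k kL _ x xk; rewrite !inord_val; apply.
have := subset_leq_card sub; rewrite SN leqNgt => /negP; apply.
apply: leq_ltn_trans Nk _.
pose f (j : 'I_k.+1) : 'Z_L := inord j.
have fE j : nat_of_ord (f j) = j.
  rewrite inordK //; apply: leq_ltn_trans (ltn_ord k); rewrite -ltnS; exact: ltn_ord.
have f_inj : injective f.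
  by move=> i j /(congr1 (@nat_of_ord _)); rewrite !fE => ij; apply/val_inj.
rewrite -[X in (X <= _)%N](card_ord k.+1) -(card_imset predT f_inj).
apply: subset_leq_card; apply/fintype.subsetP => _ /imsetP[j _ ->].
by rewrite inE fE -ltnS.
Qed.

(** Jumps are undone: unless the stones fill the first N holes, some stone can be pulled back by one
    without crossing 0, which lowers the sum of the positions. The induction is on a bound for this
    sum. *)
Lemma reach_first_stones (Q : E -> Prop) :
  (forall S S', Q S' -> a S S' -> Q S) -> forall S, 0 < r S -> Q S -> Q first_stones.
Proof.
move=> Qstep S /groundR_card; move: {-1}(\sum_(k in S) k)%N (leqnn (\sum_(k in S) k)%N).
move=> n; elim: n S => [|n IH] S Sn SN QS.
  suff <- : S = first_stones by [].
  apply: pred_closed_first_stones => // k kS k0; exfalso.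
  move: Sn; rewrite (bigD1 k) //= leqn0 addn_eq0 => /andP[/eqP k00 _].
  by case/eqP: k0; apply/val_inj.
have [/existsP[k /and3P[kS k0 k1]]|none] :=
    boolP [exists k, [&& k \in S, k != 0 & k - 1 \notin S]]; last first.
  suff <- : S = first_stones by [].
  apply: pred_closed_first_stones => // k kS k0; apply: contraNT none => k1.
  by apply/existsP; exists k; rewrite kS k0 k1.
pose S' : E := ((k - 1) |: (S :\ k))%SET.
have kk : k - 1 != k by rewrite -subr_eq0 addrAC subrr add0r oppr_eq0 oner_eq0.
have jS : jump S' S.
  apply/existsP; exists (k - 1); rewrite subrK !inE !eqxx /= eq_sym (negPf kk) /=.
  apply/eqP/finset.setP => x; rewrite !inE.
  case: (eqVneq x k) => [->|xk] //=.
  by case: (eqVneq x (k - 1)) => [->|] //=; rewrite (negPf k1).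
have S'N : #|S'| = N by rewrite -SN (jump_card jS).
apply: (IH S') => //; last by apply: Qstep QS _; rewrite /adj S'N eqxx.
have kE : nat_of_ord k = (k - 1)%R.+1.
  have k1L : ((k - 1)%R.+1 < L)%N || ((k - 1)%R.+1 == L)%N.
    by rewrite orbC -leq_eqVlt; exact: ltn_Zp.
  have := val_ZpD L_gt1 (k - 1) 1; rewrite subrK val_Zp1 addn1.
  case/orP: k1L => [kl|/eqP ->]; first by rewrite modn_small.
  by rewrite modnn => k00; case/eqP: k0; apply/val_inj.
move: Sn; rewrite (big_setD1 k) //= kE addSn ltnS; apply: leq_trans.
rewrite /S' big_setU1 //=.
by rewrite !inE negb_and k1 orbT.
Qed.

(** The Andreief identity for orthogonal waves: the Gram matrix is L times the identity of size
    N. *)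
Lemma sum_sqr_groundR : \sum_S r S ^+ 2 = L%:R ^+ N.
Proof.
apply: complexI; rewrite rmorph_sum /= rmorphXn /= rmorph_nat.
transitivity (\sum_S ((r S)%:C)%C * desc (ground R (L:=L) (N:=N)) S).
  by apply: eq_bigr => S _; rewrite -groundR_complex // rmorphXn.
rewrite (sum_groundR_desc L_gt1 N_gt0 N_ltL).
have -> : (\matrix_(i < N, j < N) (\sum_(x : 'Z_L) (ground R x i)^*%C * ground R x j)) =
    L%:R *: (groundM' R L N *m groundM R L N).
  apply/matrixP => i j; rewrite !mxE mulr_sumr; apply: eq_bigr => x _.
  by rewrite !mxE !mulrA mulfV ?mul1r ?LC_neq0.
by rewrite groundM'K // detZ det1 mulr1.
Qed.

Lemma groundR_ex_neq0 : exists S, r S != 0.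
Proof.
exists first_stones; rewrite gt_eqF //; apply: groundR_gt0 => //.
exact: card_first_stones.
Qed.

Local Notation pw := (parry_weight a r lam).

Lemma parry_measure_spec : exists nu : probability Om R,
  chain_invariant N nu /\ entropy nu = ln lam.
Proof.
have rge0 := @groundR_ge0 R L N; have rr := groundR_right R L_gt1 N_gt0 N_ltL.
have rl := groundR_left R L_gt1 N_gt0 N_ltL.
have lam0 := lambda_gt0 R L_gt1 N_gt0 N_ltL.
have ex := groundR_ex_neq0.
have q0 := parry_weight_ge0 a (rge0 L_gt1 N_gt0 N_ltL) ex lam0.
have qn : pw [::] = 1 by [].
have qr := parry_weight_rcons (rge0 L_gt1 N_gt0 N_ltL) ex lam0 rr.
have qc := parry_weight_cons (rge0 L_gt1 N_gt0 N_ltL) ex lam0 rr rl.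
pose nu := cyl_measure q0 qn qr qc.
exists nu.
have inv : chain_invariant N nu.
  split; first by apply: cyl_measure_paths => S S'; exact: parry_weight_jump.
  exact: cyl_measure_shift.
split=> //; apply: entropyE.
have wpE w : wp nu w = pw w by rewrite /wp cyl_measureE.
have H := markov_entropy (wp_ge0 nu) (wp_nil nu) (wp_rcons nu) (wp_cons inv)
  (rge0 L_gt1 N_gt0 N_ltL) lam0 rr adj_support (wp_jump inv).
apply: H => w x y; rewrite /step_weight !wpE; exact: parry_weight_markov.
Qed.

(** Maximality only compares mu with other invariant laws, so an invariant law of entropy ln lam
    must be exhibited before equality in the Gibbs bound can be used. *)
Theorem max_entropy_law (mu : probability Om R) : max_entropy_measure N mu ->
  entropy mu = ln lam /\ forall w, wp mu w = pw w.
Proof.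
move=> [inv maxmu].
have [nu [nu_inv nu_ent]] := parry_measure_spec.
have lam_le : ln lam <= entropy mu by rewrite -nu_ent maxmu.
have rge0 := groundR_ge0 R L_gt1 N_gt0 N_ltL; have rr := groundR_right R L_gt1 N_gt0 N_ltL.
have rl := groundR_left R L_gt1 N_gt0 N_ltL.
have lam0 := lambda_gt0 R L_gt1 N_gt0 N_ltL.
have mk : forall w x y, wp mu (rcons (rcons w x) y) = step_weight (wp mu) a r lam w x y.
  apply: (entropy_max_markov (wp_ge0 mu) (wp_nil mu) (wp_rcons mu) (wp_cons inv)
    rge0 lam0 rr adj_support (wp_jump inv)) => l cl.
  by rewrite -(entropyE cl).
split.
  apply: entropyE.
  exact: (markov_entropy (wp_ge0 mu) (wp_nil mu) (wp_rcons mu) (wp_cons inv)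
    rge0 lam0 rr adj_support (wp_jump inv) mk).
have law := stationary_law (wp_ge0 mu) (wp_nil mu) (wp_rcons mu) (wp_cons inv)
    rge0 lam0 rl adj_support (wp_jump inv) mk reach_first_stones.
elim/last_ind => [|w y IH]; first by rewrite wp_nil.
case/lastP: w IH => [|w x] IH; first by rewrite law /= mulr1.
by rewrite mk /step_weight IH parry_weight_markov.
Qed.

End MaximalEntropy.

(** * Poisson jump times *)

Section Enumerations.
Variable R : realType.
Implicit Types (sg : int -> R) (t : R) (j : int).

Definition idx sg t j : bool := sg j <= t < sg (j + 1).

Definition increasing sg := forall j, sg j < sg (j + 1).

Lemma increasing_lt sg j j' : increasing sg -> j < j' -> sg j < sg j'.
Proof.
move=> inc jj'; have -> : j' = j + (`|(j' - j - 1)%R|%N).+1%:Z by lia.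
elim: `|_|%N => [|n IH]; first exact: inc.
apply: lt_trans IH _; have := inc (j + n.+1%:Z).
by rewrite -addrA -PoszD addn1.
Qed.

Lemma increasing_le sg j j' : increasing sg -> j <= j' -> sg j <= sg j'.
Proof.
by move=> inc; rewrite le_eqVlt => /orP[/eqP ->//|/(increasing_lt inc)/ltW].
Qed.

Lemma idx_uniq sg t j j' : increasing sg -> idx sg t j -> idx sg t j' -> j = j'.
Proof.
move=> inc /andP[a b] /andP[c d].
case: (ltgtP j j') => // jj'.
  have : sg (j + 1) <= sg j' by apply: increasing_le => //; lia.
  by rewrite leNgt (le_lt_trans c b).
have : sg (j' + 1) <= sg j by apply: increasing_le => //; lia.
by rewrite leNgt (le_lt_trans a d).
Qed.

Lemma card_segment j c : ([set j' : int | (j < j' <= j + c%:Z)%R] #= `I_c)%card.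
Proof.
have -> : [set j' : int | (j < j' <= j + c%:Z)%R] = (fun n : nat => j + 1 + n%:Z) @` `I_c.
  apply/seteqP; split=> x /=.
    by move=> jx; exists `|(x - j - 1)%R|%N; lia.
  by move=> [n nc <-]; lia.
by apply: inj_card_eq => x y _ _; lia.
Qed.

Lemma points_segment sg t t' j j' : increasing sg ->
  idx sg t j -> idx sg t' j' ->
  [set k | t < sg k <= t'] = [set k : int | j < k <= j'].
Proof.
move=> inc /andP[a b] /andP[c d]; apply/seteqP; split=> k /= /andP[e f].
  apply/andP; split; rewrite ltNge || rewrite leNgt; apply/negP => h.
    by have := increasing_le inc h; lra.
  have : sg (j' + 1) <= sg k by apply: increasing_le => //; lia.
  lra.
apply/andP; split.
  have : sg (j + 1) <= sg k by apply: increasing_le => //; lia.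
  lra.
by have := increasing_le inc f; lra.
Qed.

Lemma card_le_segment (A : set int) j c c' : (A #= `I_c)%card ->
  A `<=` [set k : int | j < k <= j + c'%:Z] -> (c <= c')%N.
Proof.
move=> Ac /subset_card_le H; rewrite -card_le_II.
by rewrite -(card_le_eql Ac) -(card_le_eqr (card_segment j c')).
Qed.

Lemma card_ge_segment (A : set int) j c c' : (A #= `I_c)%card ->
  [set k : int | j < k <= j + c'%:Z] `<=` A -> (c' <= c)%N.
Proof.
move=> Ac /subset_card_le H; rewrite -card_le_II.
by rewrite -(card_le_eqr Ac) -(card_le_eql (card_segment j c')).
Qed.

Lemma sg_gt sg t j k : increasing sg -> idx sg t j -> t < sg k -> j < k.
Proof.
move=> inc /andP[a b] tk; rewrite ltNge; apply/negP => h.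
by have := increasing_le inc h; rewrite leNgt (le_lt_trans a tk).
Qed.

Lemma sg_le sg t j k : increasing sg -> idx sg t j -> sg k <= t -> k <= j.
Proof.
move=> inc /andP[a b] tk; rewrite leNgt; apply/negP => h.
have : sg (j + 1) <= sg k by apply: increasing_le => //; lia.
by rewrite leNgt (le_lt_trans tk b).
Qed.

Lemma gt_sg sg t j k : increasing sg -> idx sg t j -> j < k -> t < sg k.
Proof.
move=> inc /andP[a b] jk; apply: lt_le_trans b _; apply: increasing_le => //; lia.
Qed.

Lemma le_sg sg t j k : increasing sg -> idx sg t j -> k <= j -> sg k <= t.
Proof. by move=> inc /andP[a b] jk; apply: le_trans a; exact: increasing_le. Qed.

(** Only t is known to lie in an interval; if the points accumulate, t' may lie in none. A finite
    count rules this out: otherwise ]t, t'] would contain too many or too few of the points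
    following s_j. *)
Lemma card_points_forward sg t t' j c : increasing sg -> idx sg t j -> t <= t' ->
  ([set k | (t < sg k <= t')%R] #= `I_c)%card <-> idx sg t' (j + c%:Z).
Proof.
move=> inc tj tt'; split=> [Dc|t'j]; last first.
  by rewrite (points_segment inc tj t'j); exact: card_segment.
apply/andP; split; rewrite leNgt || rewrite ltNge; apply/negP => h.
  case: c Dc h => [|c] Dc h.
    by move: h; rewrite addr0 ltNge (le_trans _ tt') //; case/andP: tj.
  have : (c.+1 <= c)%N.
    apply: (card_le_segment (j := j) Dc) => k /= /andP[k1 k2].
    have jk := sg_gt inc tj k1.
    have : k < j + c.+1%:Z.
      rewrite ltNge; apply/negP => h'; have := increasing_le inc h'.
      by rewrite leNgt (le_lt_trans k2 h).
    lia.
  by rewrite ltnn.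
have : (c.+1 <= c)%N.
  apply: (card_ge_segment (j := j) Dc) => k /= /andP[k1 k2].
  rewrite (gt_sg inc tj k1) /=; apply: le_trans h; apply: increasing_le => //; lia.
by rewrite ltnn.
Qed.

Lemma card_points_backward sg t t' j c : increasing sg -> idx sg t' j -> t <= t' ->
  ([set k | (t < sg k <= t')%R] #= `I_c)%card <-> idx sg t (j - c%:Z).
Proof.
move=> inc t'j tt'; split=> [Dc|tj]; last first.
  by apply/(card_points_forward c inc tj tt'); rewrite subrK.
apply/andP; split; rewrite leNgt || rewrite ltNge; apply/negP => h.
  have : (c.+1 <= c)%N.
    apply: (card_ge_segment (j := j - c.+1%:Z) Dc) => k /= /andP[k1 k2].
    rewrite (le_sg inc t'j) ?andbT; last by lia.
    by apply: lt_le_trans h _; apply: increasing_le => //; lia.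
  by rewrite ltnn.
case: c Dc h => [|c] Dc h.
  by move: h; rewrite subr0 leNgt (le_lt_trans tt') //; case/andP: t'j.
have : (c.+1 <= c)%N.
  apply: (card_le_segment (j := j - c%:Z) Dc) => k /= /andP[k1 k2].
  have kj := sg_le inc t'j k2.
  have : j - c.+1%:Z + 1 < k.
    rewrite ltNge; apply/negP => h'; have := increasing_le inc h'.
    by rewrite leNgt (le_lt_trans h k1).
  lia.
by rewrite ltnn.
Qed.

Fixpoint jump_counts sg t0 (ts : seq R) (cs : seq nat) : Prop :=
  match ts, cs with
  | t :: ts', c :: cs' =>
      ([set k | (t0 < sg k <= t)%R] #= `I_c)%card /\ jump_counts sg t ts' cs'
  | _, _ => True
  end.

Fixpoint jump_idx sg (j : int) (ts : seq R) (cs : seq nat) : bool :=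
  match ts, cs with
  | t :: ts', c :: cs' => idx sg t (j + c%:Z) && jump_idx sg (j + c%:Z) ts' cs'
  | _, _ => true
  end.

(** Passes from counts in gaps, whose law is given by the Poisson hypothesis, to indices, at which
    the chain is read. *)
Lemma jump_countsP sg t0 j ts cs : increasing sg -> idx sg t0 j ->
  path <=%R t0 ts -> jump_counts sg t0 ts cs <-> jump_idx sg j ts cs.
Proof.
move=> inc; elim: ts t0 j cs => [|t ts IH] t0 j [|c cs] //= t0j /andP[t0t st].
split=> [[H1 H2]|/andP[H1 H2]].
  have tj := (card_points_forward c inc t0j t0t).1 H1.
  by rewrite tj /=; apply/(IH t _ cs tj st).
split; first exact/(card_points_forward c inc t0j t0t).
exact/(IH t _ cs H1 st).
Qed.

Lemma jump_counts_nth sg t0 ts cs : size ts = size cs ->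
  jump_counts sg t0 ts cs <-> (forall a, (a < size ts)%N ->
    ([set k | (nth 0 (t0 :: ts) a < sg k <= nth 0 ts a)%R] #= `I_(nth 0 cs a))%card).
Proof.
elim: ts t0 cs => [|t ts IH] t0 [|c cs] //= [scs].
split=> [[H1 /(IH t cs scs) H2] [|a] //= ats|H]; first exact: H2.
split; first exact: (H 0%N).
by apply/(IH t cs scs) => a ats; exact: (H a.+1).
Qed.

End Enumerations.

(** There are only countably many finite sets A of integers, and D w = A is a countable conjunction
    of conditions on single integers. *)
Lemma measurable_card_eq d (T : measurableType d) (D : T -> set int) c :
  (forall j, measurable [set w | D w j]) ->
  measurable [set w | (D w #= `I_c)%card].
Proof.
move=> mD.
pose elts (A : finmap.finSet int) : seq int := finmap.enum_fset A.
pose F (A : finmap.finSet int) : set T :=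
  if size (elts A) == c then \bigcap_(n : nat)
    ([set w | D w n%:Z <-> n%:Z \in elts A] `&`
     [set w | D w (Negz n) <-> Negz n \in elts A])
  else set0.
have -> : [set w | (D w #= `I_c)%card] = \bigcup_(A : finmap.finSet int) F A.
  apply/seteqP; split=> w /=.
    move=> Dc; have /finite_fsetP[A DA] : finite_set (D w) by apply/finite_setP; exists c.
    exists A => //; rewrite /F; move: Dc; rewrite DA => /card_eq_fsetP.
    by rewrite -/(elts A) => ->; rewrite eqxx => n _ /=; rewrite DA.
  move=> [A _]; rewrite /F; case: eqP => // /card_eq_fsetP Ac H.
  suff -> : D w = [set j | j \in elts A] by exact: Ac.
  by apply/seteqP; split=> -[] n /=; have [H1 H2] := H n I;
    [exact: H1.1|exact: H2.1|exact: H1.2|exact: H2.2].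
apply: countable_bigcupT_measurable => [|A].
  apply/countable_injP; exists (fun A => choice.pickle (elts A)).
  move=> A B _ _ /(pcan_inj choice.pickleK) AB; apply/finmap.fsetP => j.
  by have : (j \in elts A) = (j \in elts B) by rewrite AB.
rewrite /F; case: ifP => _ //; apply: bigcapT_measurable => n.
have mb j (b : bool) : measurable [set w | D w j <-> b].
  case: b.
    rewrite (_ : [set w | _] = [set w | D w j]) //.
    by apply/seteqP; split=> w /=; [move=> [_ H]; exact: H|].
  have -> : [set w | D w j <-> false] = ~` [set w | D w j].
    by apply/seteqP; split=> w /=; [move=> [H _] /H|move=> nD; split].
  exact: measurableC.
by apply: measurableI.
Qed.

Section PoissonCounts.
Context {R : realType} {d : measure_display} {T : measurableType d}.
Variables (P : probability T R) (s : {RV P >-> real_seq R}) (lam : R).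
Hypothesis s_poisson : poisson_points P lam s.
Hypothesis lam_ge0 : 0 <= lam.

Lemma s_increasing w : increasing (s w).
Proof. by case: s_poisson => inc _ _; exact: inc. Qed.

Lemma idx_0 w : idx (s w) 0 0.
Proof. by case: s_poisson => _ H _; rewrite /idx add0r; exact: H. Qed.

Lemma measurable_point (j : int) (B : set R) : measurable B ->
  measurable [set x : real_seq R | B (x j)].
Proof. by move=> mB; apply: sub_sigma_algebra; exists j; exists B. Qed.

Lemma measurable_s (U : set (real_seq R)) : measurable U -> measurable (s @^-1` U).
Proof. by move=> mU; rewrite -[X in measurable X]setTI; exact: measurable_funPT. Qed.

Lemma measurable_idx t j : measurable [set x : real_seq R | idx x t j].
Proof.
have -> : [set x : real_seq R | idx x t j] =
    [set x | `]-oo, t]%classic (x j)] `&` [set x | `]t, +oo[%classic (x (j + 1))].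
  apply/seteqP; split=> x /=; rewrite /idx !in_itv /= andbT.
    by move/andP.
  by move=> [-> ->].
by apply: measurableI; apply: measurable_point; exact: measurable_itv.
Qed.

Fixpoint count_weight t0 (ts : seq R) (cs : seq nat) : R :=
  match ts, cs with
  | t :: ts', c :: cs' => poisson_weight (lam * (t - t0)) c * count_weight t ts' cs'
  | _, _ => 1
  end.

Lemma count_weightE t0 ts cs : size ts = size cs ->
  count_weight t0 ts cs = \prod_(j < size ts)
    poisson_weight (lam * (nth 0 ts j - nth 0 (t0 :: ts) j)) (nth 0%N cs j).
Proof.
elim: ts t0 cs => [|t ts IH] t0 [|c cs] //=; first by rewrite big_ord0.
by move=> [scs]; rewrite big_ord_recl /= IH.
Qed.

Lemma measurable_counts t0 ts cs : measurable [set w | jump_counts (s w) t0 ts cs].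
Proof.
elim: ts t0 cs => [|t ts IH] t0 [|c cs]; try exact: measurableT.
have -> : [set w | jump_counts (s w) t0 (t :: ts) (c :: cs)] =
  [set w | ([set k | (t0 < s w k <= t)%R] #= `I_c)%card] `&` [set w | jump_counts (s w) t ts cs].
  by [].
apply: measurableI; last exact: IH.
apply: measurable_card_eq => j /=.
have -> : [set w | t0 < s w j <= t] = s @^-1` [set x | `]t0, t]%classic (x j)].
  by apply/seteqP; split=> w /=; rewrite in_itv.
by apply: measurable_s; apply: measurable_point; exact: measurable_itv.
Qed.

Lemma pr_counts t0 ts cs : size ts = size cs -> path <=%R t0 ts ->
  pr P [set w | jump_counts (s w) t0 ts cs] = count_weight t0 ts cs.
Proof.
move=> scs st; case: s_poisson => _ _ H.
(* The intervals are open on the left and closed on the right: a jump at time t has already happened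
   at t, as in [idx]. *)
pose A (j : 'I_(size ts)) : set R := `]nth 0 (t0 :: ts) j, nth 0 ts j]%classic.
have st_le (a : nat) : (a < size ts)%N -> nth 0 (t0 :: ts) a <= nth 0 ts a.
  by move=> ats; have /(pathP 0)/(_ a ats) := st.
have A_len j : lebesgue_measure (A j) = (nth 0 ts j - nth 0 (t0 :: ts) j)%:E.
  rewrite lebesgue_measure_itv /= lte_fin; have := st_le j (ltn_ord j).
  by rewrite le_eqVlt => /orP[/eqP ->|->]; rewrite ?ltxx ?subrr.
rewrite /pr (_ : [set w | _] =
  [set w | forall j, ([set i : int | A j (s w i)] #= `I_(nth 0%N cs j))%card]); last first.
  apply/seteqP; split=> w /=.
    move/(jump_counts_nth _ _ scs) => Hw j; have := Hw j (ltn_ord j).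
    by congr (_ #= _)%card; apply/seteqP; split=> k /=; rewrite /A /= in_itv.
  move=> Hw; apply/(jump_counts_nth _ _ scs) => a ats; have := Hw (Ordinal ats).
  by congr (_ #= _)%card; apply/seteqP; split=> k /=; rewrite /A /= in_itv.
rewrite H.
- rewrite count_weightE //=; apply: eq_bigr => j _; by rewrite A_len.
- by move=> j; exact: measurable_itv.
- by move=> j; rewrite A_len ltry.
apply/trivIsetP => i j _ _; wlog ij : i j / (i < j)%N => [hw|].
  move=> ij; have : (i != j :> nat) by [].
  by rewrite neq_ltn => /orP[/hw|/hw H']; [exact|rewrite setIC; apply: H'; rewrite eq_sym].
move=> _; apply/seteqP; split=> // x [] /=; rewrite /A /= !in_itv /= => /andP[_ x1] /andP[x2 _].
have : nth 0 ts i <= nth 0 (t0 :: ts) j.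
  case: j ij x2 => -[|j] //= jts; rewrite ltnS => ij x2.
  have sts : sorted <=%R ts by exact: path_sorted st.
  apply: (sorted_leq_nth le_trans lexx 0 sts) => //; rewrite inE //.
  exact: ltnW.
by rewrite leNgt (lt_le_trans x2 x1).
Qed.

Lemma sum_poisson_weight (r : R) : \sum_(c < M) poisson_weight r c @[M --> \oo] --> (1 : R).
Proof.
have -> : (fun M => \sum_(c < M) poisson_weight r c) = (fun M => exp_psum r M * expR (- r)).
  apply/funext => M; rewrite /exp_psum mulr_suml; apply: eq_bigr => c _.
  by rewrite /poisson_weight [_^-1 * _]mulrC.
have -> : (1 : R) = expR r * expR (- r) by rewrite -expRD subrr expR0.
by apply: cvgM; [exact: cvg_exp_psumR | exact: cvg_cst].
Qed.

Lemma sum_pr_le (I : finType) (A : I -> set T) (B : set T) :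
  (forall j, measurable (A j)) -> measurable B ->
  (forall j, A j `<=` B) -> (forall j k x, A j x -> A k x -> j = k) ->
  \sum_j pr P (A j) <= pr P B.
Proof.
move=> mA mB AB dA.
have seqP (l : seq I) : uniq l ->
    measurable (\big[setU/set0]_(j <- l) A j) /\
    pr P (\big[setU/set0]_(j <- l) A j) = \sum_(j <- l) pr P (A j).
  elim: l => [|j l IH] /=; first by rewrite !big_nil pr0.
  move=> /andP[jl ul]; have [ml IHl] := IH ul; rewrite !big_cons.
  split; first exact: measurableU.
  rewrite prU // ?IHl //; apply/seteqP; split=> // x [Aj].
  rewrite -bigcup_seq => -[k /= kl Ak].
  by rewrite (dA _ _ _ Aj Ak) kl in jl.
have [m1 <-] := seqP (index_enum I) (index_enum_uniq I).
by apply: pr_le => //; rewrite -bigcup_seq => x [j _ Aj]; exact: AB Aj.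
Qed.

Definition covered t : set T := [set w | exists j, idx (s w) t j].

Lemma measurable_covered t : measurable (covered t).
Proof.
have -> : covered t = \bigcup_(j : int) (s @^-1` [set x | idx x t j]).
  by apply/seteqP; split=> w [j] //; exists j.
apply: countable_bigcupT_measurable => [|j]; first exact: countableP.
by apply: measurable_s; exact: measurable_idx.
Qed.

(** As 0 lies in the interval of index 0, having index c at t >= 0 means c points in ]0, t], and
    index - c at t < 0 means c points in ]t, 0]. The Poisson weights of these disjoint events sum to
    1. *)
Lemma pr_covered t : pr P (covered t) = 1.
Proof.
apply/eqP; rewrite eq_le; apply/andP; split.
  by rewrite -(prT P); apply: pr_le => //; exact: measurable_covered.
have lower (rate : R) (j : nat -> int) : injective j ->
    (forall c, pr P (s @^-1` [set x | idx x t (j c)]) = poisson_weight rate c) ->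
    1 <= pr P (covered t).
  move=> j_inj prj; have cv := sum_poisson_weight rate.
  rewrite -(cvg_lim _ cv) //; apply: limr_le; first by apply/cvg_ex; exists 1.
  apply: nearW => M; under eq_bigr do rewrite -prj.
  apply: sum_pr_le => [c||c w|c c' w] /=.
  - by apply: measurable_s; exact: measurable_idx.
  - exact: measurable_covered.
  - by move=> H; exists (j c).
  - by move=> H /(idx_uniq (s_increasing w) H)/j_inj/val_inj.
have [t0|t0] := leP 0 t.
  apply: (lower (lam * (t - 0)) (fun c => c%:Z)) => [x y []//|c].
  have := @pr_counts 0 [:: t] [:: c] erefl; rewrite /= t0 mulr1 => <- //.
  congr pr; apply/seteqP; split=> w /=.
    move=> H; split=> //; apply/(card_points_forward c (s_increasing w) (idx_0 w) t0).
    by rewrite add0r.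
  by move=> [/(card_points_forward c (s_increasing w) (idx_0 w) t0)]; rewrite add0r.
apply: (lower (lam * (0 - t)) (fun c => - c%:Z)) => [x y /oppr_inj[]//|c].
have := @pr_counts t [:: 0] [:: c] erefl; rewrite /= (ltW t0) mulr1 => <- //.
congr pr; apply/seteqP; split=> w /=.
  move=> H; split=> //; apply/(card_points_backward c (s_increasing w) (idx_0 w) (ltW t0)).
  by rewrite add0r.
by move=> [/(card_points_backward c (s_increasing w) (idx_0 w) (ltW t0))]; rewrite add0r.
Qed.

End PoissonCounts.

(** The algebra of one step in [pr_cyl_visits]: x and y are the values of r at the current and the
    next state, b the adjacency entry, l the eigenvalue. *)
Lemma cancel_step (F : fieldType) (x y l b p q u v : F) c : x != 0 -> y != 0 ->
  y * q = u * (b * y / (l * x)) * (l ^- c * p * v) -> l != 0 ->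
  x * q = u * (l ^- c.+1 * (b * p) * v).
Proof.
move=> x0 y0 H l0; apply: (mulfI y0); rewrite mulrCA H exprS.
by field; rewrite x0 ?l0 ?expf_neq0.
Qed.

(** * Visits of the chain after prescribed numbers of jumps *)

Section MarkovVisits.
Variables (R : realType) (L N : nat).
Hypotheses (L_gt1 : (1 < L)%N) (N_gt0 : (0 < N)%N) (N_ltL : (N < L)%N).
Local Notation E := {set 'Z_L}.
Local Notation Om := (state_seq L).
Local Notation r := (@groundR R L N).
Local Notation lam := (@lambda R L N).
Local Notation pw := (parry_weight (@adj L N) r lam).
Variable mu : probability Om R.
Hypothesis mu_inv : chain_invariant N mu.
Hypothesis wp_parry : forall w, wp mu w = pw w.

Fixpoint visits (j : int) (cs : seq nat) (st : seq E) : set Om :=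
  match cs, st with
  | c :: cs', e :: st' =>
      [set x : Om | x (j + c%:Z) = e] `&` visits (j + c%:Z) cs' st'
  | _, _ => setT
  end.

Fixpoint jump_weight S (cs : seq nat) (st : seq E) : R :=
  match cs, st with
  | c :: cs', S' :: st' => lam ^- c * path_count R N c S S' * jump_weight S' cs' st'
  | _, _ => r S
  end.

Lemma measurable_visits j cs st : measurable (visits j cs st).
Proof.
elim: cs j st => [|c cs IH] j [|S st] /=; try exact: measurableT.
by apply: measurableI; [exact: (measurable_coord _ [set S])|exact: IH].
Qed.

Let r_ge0 := @groundR_ge0 R L N L_gt1 N_gt0 N_ltL.
Let lam_gt0 := lambda_gt0 R L_gt1 N_gt0 N_ltL.

Lemma pr_cyl_null j w S (B : set Om) : measurable B -> r S = 0 ->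
  pr mu (cyl j (rcons w S) `&` B) = 0.
Proof.
move=> mB rS; apply/eqP; rewrite eq_le pr_ge0 andbT.
rewrite -[leRHS](parry_weight_r0 (@adj L N) lam w rS) -wp_parry -(wp_shift mu_inv j).
by apply: pr_le => //; [apply: measurableI => //|]; exact: measurable_cyl.
Qed.

(** Along a path the ratios of r in the Parry kernel telescope to the last value over r S. The
    factor r S on the left replaces this division, since r S may be 0. *)
Lemma pr_cyl_visits j w S cs st :
  r S * pr mu (cyl j (rcons w S) `&` visits (j + (size w)%:Z) cs st) =
  pw (rcons w S) * jump_weight S cs st.
Proof.
have triv j' w' S' : r S' * pr mu (cyl j' (rcons w' S') `&` setT) = pw (rcons w' S') * r S'.
  by rewrite setIT (wp_shift mu_inv) wp_parry mulrC.
elim: cs j w S st => [|c cs IHcs] j w S [|S' st] /=; try exact: triv.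
elim: c j w S => [|c IH] j w S.
  rewrite expr0 invr1 mul1r addr0 [path_count _ _ _ _ _]/=; have [SS'|SS'] := eqVneq S S'.
    rewrite mul1r -SS' -(IHcs j); congr (_ * pr _ _).
    by rewrite setIA; congr (_ `&` _); rewrite cyl_rcons -setIA setIid.
  rewrite mul0r mulr0 (_ : _ `&` _ = set0) ?pr0 ?mulr0 //.
  apply/seteqP; split=> // x; rewrite cyl_rcons => -[[_ /= xS] [/= xS' _]].
  by move: SS'; rewrite -xS -xS' eqxx.
set V := [set x | _] `&` _; have mV : measurable V.
  by apply: measurableI; [exact: (measurable_coord _ [set S'])|exact: measurable_visits].
rewrite (pr_partition (f := fun x : Om => x (j + (size w)%:Z + 1)) mu); last 2 first.
- by apply: measurableI => //; exact: measurable_cyl.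
- by move=> S1; exact: (measurable_coord _ [set S1]).
rewrite /= mulr_sumr [in RHS]mulr_sumr mulr_suml mulr_sumr; apply: eq_bigr => S1 _.
have -> : cyl j (rcons w S) `&` V `&` [set x | x (j + (size w)%:Z + 1) = S1] =
    cyl j (rcons (rcons w S) S1) `&` V.
  rewrite (cyl_rcons _ (rcons w S)) setIAC; congr (_ `&` _ `&` _).
  by rewrite size_rcons -[(size w).+1]addn1 PoszD addrA.
have [rS1|rS1] := eqVneq (r S1) 0.
  have -> : @adj L N S S1 = false.
    by apply/negP => /(adj_support R L_gt1 N_gt0 N_ltL)[_]; rewrite rS1 ltxx.
  by rewrite mul0r !(mulr0, mul0r) pr_cyl_null // mulr0.
have := IH j (rcons w S) S1.
have -> : [set x : Om | x (j + (size (rcons w S))%:Z + c%:Z) = S'] `&`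
    visits (j + (size (rcons w S))%:Z + c%:Z) cs st = V.
  by rewrite /V size_rcons -!addrA -!PoszD [((size w).+1 + c)%N]addSnnS.
rewrite parry_weight_markov /parry_step.
have [rS|rS] := eqVneq (r S) 0; first by rewrite rS parry_weight_r0 // !mul0r.
by move/(cancel_step rS rS1); apply; rewrite gt_eqF.
Qed.

Lemma pr_visits j S cs st :
  pr mu ([set x : Om | x j = S] `&` visits j cs st) = L%:R ^- N * (r S * jump_weight S cs st).
Proof.
have -> : [set x : Om | x j = S] = cyl j (rcons [::] S) by rewrite /= setIT.
have [rS|rS] := eqVneq (r S) 0.
  by rewrite pr_cyl_null ?rS ?mul0r ?mulr0 //; exact: measurable_visits.
apply: (mulfI rS); have := pr_cyl_visits j [::] S cs st.
by rewrite addr0 => ->; rewrite /= sum_sqr_groundR // mulr1; ring.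
Qed.

End MarkovVisits.

(** * The law of the stones *)

(** Used with G j the event that index j is current and V j an event of the chain read from j on:
    the index is random, but v is the same for all j. *)
Lemma pr_mixture (R : realType) d (T : measurableType d) (P : probability T R)
    (G V : int -> set T) (v : R) :
  (forall j, measurable (G j)) -> (forall j, measurable (V j)) ->
  (forall j j' w, G j w -> G j' w -> j = j') ->
  (forall j, pr P (G j `&` V j) = pr P (G j) * v) -> 0 <= v ->
  pr P (\bigcup_j (G j `&` V j)) = pr P (\bigcup_j G j) * v.
Proof.
move=> mG mV dG GV v0.
pose nat_family (F : int -> set T) n := if pickle_inv n is Some j then F j else set0.
have famE F : \bigcup_j F j = \bigcup_n nat_family F n.
  apply/seteqP; split=> w [j _ Fw].
    by exists (choice.pickle j); [exact: I|rewrite /nat_family pickleK_inv; exact: Fw].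
  by move: Fw; rewrite /nat_family; case: pickle_inv => // j' Fw; exists j'.
have triv F : (forall j, F j `<=` G j) -> trivIset setT (nat_family F).
  move=> FG; apply/trivIsetP => n n' _ _ nn'; apply/seteqP; split=> // w [].
  rewrite /nat_family; have := @pickle_invK int n; have := @pickle_invK int n'.
  case: pickle_inv => [j' /= e'|//]; case: pickle_inv => [j /= e|//] /FG Gj /FG Gj'.
  by move: nn'; rewrite -e -e' (dG _ _ _ Gj Gj') eqxx.
have mfam F : (forall j, measurable (F j)) -> forall n, measurable (nat_family F n).
  by move=> mF n; rewrite /nat_family; case: pickle_inv.
have mGV j : measurable (G j `&` V j) by exact: measurableI.
have mU (F : int -> set T) : (forall j, measurable (F j)) -> measurable (\bigcup_j F j).
  by move=> mF; rewrite famE; apply: bigcupT_measurable; exact: mfam.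
apply: EFin_inj; rewrite EFinM -!prE //; try by apply: mU.
rewrite !famE !measure_bigcup //; try by move=> *; exact: mfam.
- rewrite muleC -nneseriesZl //; apply: eq_eseriesr => n _.
  rewrite /nat_family; case: pickle_inv => [j|]; last by rewrite !measure0 mule0.
  transitivity (pr P (G j `&` V j))%:E; first exact: prE.
  by rewrite GV mulrC EFinM; congr (_ * _)%E; apply/esym; exact: prE.
- by apply: triv => j.
- by apply: triv => j w [].
Qed.

Section Stones.
Variables (R : realType) (L : nat).
Local Notation E := {set 'Z_L}.
Local Notation Om := (state_seq L).

Lemma stones_idx (x : Om) (sg : real_seq R) t j :
  increasing sg -> idx sg t j -> stones x sg t = x j.
Proof.
move=> inc tj; apply: xget_unique; first by exists j.
by move=> S [j' [tj' ->]]; rewrite (idx_uniq inc tj tj').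
Qed.

Lemma stones_default (x : Om) (sg : real_seq R) t :
  ~ (exists j, idx sg t j) -> stones x sg t = finset.set0.
Proof.
move=> nj; rewrite /stones; case: xgetP => // S _ [j [tj _]].
by case: nj; exists j.
Qed.

Lemma stones_visits (x : Om) (sg : real_seq R) j ts cs st : increasing sg ->
  size ts = size cs -> size st = size cs ->
  jump_idx sg j ts cs -> visits j cs st x -> map (stones x sg) ts = st.
Proof.
move=> inc; elim: ts j cs st => [|t ts IH] j [|c cs] [|S st] //= [s1] [s2].
by move=> /andP[tj H] [xS V]; rewrite (stones_idx x inc tj) xS (IH _ _ _ s1 s2 H V).
Qed.

Lemma jump_idx_inj (sg : int -> R) j ts cs cs' : increasing sg ->
  size ts = size cs -> size ts = size cs' ->
  jump_idx sg j ts cs -> jump_idx sg j ts cs' -> cs = cs'.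
Proof.
move=> inc; elim: ts j cs cs' => [|t ts IH] j [|c cs] [|c' cs'] //= [s1] [s2].
move=> /andP[tj H] /andP[tj' H']; have /addrI[cc'] := idx_uniq inc tj tj'.
by subst c'; rewrite (IH _ _ _ s1 s2 H H').
Qed.

End Stones.

Section Law.
Variables (R : realType) (L N : nat).
Hypotheses (L_gt1 : (1 < L)%N) (N_gt0 : (0 < N)%N) (N_ltL : (N < L)%N).
Local Notation E := {set 'Z_L}.
Local Notation Om := (state_seq L).
Local Notation r := (@groundR R L N).
Local Notation lam := (@lambda R L N).
Local Notation pw := (parry_weight (@adj L N) r lam).
Context {d : measure_display} {T : measurableType d}.
Variables (P : probability T R) (X : {RV P >-> Om}) (s : {RV P >-> real_seq R}).
Hypothesis X_inv : chain_invariant N (distribution P X).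
Hypothesis X_parry : forall w, wp (distribution P X) w = pw w.
Hypothesis s_poisson : poisson_points P lam s.
Hypothesis X_s_independent : independent_rv P X s.

Let r_ge0 := @groundR_ge0 R L N L_gt1 N_gt0 N_ltL.
Let lam_gt0 := lambda_gt0 R L_gt1 N_gt0 N_ltL.

Lemma measurable_X (U : set Om) : measurable U -> measurable (X @^-1` U).
Proof. by move=> mU; rewrite -[X in measurable X]setTI; exact: measurable_funPT. Qed.

Lemma measurable_jump_idx j ts cs : measurable [set x : real_seq R | jump_idx x j ts cs].
Proof.
have mT : measurable [set x : real_seq R | true].
  by rewrite (_ : [set x | _] = setT) //; apply/seteqP; split.
elim: ts j cs => [|t ts IH] j [|c cs] //=.
have -> : [set x : real_seq R | idx x t (j + c%:Z) && jump_idx x (j + c%:Z) ts cs] =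
    [set x : real_seq R | idx x t (j + c%:Z)] `&` [set x | jump_idx x (j + c%:Z) ts cs].
  by apply/seteqP; split=> x /=; [move/andP|move=> [-> ->]].
by apply: measurableI => //; exact: measurable_idx.
Qed.

Definition history t0 (ts : seq R) (cs : seq nat) S (st : seq E) : set T :=
  \bigcup_(j : int) (s @^-1` ([set x | idx x t0 j] `&` [set x | jump_idx x j ts cs]) `&`
                     X @^-1` ([set x | x j = S] `&` visits j cs st)).

Let measurable_counted t0 ts cs j : measurable
  (s @^-1` ([set x | idx x t0 j] `&` [set x | jump_idx x j ts cs])).
Proof.
by apply: measurable_s; apply: measurableI; [exact: measurable_idx|exact: measurable_jump_idx].
Qed.

Let measurable_visited cs S st j : measurable
  (X @^-1` ([set x : Om | x j = S] `&` visits j cs st)).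
Proof.
apply: measurable_X; apply: measurableI; last exact: measurable_visits.
exact: (measurable_coord j [set S]).
Qed.

Lemma measurable_history t0 ts cs S st : measurable (history t0 ts cs S st).
Proof.
apply: countable_bigcupT_measurable => [|j]; first exact: countableP.
by apply: measurableI.
Qed.

(** For a fixed index at t0, counts and states are independent, and shift invariance makes the
    factor of the states independent of the index. The union over indices gives the count event up
    to the null event that t0 lies in no interval. *)
Lemma pr_history t0 ts cs S st : path <=%R t0 ts -> size ts = size cs ->
  pr P (history t0 ts cs S st) =
  count_weight lam t0 ts cs * (L%:R ^- N * (r S * jump_weight R N S cs st)).
Proof.
move=> tts scs; have inc w := s_increasing s_poisson w.
have prX j : pr P (X @^-1` ([set x : Om | x j = S] `&` visits j cs st)) =
    L%:R ^- N * (r S * jump_weight R N S cs st).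
  by rewrite -(pr_visits L_gt1 N_gt0 N_ltL X_inv X_parry j).
rewrite /history (@pr_mixture _ _ _ P _ _ (L%:R ^- N * (r S * jump_weight R N S cs st))) //.
- congr (_ * _); rewrite -(pr_counts s_poisson scs tts).
  have mJ := measurable_counts s t0 ts cs; have mC := measurable_covered s t0.
  transitivity (pr P ([set w | jump_counts (s w) t0 ts cs] `&` covered s t0)).
    congr pr; apply/seteqP; split=> w.
      move=> [j _ [/= tj J]]; split; last by exists j.
      exact/(jump_countsP cs (inc w) tj tts).
    move=> [/= J [j tj]]; exists j => //; split=> //.
    exact/(jump_countsP cs (inc w) tj tts).
  apply/eqP; rewrite eq_le; apply/andP; split.
    by apply: pr_le => //; exact: measurableI.
  set J := [set w | _]; have -> : pr P J = pr P (J `&` covered s t0) + pr P (J `\` covered s t0).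
    rewrite -prU //; first by rewrite setUIDK.
    - exact: measurableI.
    - exact: measurableD.
    - by rewrite setDE setIACA setICr setI0.
  rewrite gerDl; have <- : pr P (~` covered s t0) = 0.
    have := prU P mC (measurableC mC) (setICr _); rewrite setUv prT (pr_covered s_poisson).
    by move/(congr1 (fun v => v - 1)); rewrite addrAC subrr add0r.
  apply: pr_le; [exact: measurableD|exact: measurableC|by move=> w []].
- by move=> j j' w [/= tj _] [/= tj' _]; exact: idx_uniq (inc w) tj tj'.
- move=> j; rewrite setIC /pr X_s_independent; last 2 first.
  + apply: measurableI; [exact: (measurable_coord j [set S])|exact: measurable_visits].
  + by apply: measurableI; [exact: measurable_idx|exact: measurable_jump_idx].
  by rewrite fineM ?fin_num_measure // mulrC; congr (_ * _); exact: prX.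
- by rewrite -(prX 0) pr_ge0.
Qed.

Fixpoint truncated_chain M t0 S (ts : seq R) (st : seq E) : R :=
  match ts, st with
  | t :: ts', S' :: st' => expR (- ((t - t0) * lam)) * transfer_psum N (t - t0) S S' M *
                           truncated_chain M t S' ts' st'
  | _, _ => r S
  end.

(** Allowing fewer than M jumps in every gap makes the sum factor gap by gap into partial sums of
    the exponential. *)
Lemma sum_counts M p t0 S ts st : size ts = p -> size st = p ->
  \sum_(cs : p.-tuple 'I_M) count_weight lam t0 ts (map val cs) *
    jump_weight R N S (map val cs) st = truncated_chain M t0 S ts st.
Proof.
elim: p t0 S ts st => [|p IH] t0 S [|t ts] [|S' st] //=.
  by rewrite (big_pred1 [tuple]) ?mul1r // => cs; apply/esym/eqP; exact: tuple0.
move=> [sts] [sst]; rewrite sum_tuple_cons -(IH t S' ts st sts sst).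
rewrite /transfer_psum -mulrA mulr_suml mulr_sumr; apply: eq_bigr => c _.
rewrite !mulr_sumr; apply: eq_bigr => cs _ /=.
rewrite /poisson_weight exprMn [(t - t0) * lam]mulrC.
by field; rewrite expf_neq0 ?gt_eqF // ltr0n fact_gt0.
Qed.

Lemma cvg_truncated_chain t0 S ts st : path <=%R t0 ts ->
  truncated_chain M t0 S ts st @[M --> \oo] --> wchain N t0 S ts st.
Proof.
elim: ts t0 S st => [|t ts IH] t0 S [|S' st] /=; try by move=> _; exact: cvg_cst.
move=> /andP[t0t tts]; apply: cvgM; last exact: IH.
apply: cvgM; first exact: cvg_cst.
by apply: cvg_transfer => //; rewrite subr_ge0.
Qed.

Definition stones_at ts (st : seq E) : set T :=
  [set w | map (stones (X w) (s w)) ts = st].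

Lemma measurable_stones t S : measurable [set w | stones (X w) (s w) t = S].
Proof.
have -> : [set w | stones (X w) (s w) t = S] =
    \bigcup_(j : int) (s @^-1` [set x | idx x t j] `&` X @^-1` [set x | x j = S]) `|`
    (* When t lies in no interval, [stones] takes its default value, the empty set. *)
    (if S == finset.set0 then ~` covered s t else set0).
  apply/seteqP; split=> w /=.
    move=> <-; have [[j tj]|nc] := pselect (covered s t w).
      by left; exists j => //; split=> //=; rewrite (stones_idx _ (s_increasing s_poisson w) tj).
    by right; rewrite stones_default // eqxx.
  move=> [[j _ [/= tj <-]]|].
    exact: stones_idx (s_increasing s_poisson w) tj.
  by case: eqP => // -> nc; exact: stones_default.
apply: measurableU.
  apply: countable_bigcupT_measurable => [|j]; first exact: countableP.
  apply: measurableI; first by apply: measurable_s; exact: measurable_idx.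
  by apply: measurable_X; exact: (measurable_coord j [set S]).
by case: ifP => // _; apply: measurableC; exact: measurable_covered.
Qed.

Lemma measurable_stones_at ts st : measurable (stones_at ts st).
Proof.
elim: ts st => [|t ts IH] [|S st].
- by rewrite /stones_at (_ : [set w | _] = setT) //; apply/seteqP; split.
- by rewrite /stones_at (_ : [set w | _] = set0) //; apply/seteqP; split.
- by rewrite /stones_at (_ : [set w | _] = set0) //; apply/seteqP; split.
have -> : stones_at (t :: ts) (S :: st) =
    [set w | stones (X w) (s w) t = S] `&` stones_at ts st.
  by apply/seteqP; split=> w /=; [case|move=> [/= <- <-]].
by apply: measurableI => //; exact: measurable_stones.
Qed.

(* Both sides sum to 1 over st, so this inequality is an equality. *)
Lemma path_weight_le ts st : sorted <=%R ts -> size st = size ts ->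
  path_weight N ts st <= pr P (stones_at ts st).
Proof.
case: ts st => [|t0 ts] [|S st] //= tts.
  by move=> _; rewrite -(prT P) (_ : stones_at _ _ = setT) //; apply/seteqP; split.
move=> [sst]; have cv := @cvg_truncated_chain t0 S ts st tts.
have {}cv : L%:R ^- N * (r S * truncated_chain M t0 S ts st) @[M --> \oo] -->
    L%:R ^- N * (r S * wchain N t0 S ts st).
  by apply: cvgM; [exact: cvg_cst|apply: cvgM; [exact: cvg_cst|]].
rewrite -(cvg_lim _ cv) //; apply: limr_le; first by apply/cvg_ex; eexists; exact: cv.
(* For each M the bounded histories are disjoint sub-events, so the truncated weight is already
   below the probability; then M tends to infinity. *)
apply: nearW => M; rewrite -(@sum_counts M (size ts)) // !mulr_sumr.
rewrite (eq_bigr (fun cs : (size ts).-tuple 'I_M => pr P (history t0 ts (map val cs) S st))).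
  2: by move=> cs _; rewrite pr_history ?size_map ?size_tuple //; ring.
apply: sum_pr_le => [cs||cs w|cs cs' w].
- exact: measurable_history.
- exact: measurable_stones_at.
- move=> [j _ [[/= tj J] [/= xS V]]]; rewrite /stones_at /=.
  rewrite (stones_idx _ (s_increasing s_poisson w) tj) xS; congr (_ :: _).
  by apply: stones_visits (s_increasing s_poisson w) _ _ J V; rewrite size_map size_tuple.
move=> [j _ [[/= tj J] _]] [j' _ [[/= tj' J'] _]].
have inc := s_increasing s_poisson w; rewrite (idx_uniq inc tj tj') in J.
apply/val_inj/(inj_map val_inj).
by apply: jump_idx_inj inc _ _ J J'; rewrite size_map size_tuple.
Qed.

End Law.

Lemma sorting_perm (R : realDomainType) n (t : 'I_n -> R) :
  exists p : 'S_n, forall a b : 'I_n, (a <= b)%N -> t (p a) <= t (p b).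
Proof.
pose le_t a b := t a <= t b.
have /tuple_permP[p ptE] : perm_eq (sort_tuple le_t (ord_tuple n)) (ord_tuple n).
  by rewrite /= perm_sort.
exists p => a b ab; have : sorted le_t (sort le_t (enum 'I_n)).
  by apply: sort_sorted => x y; exact: le_total.
have -> : sort le_t (enum 'I_n) = map p (enum 'I_n).
  rewrite (_ : sort _ _ = sort_tuple le_t (ord_tuple n)) // ptE /=.
  by apply: eq_map => i; rewrite tnth_ord_tuple.
rewrite sorted_map => /(sorted_leq_nth _ _ a) H.
have := H (fun y x z xy yz => le_trans xy yz) (fun x => lexx _) a b.
by rewrite !inE !size_enum_ord !ltn_ord !nth_ord_enum; exact.
Qed.

Lemma sorted_map_enum (R : realDomainType) n (t : 'I_n -> R) :
  (forall a b : 'I_n, (a <= b)%N -> t a <= t b) -> sorted <=%R (map t (enum 'I_n)).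
Proof.
move=> t_sorted; rewrite sorted_map.
apply: (@sub_sorted _ (relpre val leq)) => [a b|]; first exact: t_sorted.
by rewrite -sorted_map val_enum_ord iota_sorted.
Qed.

Lemma det_perm_both (R : comNzRingType) n (p : 'S_n) (M : 'M[R]_n) :
  \det (\matrix_(a, b) M (p a) (p b)) = \det M.
Proof.
have -> : \matrix_(a, b) M (p a) (p b) = row_perm p (col_perm p M).
  by apply/matrixP => a b; rewrite !mxE.
rewrite row_permE col_permE !det_mulmx !det_perm odd_permV mulrCA -signr_addb.
by rewrite addbb mulr1.
Qed.

(** * The determinantal formula for the process *)

Section Correlations.
Variables (R : realType) (L N : nat).
Hypotheses (L_gt1 : (1 < L)%N) (N_gt0 : (0 < N)%N) (N_ltL : (N < L)%N).
Local Notation E := {set 'Z_L}.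
Local Notation Om := (state_seq L).
Local Notation r := (@groundR R L N).
Local Notation lam := (@lambda R L N).
Context {d : measure_display} {T : measurableType d}.
Variables (P : probability T R) (X : {RV P >-> Om}) (s : {RV P >-> real_seq R}).
Hypothesis X_inv : chain_invariant N (distribution P X).
Hypothesis X_parry : forall w,
  wp (distribution P X) w = parry_weight (@adj L N) r lam w.
Hypothesis s_poisson : poisson_points P lam s.
Hypothesis X_s_independent : independent_rv P X s.

Let stones_tuple n (t : 'I_n -> R) w : n.-tuple E :=
  [tuple stones (X w) (s w) (t a) | a < n].

Let stones_atE n (t : 'I_n -> R) (st : n.-tuple E) :
  stones_at X s (map t (enum 'I_n)) st = [set w | stones_tuple t w = st].
Proof.
apply/seteqP; split=> w.
  rewrite /stones_at /= -map_comp => H; apply/val_inj; rewrite /= -H.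
  by apply: eq_map => a.
by move=> /= <-; rewrite /stones_at /= -map_comp.
Qed.

Lemma pr_stones_at n (t : 'I_n -> R) (st : n.-tuple E) :
  (forall a b : 'I_n, (a <= b)%N -> t a <= t b) ->
  pr P (stones_at X s (map t (enum 'I_n)) st) = path_weight N (map t (enum 'I_n)) st.
Proof.
move=> t_sorted; have st_sorted := sorted_map_enum t_sorted.
have le (st' : n.-tuple E) : path_weight N (map t (enum 'I_n)) (tval st') <=
    pr P (stones_at X s (map t (enum 'I_n)) (tval st')).
  by apply: path_weight_le => //; rewrite size_tuple size_map size_enum_ord.
have sum_pr : \sum_(st' : n.-tuple E) pr P (stones_at X s (map t (enum 'I_n)) st') = 1.
  transitivity (pr P setT); last exact: prT.
  rewrite (pr_partition (f := stones_tuple t) P) //.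
    by apply: eq_bigr => st' _; rewrite setTI stones_atE.
  by move=> st'; rewrite -stones_atE; apply: measurable_stones_at s_poisson _ _.
have sum_pw : \sum_(st' : n.-tuple E) path_weight N (map t (enum 'I_n)) st' = 1.
  apply: complexI; rewrite rmorph_sum /= rmorph1.
  (* At u = 0 the generating function is the total weight and the determinant is 1; the positions
     chosen are immaterial. *)
  have := sum_path_weight L_gt1 N_gt0 N_ltL (fun=> 0) 0 t_sorted.
  rewrite scale0r addr0 det1 => <-; apply: eq_bigr => st' _.
  by rewrite big1 ?mulr1 // => a _; rewrite /occ_weight mul0r addr0.
apply/eqP; rewrite -subr_eq0; apply/eqP.
apply: (psumr_eq0P (P := xpredT) (F := fun st' : n.-tuple E =>
  pr P (stones_at X s (map t (enum 'I_n)) st') - path_weight N (map t (enum 'I_n)) st')) => //.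
  by move=> st' _; rewrite subr_ge0.
by rewrite sumrB sum_pr sum_pw subrr.
Qed.

Lemma pr_occupied_sorted n (t : 'I_n -> R) (k : 'I_n -> 'Z_L) :
  (forall a b : 'I_n, (a <= b)%N -> t a <= t b) ->
  injective (fun a => (t a, k a)) ->
  ((pr P [set w | forall a, k a \in stones (X w) (s w) (t a)])%:C)%C =
  \det (\matrix_(a, b) stone_kernel N (t a - t b) (k b - k a)).
Proof.
move=> t_sorted tk; rewrite -sum_path_weight_occupied //; congr (_%:C)%C.
have mst a : measurable [set w | k a \in stones (X w) (s w) (t a)].
  have -> : [set w | k a \in stones (X w) (s w) (t a)] =
      \big[setU/set0]_(S : E | k a \in S) [set w | stones (X w) (s w) (t a) = S].
    rewrite -bigcup_seq_cond; apply/seteqP; split=> w /=.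
      by move=> kS; exists (stones (X w) (s w) (t a)) => //=; rewrite mem_index_enum.
    by move=> [S /= /andP[_ kS] ->].
  by apply: bigsetU_measurable => S _; apply: measurable_stones s_poisson _ _.
have -> : [set w | forall a, k a \in stones (X w) (s w) (t a)] =
    \bigcap_(a in [set` index_enum 'I_n]) [set w | k a \in stones (X w) (s w) (t a)].
  apply/seteqP; split=> w /= H a; first by move=> _; exact: H.
  by apply: H; rewrite /= mem_index_enum.
rewrite bigcap_seq (pr_partition (f := stones_tuple t) P); last 2 first.
- by apply: bigsetI_measurable.
- by move=> st; rewrite -stones_atE; apply: measurable_stones_at s_poisson _ _.
apply: eq_bigr => st _; rewrite -pr_stones_at // stones_atE -bigcap_seq.
have [kst|kst] := boolP [forall a, k a \in tnth st a].
  rewrite big1 ?mulr1; last by move=> a _; rewrite (forallP kst).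
  congr pr; apply/seteqP; split=> w; first by case.
  move=> /= wst; split=> // a _ /=; have := forallP kst a.
  by rewrite -wst tnth_mktuple.
have /forallPn[a ka] := kst.
rewrite (bigD1 a) //= (negPf ka) mul0r mulr0 (_ : _ `&` _ = set0) ?pr0 //.
apply/seteqP; split=> // w [/(_ a (mem_index_enum a)) /= kw /= wst].
by move: ka; rewrite -wst tnth_mktuple kw.
Qed.

(** Both sides are invariant under a simultaneous permutation of times and positions, so the times
    may be sorted. *)
Lemma pr_occupied n (t : 'I_n -> R) (k : 'I_n -> 'Z_L) :
  injective (fun a => (t a, k a)) ->
  ((pr P [set w | forall a, k a \in stones (X w) (s w) (t a)])%:C)%C =
  \det (\matrix_(a, b) stone_kernel N (t a - t b) (k b - k a)).
Proof.
move=> tk; have [p p_sorted] := sorting_perm t.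
rewrite -(det_perm_both p).
transitivity (\det (\matrix_(a, b) stone_kernel N (t (p a) - t (p b)) (k (p b) - k (p a)))).
  2: by congr (\det _); apply/matrixP => a b; rewrite !mxE.
rewrite -(pr_occupied_sorted (t := fun a => t (p a)) (k := fun a => k (p a))) //.
  congr ((pr P _)%:C)%C; apply/seteqP; split=> w /= H a //.
  by rewrite -(permKV p a).
by move=> a b /tk; exact: perm_inj.
Qed.

End Correlations.

Theorem theorem4 (R : realType) (L N : nat) (N_gt0 : (0 < N)%N)
  (N_ltL : (N < L)%N)
  (d : measure_display) (T : measurableType d) (P : probability T R)
  (X : {RV P >-> state_seq L}) (s : {RV P >-> real_seq R})
  (X_max_entropy : max_entropy_measure N (distribution P X))
  (s_poisson : poisson_points P (expR (entropy (distribution P X))) s)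
  (X_s_independent : independent_rv P X s)
  (n : nat) (t : 'I_n -> R) (k : 'I_n -> 'Z_L)
  (tk_distinct : injective (fun a : 'I_n => (t a, k a))) :
  expR (entropy (distribution P X)) = sin (pi * N%:R / L%:R) / sin (pi / L%:R) /\
  (fine (P [set w | forall a : 'I_n, k a \in stones (X w) (s w) (t a)]))%:C%C =
  \det (\matrix_(a < n, b < n) stone_kernel N (t a - t b) (k b - k a)).
Proof.
have L_gt1 : (1 < L)%N by exact: leq_ltn_trans N_gt0 N_ltL.
have [ent law] := max_entropy_law L_gt1 N_gt0 N_ltL X_max_entropy.
have lamE : expR (entropy (distribution P X)) = lambda R L N.
  by rewrite ent lnK // posrE; exact: lambda_gt0.
split; first by rewrite lamE.
apply: pr_occupied => //; first exact: X_max_entropy.1.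
by rewrite -lamE.
Qed.
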